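(* Let $\sigma_1,\sigma_2\in L_2[0,1]$, let $P=[p_{kj}]_{k,j=1}^2\in M(L_1[0,1])$, let $d>0$, and for $\mu\ne0$ let $\tilde D(x,\mu)$ be the solution of the Cauchy problem \[ \tilde D'(x)+J(x)\tilde D(x)=A_\mu\tilde D(x)+\frac{P(x)}{\mu}\tilde D(x),\quad x\in[0,1],\qquad \tilde D(0)=I. \] If $\mu\in P_d$ and $|\mu|>2be^{2d}$, then \[ \tilde D(x,\mu)=\mathcal{R}(x,\mu)+\mathcal{R}_0(x,\mu),\qquad x\in[0,1], \] where \begin{align*} \mathcal{R}(x,\mu)&:=e^{xA_\mu}+D^{(0)}(x,\mu)+\frac1\mu e^{xA_\mu}\int_0^xe^{-tA_\mu}P(t)e^{tA_\mu}\,dt\\ &\quad+\frac1\mu D_0(x,\mu)\int_0^xe^{-tA_\mu}P(t)e^{tA_\mu}\,dt, \end{align*} \[ \mathcal{R}_0(x,\mu)=D^{(1)}(x,\mu)+\frac{R_2(x,\mu)}{\mu}+\tilde D_1(x,\mu), \] and the remainder satisfies, for all $x\in[0,1]$, \[ \|\mathcal{R}_0(x,\mu)\|_{M(\mathbb{C})}\le a_6\big(\gamma^2(\mu)+\gamma_1(\mu)+|\mu|^{-1}k_P(\mu)+|\mu|^{-2}\big), \] with a constant $a_6=a_6(d,\|\sigma_1\|_{L_2},\|\sigma_2\|_{L_2},\|P\|_{M(L_1)})$.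
   Context: $\sigma_1,\sigma_2$ and the entries of $P$ are complex-valued functions on $[0,1]$; $P_d:=\{\mu\in\mathbb{C}:|\mathrm{Im}\,\mu|\le d\}$ (not to be confused with the matrix $P$); \[ J(x)=\begin{bmatrix}0&\sigma_1(x)\\ \sigma_2(x)&0\end{bmatrix},\quad J_0=\begin{bmatrix}1&0\\0&-1\end{bmatrix},\quad A_\mu=i\mu J_0,\quad I=\begin{bmatrix}1&0\\0&1\end{bmatrix}. \] Solutions have absolutely continuous entries and satisfy the equation a.e. For a Banach space $X$, $M(X)$ is the space of $2\times2$ matrices with entries in $X$, with norm $\|F\|_{M(X)}=\sum_{k,j=1}^2\|F_{kj}\|_X$; $L_p=L_p[0,1]$. Constants: $l_0=\max\{\|\sigma_1\|_{L_1},\|\sigma_2\|_{L_1}\}$, $l=\|\sigma_1\|_{L_1}\|\sigma_2\|_{L_1}$, $l_1=\|\sigma_1\|_{L_1}+\|\sigma_2\|_{L_1}$, $\tilde l=\|\sigma_1\|_{L_2}\|\sigma_2\|_{L_2}$, $a=1+l_1+2\tilde l(1+l_0)e^{l}$, $b=a^2\|P\|_{M(L_1[0,1])}$. With $\sigma_0(x)=|\sigma_1(x)|+|\sigma_2(x)|$, \[ \gamma(\mu)=\sum_{j=1}^2\Big(\Big\|\int_0^xe^{-2i\mu t}\sigma_j(t)dt\Big\|_{L_2}+\Big\|\int_0^xe^{2i\mu t}\sigma_j(t)dt\Big\|_{L_2}\Big) \] ($L_2$-norms in $x\in[0,1]$), \[ \gamma_0(x,\mu)=\sum_{j=1}^2\Big(\Big|\int_0^xe^{-2i\mu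 t}\sigma_j(t)dt\Big|+\Big|\int_0^xe^{2i\mu t}\sigma_j(t)dt\Big|\Big), \] \[ \gamma_1(\mu)=\int_0^1\sigma_0(s)\gamma_0^2(s,\mu)\,ds,\qquad k_P(\mu)=\int_0^1\|P(t)\|_{M(\mathbb{C})}\gamma_0(t,\mu)\,dt. \] Let $\Delta=\{(x,t):0\le t\le x\le1\}$. For $(x,t)\in\Delta$ put $\tilde\sigma_1(x,t)=\int_0^{x-t}\sigma_1(t+\xi)\sigma_2(\xi)d\xi$, $\tilde\sigma_2(x,t)=\int_0^{x-t}\sigma_2(t+\xi)\sigma_1(\xi)d\xi$, and for $f\in C(\Delta)$ put $(T_{\sigma_j}f)(x,t)=\int_0^{x-t}\sigma_j(t+\xi)f(t+\xi,\xi)d\xi$; let \[ N(x,t)=\begin{bmatrix}\tilde\sigma_1(x,t)&-(T_{\sigma_1}\tilde\sigma_2)(x,t)\\-(T_{\sigma_2}\tilde\sigma_1)(x,t)&\tilde\sigma_2(x,t)\end{bmatrix}. \] Define \[ D_0(x,\mu)=-\int_0^xe^{(x-2t)A_\mu}J(t)\,dt,\qquad D^{(0)}(x,\mu)=D_0(x,\mu)+\int_0^xe^{(x-2t)A_\mu}N(x,t)\,dt. \] Let $D(x,\mu)$ be the solution of the unperturbed problem $D'+JD=A_\mu D$, $D(0)=I$. Then $D^{(1)}:=D-e^{xA_\mu}-D^{(0)}$, $R_0:=D-e^{xA_\mu}-D_0$, $R_1(t,\mu):=D^{-1}(t,\mu)P(t)D(t,\mu)-e^{-tA_\mu}P(t)e^{tA_\mu}$,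 \[ R_2(x,\mu):=R_0(x,\mu)\int_0^xe^{-tA_\mu}P(t)e^{tA_\mu}dt+D(x,\mu)\int_0^xR_1(t,\mu)\,dt, \] \[ \tilde D_1(x,\mu):=\tilde D(x,\mu)-D(x,\mu)-\frac1\mu D(x,\mu)\int_0^xD^{-1}(t,\mu)P(t)D(t,\mu)\,dt. \] *)

(* Defs.v *)
From HB Require Import structures.
From mathcomp Require Import all_boot all_order all_algebra.
From mathcomp Require Import all_classical all_reals all_analysis.
From mathcomp Require Import complex.

Set Implicit Arguments.
Unset Strict Implicit.
Unset Printing Implicit Defensive.

Import Order.TTheory GRing.Theory Num.Theory.
Import numFieldNormedType.Exports.

Local Open Scope classical_set_scope.
Local Open Scope ring_scope.

Section ComplexAnalysis.
Context {R : realType}.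
Local Notation C := R[i].
Local Notation leb := (@lebesgue_measure R).
Implicit Types (D : set R) (f : R -> C).

(* The library norm on R[i] is itself R[i]-valued. *)
Definition cabs (z : C) : R := complex.Re `|z|.

Definition cexp (z : C) : C :=
  Complex (expR (complex.Re z) * cos (complex.Im z))
          (expR (complex.Re z) * sin (complex.Im z)).

Definition cint D f : C :=
  Complex (\int[leb]_(t in D) complex.Re (f t))
          (\int[leb]_(t in D) complex.Im (f t)).

(* L_p[0,1] consists of functions on [0,1]: values elsewhere are irrelevant. *)
Definition eLnorm (p : R) f : \bar R :=
  'N[leb]_(p%:E)[(fun x => (cabs (f x))%:E) \_ `[0, 1]].

Definition Lp_norm (p : R) f : R := fine (eLnorm p f).

Definition in_Lp (p : R) f : Prop :=
  [/\ measurable_fun (`[0, 1] : set R) (fun x => complex.Re (f x)),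
      measurable_fun (`[0, 1] : set R) (fun x => complex.Im (f x)) &
      (eLnorm p f < +oo)%E].

Definition abs_continuous f : Prop :=
  forall e : R, 0 < e -> exists2 del : R, 0 < del &
    forall (n : nat) (a b : 'I_n -> R),
      (forall i, [/\ 0 <= a i, a i <= b i & b i <= 1]) ->
      trivIset [set: 'I_n] (fun i => `]a i, b i[%classic) ->
      \sum_(i < n) (b i - a i) < del ->
      \sum_(i < n) cabs (f (b i) - f (a i)) < e.

Definition has_derivative f (x : R) (v : C) : Prop :=
  is_derive x 1 (fun t => complex.Re (f t)) (complex.Re v) /\
  is_derive x 1 (fun t => complex.Im (f t)) (complex.Im v).

End ComplexAnalysis.

Section Matrices.
Context {R : realType}.
Local Notation C := R[i].
Local Notation M2 := 'M[C]_2.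

Definition mx2 (a b c d : C) : M2 :=
  \matrix_(i < 2, j < 2)
    if i == 0 then (if j == 0 then a else b) else (if j == 0 then c else d).

Definition mint (D : set R) (F : R -> M2) : M2 :=
  \matrix_(k < 2, j < 2) cint D (fun t => F t k j).

Definition normMC (A : M2) : R := \sum_(k < 2) \sum_(j < 2) cabs (A k j).

Definition normML (p : R) (F : R -> M2) : R :=
  \sum_(k < 2) \sum_(j < 2) Lp_norm p (fun x => F x k j).

Definition in_ML (p : R) (F : R -> M2) : Prop :=
  forall k j : 'I_2, in_Lp p (fun x => F x k j).

Definition mx_abs_continuous (Y : R -> M2) : Prop :=
  forall k j : 'I_2, abs_continuous (fun x => Y x k j).

Definition mx_has_derivative (Y : R -> M2) (x : R) (V : M2) : Prop :=
  forall k j : 'I_2, has_derivative (fun t => Y t k j) x (V k j).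

End Matrices.

Section Dirac.
Context {R : realType}.
Local Notation C := R[i].
Local Notation M2 := 'M[C]_2.
Local Notation leb := (@lebesgue_measure R).
Local Notation "x %:C" := (real_complex R x).
Implicit Types (P D Dt : R -> M2) (mu : C) (x t : R).

Definition strip (d : R) : set C := [set mu | `|complex.Im mu| <= d].

Definition Jmx (s1 s2 : R -> C) x : M2 := mx2 0 (s1 x) (s2 x) 0.
Definition J0 : M2 := mx2 1 0 0 (-1).
Definition Amx mu : M2 := ('i%C * mu) *: J0.

(* exp(x A_mu), the exponential of a diagonal matrix. *)
Definition expA x mu : M2 :=
  mx2 (cexp (x%:C * ('i%C * mu))) 0 0 (cexp (- (x%:C * ('i%C * mu)))).

Definition unperturbed_sol (s1 s2 : R -> C) mu D : Prop :=
  [/\ mx_abs_continuous D,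
      {ae leb, forall x, x \in `[0, 1] -> exists2 V : M2,
        mx_has_derivative D x V & V + Jmx s1 s2 x *m D x = Amx mu *m D x} &
      D 0 = 1%:M].

Definition perturbed_sol (s1 s2 : R -> C) P mu Dt : Prop :=
  [/\ mx_abs_continuous Dt,
      {ae leb, forall x, x \in `[0, 1] -> exists2 V : M2,
        mx_has_derivative Dt x V &
        V + Jmx s1 s2 x *m Dt x
          = Amx mu *m Dt x + (mu^-1 *: P x) *m Dt x} &
      Dt 0 = 1%:M].

Definition const_l0 (s1 s2 : R -> C) : R := Num.max (Lp_norm 1 s1) (Lp_norm 1 s2).
Definition const_l (s1 s2 : R -> C) : R := Lp_norm 1 s1 * Lp_norm 1 s2.
Definition const_l1 (s1 s2 : R -> C) : R := Lp_norm 1 s1 + Lp_norm 1 s2.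
Definition const_lt (s1 s2 : R -> C) : R := Lp_norm 2 s1 * Lp_norm 2 s2.
Definition const_a (s1 s2 : R -> C) : R :=
  1 + const_l1 s1 s2
  + 2 * const_lt s1 s2 * (1 + const_l0 s1 s2) * expR (const_l s1 s2).
Definition const_b (s1 s2 : R -> C) P : R := const_a s1 s2 ^+ 2 * normML 1 P.

Definition osc_minus (s : R -> C) mu x : C :=
  cint `[0, x] (fun t => cexp (- (2 * 'i%C * mu * t%:C)) * s t).
Definition osc_plus (s : R -> C) mu x : C :=
  cint `[0, x] (fun t => cexp (2 * 'i%C * mu * t%:C) * s t).

Definition sigma0 (s1 s2 : R -> C) x : R := cabs (s1 x) + cabs (s2 x).

Definition gamma (s1 s2 : R -> C) mu : R :=
  \sum_(s <- [:: s1; s2])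
    (Lp_norm 2 (osc_minus s mu) + Lp_norm 2 (osc_plus s mu)).

Definition gamma0 (s1 s2 : R -> C) x mu : R :=
  \sum_(s <- [:: s1; s2]) (cabs (osc_minus s mu x) + cabs (osc_plus s mu x)).

Definition gamma1 (s1 s2 : R -> C) mu : R :=
  \int[leb]_(s in `[0, 1]) (sigma0 s1 s2 s * gamma0 s1 s2 s mu ^+ 2).

Definition kP (s1 s2 : R -> C) P mu : R :=
  \int[leb]_(t in `[0, 1]) (normMC (P t) * gamma0 s1 s2 t mu).

Definition sigma_conv (s s' : R -> C) x t : C :=
  cint `[0, x - t] (fun xi => s (t + xi) * s' xi).

Definition Tconv (s : R -> C) (f : R -> R -> C) x t : C :=
  cint `[0, x - t] (fun xi => s (t + xi) * f (t + xi) xi).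

Definition Nmx (s1 s2 : R -> C) x t : M2 :=
  let st1 := sigma_conv s1 s2 in
  let st2 := sigma_conv s2 s1 in
  mx2 (st1 x t) (- Tconv s1 st2 x t) (- Tconv s2 st1 x t) (st2 x t).

Definition D_0 (s1 s2 : R -> C) x mu : M2 :=
  - mint `[0, x] (fun t => expA (x - 2 * t) mu *m Jmx s1 s2 t).

Definition D_sup0 (s1 s2 : R -> C) x mu : M2 :=
  D_0 s1 s2 x mu
  + mint `[0, x] (fun t => expA (x - 2 * t) mu *m Nmx s1 s2 x t).

(* Below, [D] and [Dt] stand for D(., mu) and \tilde D(., mu) at the given
   value of [mu]. *)
Definition D_sup1 (s1 s2 : R -> C) D x mu : M2 := D x - expA x mu - D_sup0 s1 s2 x mu.

Definition R_0 (s1 s2 : R -> C) D x mu : M2 := D x - expA x mu - D_0 s1 s2 x mu.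

Definition conjP P t mu : M2 := expA (- t) mu *m P t *m expA t mu.

Definition conjPD P D t : M2 := invmx (D t) *m P t *m D t.

Definition R_1 P D t mu : M2 := conjPD P D t - conjP P t mu.

Definition R_2 (s1 s2 : R -> C) P D x mu : M2 :=
  R_0 s1 s2 D x mu *m mint `[0, x] (fun t => conjP P t mu)
  + D x *m mint `[0, x] (fun t => R_1 P D t mu).

Definition Dt_1 P D Dt x mu : M2 :=
  Dt x - D x - mu^-1 *: (D x *m mint `[0, x] (conjPD P D)).

Definition main_part (s1 s2 : R -> C) P x mu : M2 :=
  expA x mu + D_sup0 s1 s2 x mu
  + mu^-1 *: (expA x mu *m mint `[0, x] (fun t => conjP P t mu))
  + mu^-1 *: (D_0 s1 s2 x mu *m mint `[0, x] (fun t => conjP P t mu)).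

Definition remainder (s1 s2 : R -> C) P D Dt x mu : M2 :=
  D_sup1 s1 s2 D x mu + mu^-1 *: R_2 s1 s2 P D x mu + Dt_1 P D Dt x mu.

End Dirac.

(* Main.v *)
Require Import Defs.
From mathcomp Require Import all_boot all_order all_algebra.
From mathcomp Require Import all_classical all_reals all_analysis.
From mathcomp Require Import measurable_realfun.
From mathcomp Require Import complex ring lra.

Set Implicit Arguments.
Unset Strict Implicit.
Unset Printing Implicit Defensive.

Import Order.TTheory GRing.Theory Num.Theory.
Import numFieldNormedType.Exports.
Local Open Scope classical_set_scope.
Local Open Scope ring_scope.

(** Conjugating the system by the diagonal exponential E(x) = expA x mu removes
    the spectral term.  With Y = E^-1 D one gets the Volterra equation
    Y' = - K Y, Y(0) = I, whose kernel K = E^-1 J E is off-diagonal with entries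
    e^(-2 i mu t) sigma1(t) and e^(2 i mu t) sigma2(t).  Put B = int K,
    Y2 = int K B and T3 = int K Y2.

    The entries of B are the oscillatory integrals which make up gamma0, so
    |B| <= gamma0, and D_0 = - E B.  Interchanging the order of integration over
    a triangle (after the shear (t, u) |-> (t + u, u)) turns the convolutions in
    the matrix N into iterated integrals, and D^(0) = E (- B + Y2 - T3)
    ([D_sup0E]).  Hence D^(1) = E Z, where Z is the tail of the Neumann series.
    Its source term is the fourth iterate int K T3; integrating by parts,
    T3 = B Y2 - int B K B, so this iterate is bounded by q^2 plus a multiple of
    Gamma, where q = int |K| |B| and Gamma = int |K| |B|^2.  The inequality of
    Cauchy and Schwarz gives q^2 <= (1 + int |K|) Gamma, and Gamma is bounded by
    a multiple of gamma_1: with Gronwall's inequality, D^(1) = O(gamma_1)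
    ([D_sup1_le]).  In the same way D - E - D_0 = O(q) and Y - I = O(|B| + q).

    Since K has trace zero, Y^-1 is the adjugate of Y, and
    D^-1 P D = Y^-1 (E^-1 P E) Y differs from E^-1 P E by at most a multiple of
    |P| (gamma0 + q).  This bounds R_2 by O(k_P + q) ([R_2_le]), and
    |mu|^-1 q <= q^2 + |mu|^-2.  Finally W = D^-1 Dt satisfies
    W' = mu^-1 (D^-1 P D) W, W(0) = I, so that the first order expansion of Dt
    has an error O(|mu|^-2) ([Dt_1_le]); the lower bound on |mu| keeps the
    exponent in Gronwall's inequality for W bounded, because the constant a of
    the statement is at least 1.

    All differential equations are used in integrated form.  This rests on the
    fundamental theorem of calculus for absolutely continuous functions
    ([ac_prim], from [ac_derive0_const]), which makes products of primitives
    primitives again ([primM]).  Integrals of complex functions are estimated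
    through real and imaginary parts, which costs harmless factors 2. *)

(** * Absolutely continuous functions with zero derivative are constant *)

Section AbsoluteContinuity.
Context {R : realType}.
Local Notation leb := (@lebesgue_measure R).
Implicit Types (f g h : R -> R) (x y z : R).

(** Absolute continuity on [0, 1] of a real function. *)
Definition ac f : Prop :=
  forall e : R, 0 < e -> exists2 del : R, 0 < del &
    forall (n : nat) (a b : 'I_n -> R),
      (forall i, [/\ 0 <= a i, a i <= b i & b i <= 1]) ->
      trivIset [set: 'I_n] (fun i => `]a i, b i[%classic) ->
      \sum_(i < n) (b i - a i) < del ->
      \sum_(i < n) `|f (b i) - f (a i)| < e.

(** The point [y] is reached from 0 with an increment of [g] of at most
    [e * y], up to the increments over finitely many ordered intervals whose
    interiors lie in [U]. *)
Definition chained (U : set R) (e : R) g y : Prop :=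
  exists n (a b : nat -> R),
    [/\ forall i, (i < n)%N -> [/\ 0 <= a i, a i <= b i & b i <= y],
        forall i j, (i < j < n)%N -> b i <= a j,
        forall i, (i < n)%N -> `]a i, b i[ `<=` U &
        `|g y - g 0| <= e * y + \sum_(i < n) `|g (b i) - g (a i)|].

Lemma chained0 U e g : chained U e g 0.
Proof.
exists 0%N, (fun=> 0), (fun=> 0); split => //.
by rewrite subrr normr0 big_ord0 mulr0 addr0.
Qed.

Lemma chained_slope U e g y z : 0 <= y <= z -> `|g z - g y| <= e * (z - y) ->
  chained U e g y -> chained U e g z.
Proof.
move=> /andP[y0 yz] gzy [n [a [b [ab sab abU gy]]]].
exists n, a, b; split => //.
  by move=> i /ab[? ? biy]; split => //; exact: le_trans biy yz.
have -> : g z - g 0 = (g z - g y) + (g y - g 0) by ring.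
rewrite (le_trans (ler_normD _ _))//.
have -> : e * z = e * (z - y) + e * y by ring.
by rewrite -addrA lerD.
Qed.

Lemma chained_open U e g y z : 0 <= y <= z -> 0 <= e -> `]y, z[ `<=` U ->
  chained U e g y -> chained U e g z.
Proof.
move=> /andP[y0 yz] e0 yzU [n [a [b [ab sab abU gy]]]].
exists n.+1, (fun i => if i == n then y else a i),
  (fun i => if i == n then z else b i); split.
- move=> i; rewrite ltnS leq_eqVlt => /predU1P[->|lein]; first by rewrite eqxx.
  rewrite ltn_eqF//; have [? ? biy] := ab i lein.
  by split => //; exact: le_trans biy yz.
- move=> i j /andP[ij]; rewrite ltnS leq_eqVlt => /predU1P[jn|jn].
    rewrite jn eqxx ltn_eqF -?jn//; rewrite jn in ij.
    by have [] := ab i ij.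
  by rewrite !ltn_eqF ?(ltn_trans ij jn)// sab// ij.
- move=> i; rewrite ltnS leq_eqVlt => /predU1P[->|lein]; first by rewrite eqxx.
  by rewrite ltn_eqF//; exact: abU.
rewrite big_ord_recr/= eqxx.
under eq_bigr => i _ do rewrite ltn_eqF//.
have -> : g z - g 0 = (g y - g 0) + (g z - g y) by ring.
rewrite (le_trans (ler_normD _ _))// addrA lerD//.
by rewrite (le_trans gy)// lerD// ler_wpM2l.
Qed.

(** If [g] satisfies the absolute continuity condition for [(e, del)], the
    intervals inside a set of measure less than [del] contribute at most [e]. *)
Lemma chained_ac_le U e del g x : 0 <= x <= 1 -> 0 <= e ->
  open U -> (leb U < del%:E)%E ->
  (forall (n : nat) (a b : 'I_n -> R),
      (forall i, [/\ 0 <= a i, a i <= b i & b i <= 1]) ->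
      trivIset [set: 'I_n] (fun i => `]a i, b i[%classic) ->
      \sum_(i < n) (b i - a i) < del ->
      \sum_(i < n) `|g (b i) - g (a i)| < e) ->
  chained U e g x -> `|g x - g 0| <= e + e.
Proof.
move=> /andP[x0 x1] e0 oU Udel acg [n [a [b [ab sab abU gx]]]].
have tI : trivIset [set: 'I_n] (fun i : 'I_n => `]a i, b i[%classic).
  have Hlt (i j : 'I_n) t : (i < j)%N -> `]a i, b i[%classic t ->
      `]a j, b j[%classic t -> False.
    move=> ij /=; rewrite !in_itv/= => /andP[_ tb] /andP[atj _].
    have := sab i j; rewrite ij ltn_ord => /(_ isT); lra.
  move=> i j _ _ [t [ti tj]]; apply/val_inj.
  case: (ltngtP i j) => // ij; exfalso.
  - exact: (Hlt i j t).
  - exact: (Hlt j i t).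
have/acg : \sum_(i < n) (b i - a i) < del.
  rewrite -lte_fin (le_lt_trans _ Udel)//.
  have -> : (\sum_(i < n) (b i - a i))%:E =
      leb (\big[setU/set0]_(i < n) `]a i, b i[%classic).
    rewrite measure_bigsetU_ord// -sumEFin; apply: eq_bigr => i _.
    have [_ + _] := ab i (ltn_ord i).
    rewrite le_eqVlt => /predU1P[->|aibi].
      by rewrite subrr set_itvoo0 measure0.
    by rewrite [RHS]lebesgue_measure_itv/= lte_fin aibi.
  apply: le_measure; rewrite ?inE//=.
  - exact: bigsetU_measurable.
  - exact: open_measurable.
  - apply: (big_ind (fun A => A `<=` U)) => // [A B AU BU|i _].
      by rewrite subUset.
    exact: abU.
move=> sle.
rewrite (le_trans gx)// lerD//; first by rewrite ler_piMr.
apply/ltW/sle => //.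
move=> i; have [? ? ?] := ab i (ltn_ord i); split => //; lra.
Qed.

(** Induction along [0, x]: a property of 0 which crosses every point of the
    interval holds at [x]. *)
Lemma real_induction (Q : R -> Prop) x : 0 <= x -> Q 0 ->
  (forall s, 0 <= s <= x -> exists2 r, 0 < r &
     forall y z, 0 <= y <= s -> s <= z <= x -> s - r < y -> z < s + r ->
     Q y -> Q z) -> Q x.
Proof.
move=> x0 Q0 step.
pose S := [set y | 0 <= y <= x /\ Q y].
have S0 : S 0 by split => //; rewrite lexx.
have Sx : ubound S x by move=> y [/andP[]].
have hS : has_sup S by split; [exists 0|exists x].
have s0 : 0 <= sup S by exact: ub_le_sup hS.2 _ S0.
have sx : sup S <= x by apply: ge_sup => //; exists 0.
have [|r r0 hr] := step (sup S); first by rewrite s0 sx.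
have [y Sy ry] := sup_adherent r0 hS.
have yS : y <= sup S by exact: ub_le_sup hS.2 _ Sy.
have [/andP[y0 yx] Qy] := Sy.
pose z := Num.min x (sup S + r / 2).
have zs : sup S <= z by rewrite /z le_min sx/=; lra.
have zx : z <= x by rewrite /z ge_min lexx.
have zr : z < sup S + r by rewrite /z gt_min; apply/orP; right; lra.
have Qz : Q z.
  by apply: (hr y z) => //; apply/andP; split => //; lra.
have : z <= sup S.
  apply: (ub_le_sup hS.2); split => //; apply/andP; split => //; lra.
move: Qz; rewrite /z minEle; case: ifP => // _ _; lra.
Qed.

Lemma derive0_slope g x (e : R) : 0 < e -> is_derive x 1 g 0 ->
  exists2 r, 0 < r & forall y, `|y - x| < r -> `|g y - g x| <= e * `|y - x|.
Proof.
move=> e0 [dg gx].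
have : h^-1 *: (g (h *: 1 + x) - g x) @[h --> (0:R)^'] --> (0 : R).
  by rewrite -[X in _ --> X]gx; exact: dg.
move=> /cvgrPdist_le /(_ _ e0) /nbhs_ballP[r /= r0 hr].
exists r => // y yx; have [->|yNx] := eqVneq y x.
  by rewrite !subrr normr0 mulr0.
have := hr (y - x); rewrite /ball/= sub0r normrN => /(_ yx).
rewrite subr_eq0 => /(_ yNx).
have -> : (y - x) *: (1 : R) + x = y by rewrite /GRing.scale/=; ring.
rewrite sub0r normrN normrZ normfV ler_pdivrMl ?normr_gt0 ?subr_eq0//.
by rewrite mulrC.
Qed.

(** The exceptional null set is covered by an open set of small measure; away
    from it the increments are controlled by the derivative, inside it by
    absolute continuity. *)
Lemma ac_derive0_const g : ac g ->
  {ae leb, forall x, x \in `]0, 1[ -> is_derive x 1 g 0} ->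
  forall x, 0 <= x <= 1 -> g x = g 0.
Proof.
move=> acg [N [mN N0 dg]] x /andP[x0 x1].
apply/eqP; rewrite -subr_eq0 -normr_le0; apply/ler_addgt0Pl => e e0.
rewrite addr0; have {}e0 : 0 < e / 2 by lra.
have [del del0 gdel] := acg _ e0.
have mN' : measurable (N `|` [set 0] `|` [set 1]).
  by do 2 apply: measurableU => //; exact: measurable_set1.
have N'0 : leb (N `|` [set 0] `|` [set 1]) = 0%E.
  rewrite measureU0; [|exact: measurableU|by []|exact: lebesgue_measure_set1].
  by rewrite measureU0; [|by []|by []|exact: lebesgue_measure_set1].
have [|U [oU NU Udel]] := @lebesgue_regularity_outer R _ _ mN' _ del0.
  by rewrite [X in (X < _)%E]N'0.
have {}Udel : (leb U < del%:E)%E.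
  rewrite -[U](setDKU NU) measureU0//.
  by apply: measurableD => //; exact: open_measurable.
suff : chained U (e / 2) g x.
  move/(chained_ac_le _ (ltW e0) oU Udel gdel); rewrite x0 x1 => /(_ isT).
  lra.
apply: real_induction => //; first exact: chained0.
move=> s /andP[s0 sx].
have [Us|Us] := pselect (U s).
  have /nbhs_ballP[r /= r0 rU] := open_nbhs_nbhs (conj oU Us).
  exists r => // y z /andP[y0 ys] /andP[sz zx] sy zs.
  apply: chained_open; [by rewrite y0 (le_trans ys)|exact: ltW|].
  move=> t/=; rewrite in_itv/= => /andP[yt tz]; apply: rU.
  by rewrite /ball/= ltr_distlC; lra.
have sN : ~ (N `|` [set 0] `|` [set 1]) s by move/NU.
have ds : is_derive s 1 g 0.
  apply: contrapT => nds; apply: sN; left; left; apply: dg => /= H; apply: nds.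
  apply: H; rewrite in_itv/= !lt_neqAle s0 (le_trans sx x1) !andbT.
  apply/andP; split; apply/eqP => s01; apply/Us/NU.
    by left; right; rewrite /= -s01.
  by right; rewrite /= s01.
have [r r0 hr] := derive0_slope e0 ds.
exists r => // y z /andP[y0 ys] /andP[sz zx] sy zs.
apply: chained_slope; first by rewrite y0 (le_trans ys).
have -> : g z - g y = (g z - g s) - (g y - g s) by ring.
rewrite (le_trans (ler_normB _ _))//.
have := hr z; rewrite (ger0_norm (_ : 0 <= z - s)) ?subr_ge0//.
have -> : z - s < r by lra.
move=> /(_ isT); have := hr y; rewrite distrC (ger0_norm (_ : 0 <= s - y)) ?subr_ge0//.
have -> : s - y < r by lra.
move=> /(_ isT); lra.
Qed.

End AbsoluteContinuity.

(** * The fundamental theorem of calculus for the Lebesgue integral *)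

Section Primitives.
Context {R : realType}.
Local Notation leb := (@lebesgue_measure R).
Local Notation inte h := (leb.-integrable `[0, 1] (EFin \o h)).
Local Notation rint h x := (\int[leb]_(t in `[0, x]) h t).
Implicit Types (f g h k : R -> R) (x y z : R).

(** [f] is, on [0, 1], an indefinite Lebesgue integral of [h]. *)
Definition prim f h : Prop :=
  inte h /\ forall x, 0 <= x <= 1 -> f x = f 0 + rint h x.

Lemma inteS (A : set R) h : measurable A -> A `<=` `[0, 1] -> inte h ->
  leb.-integrable A (EFin \o h).
Proof. by move=> mA A01; apply: integrableS. Qed.

Lemma inteD h k : inte h -> inte k -> inte (fun x => h x + k x).
Proof.
move=> ih ik; have : leb.-integrable `[0, 1] ((EFin \o h) \+ (EFin \o k))%E.
  exact: integrableD.
exact: eq_integrable.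
Qed.

Lemma eq_inte h k : (forall x, 0 <= x <= 1 -> h x = k x) -> inte h -> inte k.
Proof.
move=> hk; apply: eq_integrable => // x; rewrite inE/= in_itv/= => x01.
by rewrite hk.
Qed.

Lemma sub_itv0 x : x <= 1 -> `[0, x] `<=` (`[0, 1] : set R).
Proof. by move=> x1 t /=; rewrite !in_itv/= => /andP[-> /le_trans]; exact. Qed.

Lemma rint0 h : rint h 0 = 0.
Proof. by rewrite set_itv1 Rintegral_set1. Qed.

Lemma rint_sub h x y : inte h -> 0 <= x -> x <= y -> y <= 1 ->
  rint h y - rint h x = \int[leb]_(t in `]x, y]) h t.
Proof.
move=> ih x0 xy y1; apply: Rintegral_itvB; rewrite ?bnd_simp//.
by apply: inteS ih => //; exact: sub_itv0.
Qed.

(** Absolute continuity of the integral. *)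
Lemma ac_rint h : inte h -> ac (fun x => rint h x).
Proof.
move=> ih e e0.
pose h' := h \_ `[0, 1].
have ih' : leb.-integrable setT (EFin \o h').
  by move/integrable_mkcond : ih => /(_ (measurable_itv _)); rewrite restrict_EFin.
have [del [del0 hdel]] := integral_normr_continuous ih' e0.
exists del => // n a b ab tI sdel.
pose U := \big[setU/set0]_(i < n) `]a i, b i[%classic.
have mU : measurable U by exact: bigsetU_measurable.
have muU : (leb U < del%:E)%E.
  rewrite measure_bigsetU_ord//.
  rewrite (eq_bigr (fun i : 'I_n => (b i - a i)%:E)) ?sumEFin ?lte_fin// => i _.
  have [_ + _] := ab i.
  rewrite le_eqVlt => /predU1P[->|aibi].
    by rewrite subrr set_itvoo0 measure0.
  by rewrite [LHS]lebesgue_measure_itv/= lte_fin aibi.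
apply: le_lt_trans (hdel U mU muU).
have ih'U : leb.-integrable U (EFin \o (Num.norm \o h')).
  by apply/integrable_norm; apply: integrableS ih'.
have mh' : measurable_fun setT h' by apply/measurable_EFinP; case/integrableP : ih'.
have -> : \int[leb]_(x in U) `|h' x| =
    \sum_(i < n) \int[leb]_(x in `]a i, b i[) `|h' x|.
  rewrite /Rintegral ge0_integral_bigsetU//=.
  - rewrite -sum_fine// => i _; apply: integrable_fin_num => //.
    by apply: integrable_norm; apply: integrableS ih'.
  - exact: index_enum_uniq.
  - by apply: sub_trivIset tI => i.
  - by apply/measurable_EFinP; apply: measurableT_comp => //; exact: measurable_funTS.
apply: ler_sum => i _; have [a0 aibi b1] := ab i.
rewrite rint_sub// Rintegral_itv_bndo_bndc; last first.
  by apply: integrable_norm; apply: integrableS ih'.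
have abS : `]a i, b i]%classic `<=` `[0, 1].
  by move=> t /=; rewrite !in_itv/= => /andP[/ltW at_ tb]; lra.
have -> : \int[leb]_(x in `]a i, b i]) h x = \int[leb]_(x in `]a i, b i]) h' x.
  by apply: eq_Rintegral => t; rewrite inE => /abS ?; rewrite /h' patchE mem_set.
by apply: le_normr_Rintegral => //; apply: integrableS ih'.
Qed.

(** Lebesgue differentiation theorem for the indefinite integral. *)
Lemma ae_derive_rint h : inte h ->
  {ae leb, forall x, x \in `]0, 1[ -> is_derive x 1 (fun x => rint h x) (h x)}.
Proof.
move=> ih.
pose h' := h \_ `[0, 1].
have ih' : leb.-integrable setT (EFin \o h').
  by move/integrable_mkcond : ih => /(_ (measurable_itv _)); rewrite restrict_EFin.
have lh' : locally_integrable setT h' by exact: integrable_locally.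
have := @FTC1 R h' (BLeft 0) (fun y => _) lh'.
have H y : leb.-integrable [set` Interval (BLeft 0) (BRight y)] (EFin \o h').
  by apply: integrableS ih'.
move=> /(_ H); apply: (@filterS _ _ (ae_filter_ringOfSetsType leb)) => x /= hx.
rewrite in_itv/= => /andP[x0 x1].
have [|dx dhx] := hx; first by rewrite lte_fin.
have hxE : h' x = h x by rewrite /h' patchE mem_set//= in_itv/= !ltW.
have dx' : is_derive x 1 (fun x => rint h' x) (h x).
  by rewrite -hxE -dhx derive1E; exact/derivableP.
apply: near_eq_is_derive dx'.
near=> y.
apply: eq_Rintegral => t; rewrite inE/= in_itv/= => /andP[t0 ty].
rewrite /h' patchE mem_set//= in_itv/= t0/= (le_trans ty)//.
have : y \in `]0, 1[ by near: y; apply: near_in_itvoo; rewrite in_itv/= x0.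
by rewrite in_itv/= => /andP[_ /ltW].
Unshelve. all: by end_near. Qed.

Lemma acD f g : ac f -> ac g -> ac (fun x => f x + g x).
Proof.
move=> acf acg e e0; have e2 : 0 < e / 2 by lra.
have [d1 d10 h1] := acf _ e2; have [d2 d20 h2] := acg _ e2.
exists (Num.min d1 d2); first by rewrite lt_min d10.
move=> n a b ab tI; rewrite lt_min => /andP[sd1 sd2].
have := h1 n a b ab tI sd1; have := h2 n a b ab tI sd2.
suff : \sum_(i < n) `|f (b i) + g (b i) - (f (a i) + g (a i))| <=
  \sum_(i < n) `|f (b i) - f (a i)| + \sum_(i < n) `|g (b i) - g (a i)| by lra.
rewrite -big_split/=; apply: ler_sum => i _.
rewrite (_ : _ - _ = (f (b i) - f (a i)) + (g (b i) - g (a i))); last by ring.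
exact: ler_normD.
Qed.

Lemma ac_dominated f g (M : R) : ac f ->
  (forall x y, 0 <= x -> x <= y -> y <= 1 -> `|g y - g x| <= M * `|f y - f x|) ->
  ac g.
Proof.
move=> acf gf e e0.
have M0 : 0 < `|M| + 1 by rewrite ltr_pwDr.
have eM : 0 < e / (`|M| + 1) by rewrite divr_gt0.
have [d d0 hd] := acf _ eM; exists d => // n a b ab tI sd.
have := hd n a b ab tI sd; rewrite ltr_pdivlMr// mulrC mulr_sumr.
apply: le_lt_trans; apply: ler_sum => i _; have [? ? ?] := ab i.
by rewrite (le_trans (gf _ _ _ _ _))// ler_wpM2r// (le_trans (ler_norm _))// lerDl.
Qed.

Lemma ac_cst (c : R) : ac (fun=> c).
Proof.
move=> e e0; exists 1 => // n a b _ _ _.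
by rewrite big1// => i _; rewrite subrr normr0.
Qed.

Lemma acN f : ac f -> ac (fun x => - f x).
Proof.
move=> acf; apply: (ac_dominated (M := 1)) acf _ => x y _ _ _.
by rewrite mul1r -opprD normrN.
Qed.

(** Fundamental theorem of calculus for absolutely continuous functions: the
    difference with the integral of the derivative has derivative 0 a.e. *)
Lemma ac_prim f h : ac f -> inte h ->
  {ae leb, forall x, x \in `]0, 1[ -> is_derive x 1 f (h x)} -> prim f h.
Proof.
move=> acf ih df; split => // x x01.
pose g t := f t + - rint h t.
have acg : ac g by apply: acD => //; apply: acN; exact: ac_rint.
have dg : {ae leb, forall x, x \in `]0, 1[ -> is_derive x 1 g 0}.
  have := ae_derive_rint ih.
  apply: (@filterS2 _ _ (ae_filter_ringOfSetsType leb)) df => t /= H1 H2 t01.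
  have d1 := H1 t01; have d2 := H2 t01.
  have := @is_deriveB _ _ _ _ _ _ _ _ _ d1 d2.
  by rewrite subrr.
have := ac_derive0_const acg dg x01; rewrite /g rint0 oppr0 addr0 => <-.
by rewrite subrK.
Qed.

Lemma prim_ac f h : prim f h -> ac f.
Proof.
move=> [ih fE]; apply: (ac_dominated (M := 1)) (ac_rint ih) _ => x y x0 xy y1.
rewrite mul1r (fE y) ?(fE x) ?x0 ?y1 ?(le_trans xy) ?(le_trans x0)//.
by rewrite (_ : _ - (_ + _) = rint h y - rint h x)//; ring.
Qed.

Lemma prim_derive f h : prim f h ->
  {ae leb, forall x, x \in `]0, 1[ -> is_derive x 1 f (h x)}.
Proof.
move=> [ih fE]; have := ae_derive_rint ih; apply: (@filterS _ _ (ae_filter_ringOfSetsType leb)) => x /= H x01.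
have := @is_deriveD _ _ _ (cst (f 0)) _ x 1 0 _ (is_derive_cst _ _ _) (H x01).
rewrite add0r; apply: near_eq_is_derive.
near=> y; rewrite [RHS]fE//.
have : y \in `]0, 1[ by near: y; exact: near_in_itvoo.
by rewrite in_itv/= => /andP[? ?]; rewrite !ltW.
Unshelve. all: by end_near. Qed.

Lemma ac_continuous f : ac f -> {within `[0, 1], continuous f}.
Proof.
move=> acf; apply/continuous_within_itvP => //.
have H x : 0 <= x <= 1 -> forall e, 0 < e -> exists2 d, 0 < d &
    forall y, 0 <= y <= 1 -> `|y - x| < d -> `|f x - f y| < e.
  move=> /andP[x0 x1] e e0; have [d d0 hd] := acf e e0; exists d => // y /andP[y0 y1] yx.
  have [xy|/ltW yx'] := leP x y.
  - have := hd 1%N (fun=> x) (fun=> y); rewrite !big_ord1 distrC; apply => //.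
      by move=> i j _ _ _; rewrite !ord1.
    by rewrite ger0_norm ?subr_ge0// in yx.
  - have := hd 1%N (fun=> y) (fun=> x); rewrite !big_ord1; apply => //.
      by move=> i j _ _ _; rewrite !ord1.
    by rewrite distrC ger0_norm ?subr_ge0// in yx.
split.
- move=> x; rewrite in_itv/= => /andP[x0 x1]; apply/cvgrPdist_lt => e e0.
  have [|d d0 hd] := H x _ e e0; first by rewrite !ltW.
  near=> y; apply: hd.
    have : y \in `]0, 1[ by near: y; apply: near_in_itvoo; rewrite in_itv/= x0.
    by rewrite in_itv/= => /andP[? ?]; rewrite !ltW.
  rewrite distrC; near: y; exact: (@cvgr_dist_lt _ _ _ _ _ id x).
- apply/cvgrPdist_lt => e e0.
  have [|d d0 hd] := H 0 _ e e0; first by rewrite lexx ler01.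
  near=> y; apply: hd.
    apply/andP; split; first by near: y; exact: nbhs_right_ge.
    by near: y; exact: nbhs_right_le.
  rewrite subr0 ger0_norm; first by near: y; exact: nbhs_right_lt.
  by near: y; exact: nbhs_right_ge.
- apply/cvgrPdist_lt => e e0.
  have [|d d0 hd] := H 1 _ e e0; first by rewrite lexx ler01.
  near=> y; apply: hd.
    apply/andP; split; first by near: y; exact: nbhs_left_ge.
    by near: y; exact: nbhs_left_le.
  rewrite distrC ger0_norm ?subr_ge0; last by near: y; exact: nbhs_left_le.
  suff : 1 - d < y by lra.
  by near: y; apply: nbhs_left_gt; lra.
Unshelve. all: by end_near. Qed.

Lemma ac_bounded f : ac f -> exists2 M, 0 <= M & forall x, 0 <= x <= 1 -> `|f x| <= M.
Proof.
move=> /ac_continuous cf.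
have [c _ hc] := EVT_max ler01 cf; have [d _ hd] := EVT_min ler01 cf.
exists (`|f c| + `|f d|); first by rewrite addr_ge0.
move=> x x01; rewrite ler_norml; apply/andP; split.
  have := hd x; rewrite in_itv => /(_ x01); have := ler_norm (- f d); rewrite normrN.
  have := normr_ge0 (f c); lra.
have := hc x; rewrite in_itv => /(_ x01); have := ler_norm (f c).
have := normr_ge0 (f d); lra.
Qed.

Lemma ac_measurable f : ac f -> measurable_fun (`[0, 1] : set R) f.
Proof.
by move=> /ac_continuous cf; apply: subspace_continuous_measurable_fun.
Qed.

(** Bounded measurable functions on [0, 1]. *)
Definition bmeas f : Prop := measurable_fun (`[0, 1] : set R) f /\
  exists2 M, 0 <= M & forall x, 0 <= x <= 1 -> `|f x| <= M.

Lemma ac_bmeas f : ac f -> bmeas f.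
Proof. by move=> acf; split; [exact: ac_measurable|exact: ac_bounded]. Qed.

Lemma bmeas_inteM f h : bmeas f -> inte h -> inte (fun x => f x * h x).
Proof.
move=> [mf [M M0 fM]] ih.
have := @integrableMr _ _ _ leb _ (measurable_itv _) f (EFin \o h) mf _ ih.
move=> H; apply: H.
exists M; split; first exact: num_real.
move=> N MN x/=; rewrite in_itv/= => x01.
by rewrite (le_trans _ (ltW MN))// fM.
Qed.

Lemma acM f g : ac f -> ac g -> ac (fun x => f x * g x).
Proof.
move=> acf acg.
have [M M0 fM] := ac_bounded acf; have [N N0 gN] := ac_bounded acg.
move=> e e0.
pose C := M + N + 1; have C0 : 0 < C by rewrite /C; lra.
have e2 : 0 < e / (2 * C) by rewrite divr_gt0// mulr_gt0.
have [d1 d10 h1] := acf _ e2; have [d2 d20 h2] := acg _ e2.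
exists (Num.min d1 d2); first by rewrite lt_min d10.
move=> n a b ab tI; rewrite lt_min => /andP[sd1 sd2].
have := h1 n a b ab tI sd1; have := h2 n a b ab tI sd2.
rewrite !ltr_pdivlMr ?mulr_gt0// => H1 H2.
suff : \sum_(i < n) `|f (b i) * g (b i) - f (a i) * g (a i)| <=
  C * \sum_(i < n) `|f (b i) - f (a i)| + C * \sum_(i < n) `|g (b i) - g (a i)| by lra.
rewrite !mulr_sumr -big_split/=; apply: ler_sum => i _; have [a0 aibi b1] := ab i.
(* the increment of a product, split by the increments of the factors *)
have -> : f (b i) * g (b i) - f (a i) * g (a i) =
  g (b i) * (f (b i) - f (a i)) + f (a i) * (g (b i) - g (a i)) by ring.
rewrite (le_trans (ler_normD _ _))// !normrM lerD// ler_wpM2r//.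
  by rewrite (le_trans (gN _ _)) ?(le_trans a0)// /C; lra.
by rewrite (le_trans (fM _ _)) ?a0 ?(le_trans aibi)// /C; lra.
Qed.

(** Integration by parts for indefinite Lebesgue integrals. *)
Lemma primM f g h k : prim f h -> prim g k ->
  prim (fun x => f x * g x) (fun x => h x * g x + f x * k x).
Proof.
move=> fh gk; have acf := prim_ac fh; have acg := prim_ac gk.
apply: ac_prim; first exact: acM.
- have H1 := bmeas_inteM (ac_bmeas acg) fh.1.
  have H2 := bmeas_inteM (ac_bmeas acf) gk.1.
  by apply: eq_inte (inteD H1 H2) => x _; rewrite [h x * _]mulrC.
- have := prim_derive gk.
  apply: (@filterS2 _ _ (ae_filter_ringOfSetsType leb)) (prim_derive fh).
  move=> x /= H1 H2 x01; have d1 := H1 x01; have d2 := H2 x01.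
  have dd : is_derive x 1 (fun x => f x * g x) (f x *: k x + g x *: h x).
    exact: is_deriveM d1 d2.
  by rewrite addrC [h x * _]mulrC.
Qed.

Lemma primD f g h k : prim f h -> prim g k ->
  prim (fun x => f x + g x) (fun x => h x + k x).
Proof.
move=> [ih fE] [ik gE]; split; first exact: inteD.
move=> x x01; have /andP[_ x1] := x01.
rewrite fE// gE// RintegralD//; first by ring.
- by apply: inteS ih => //; exact: sub_itv0.
- by apply: inteS ik => //; exact: sub_itv0.
Qed.

Lemma prim_cst (c : R) : prim (fun=> c) (fun=> 0).
Proof.
split=> [|x _]; first exact: integrable0.
by rewrite Rintegral_cst// mul0r addr0.
Qed.

Lemma eq_prim f g h k : (forall x, 0 <= x <= 1 -> f x = g x) ->
  (forall x, 0 <= x <= 1 -> h x = k x) -> prim f h -> prim g k.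
Proof.
move=> fg hk [ih fE]; split.
  exact: eq_inte ih.
move=> x x01; rewrite -!fg// ?lexx ?ler01// fE//; congr (_ + _).
apply: eq_Rintegral => t; rewrite inE/= in_itv/= => /andP[t0 tx].
by rewrite hk// t0 (le_trans tx)//; case/andP : x01.
Qed.

Lemma primN f h : prim f h -> prim (fun x => - f x) (fun x => - h x).
Proof.
move=> fh; apply: eq_prim (primM (prim_cst (-1)) fh) => x _.
  by rewrite mulN1r.
by rewrite mul0r add0r mulN1r.
Qed.

Lemma prim_rint h : inte h -> prim (fun x => rint h x) h.
Proof. by move=> ih; split => // x _; rewrite rint0 add0r. Qed.

Lemma prim_C1 f h : (forall x, is_derive x 1 f (h x)) -> continuous h -> prim f h.
Proof.
move=> df ch; split.
  apply: continuous_compact_integrable; first exact: segment_compact.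
  exact: continuous_subspaceT.
move=> x /andP[]; rewrite le_eqVlt => /predU1P[<- _|x0 x1].
  by rewrite rint0 addr0.
have := @continuous_FTC2 R h f 0 x x0; rewrite /Rintegral => ->.
- by rewrite -EFinB/= addrC subrK.
- exact: continuous_subspaceT.
- have cf : continuous f.
    by move=> y; apply/differentiable_continuous/derivable1_diffP; case: (df y).
  split => [y _||]; first by case: (df y).
  + by apply: cvg_at_right_filter; exact: cf.
  + by apply: cvg_at_left_filter; exact: cf.
- by move=> y _; rewrite derive1E; case: (df y).
Qed.

End Primitives.

(** * Gronwall's inequality *)

Section Gronwall.
Context {R : realType}.
Local Notation leb := (@lebesgue_measure R).
Local Notation inte h := (leb.-integrable `[0, 1] (EFin \o h)).
Local Notation rint h x := (\int[leb]_(t in `[0, x]) h t).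
Implicit Types (f g h k : R -> R) (x y z : R).

Lemma rint_ge0 h x : (forall t, 0 <= t <= 1 -> 0 <= h t) -> x <= 1 -> 0 <= rint h x.
Proof.
move=> h0 x1; apply: Rintegral_ge0 => t /=; rewrite in_itv/= => /andP[t0 tx].
by rewrite h0// t0 (le_trans tx).
Qed.

Lemma le_rint h k x : inte h -> inte k -> (forall t, 0 <= t <= 1 -> h t <= k t) ->
  x <= 1 -> rint h x <= rint k x.
Proof.
move=> ih ik hk x1; apply: le_Rintegral => //.
- by apply: inteS ih => //; exact: sub_itv0.
- by apply: inteS ik => //; exact: sub_itv0.
- by move=> t /=; rewrite in_itv/= => /andP[t0 tx]; rewrite hk// t0 (le_trans tx).
Qed.

Lemma rint_mono h x y : inte h -> (forall t, 0 <= t <= 1 -> 0 <= h t) ->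
  0 <= x -> x <= y -> y <= 1 -> rint h x <= rint h y.
Proof.
move=> ih h0 x0 xy y1; rewrite -subr_ge0 rint_sub//; apply: Rintegral_ge0 => t /=.
by rewrite in_itv/= => /andP[/ltW xt ty]; rewrite h0// (le_trans x0)// (le_trans ty).
Qed.

Lemma prim_expN k : inte k -> (forall t, 0 <= t <= 1 -> 0 <= k t) ->
  prim (fun x => expR (- rint k x)) (fun x => - k x * expR (- rint k x)).
Proof.
move=> ik k0.
have acE : ac (fun x => expR (- rint k x)).
  apply: (ac_dominated (M := 1)) (ac_rint ik) _ => x y x0 xy y1; rewrite mul1r.
  have Gxy := rint_mono ik k0 x0 xy y1.
  have Gx0 := rint_ge0 k0 (le_trans xy y1).
  rewrite (ger0_norm (_ : 0 <= rint k y - rint k x)) ?subr_ge0//.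
  rewrite distrC ger0_norm ?subr_ge0 ?ler_expR ?lerN2//.
  set a := rint k x in Gxy Gx0 *; set b := rint k y in Gxy *.
  have -> : - b = - a + (a - b) by ring.
  rewrite expRD -{1}[expR (- a)]mulr1 -mulrBr.
  have := expR_ge1Dx (a - b) => H.
  have Ea : expR (- a) <= 1 by rewrite -expR0 ler_expR oppr_le0.
  have Ea0 := expR_ge0 (- a).
  rewrite (@le_trans _ _ (expR (- a) * (b - a)))//; first by rewrite ler_wpM2l//; lra.
  by rewrite ler_piMl// subr_ge0.
apply: ac_prim => //.
  apply: eq_inte (bmeas_inteM (ac_bmeas acE) (primN (prim_rint ik)).1) => x _.
  by rewrite mulrC.
have := ae_derive_rint ik.
apply: (@filterS _ _ (ae_filter_ringOfSetsType leb)) => x /= H x01.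
have d1 : is_derive x 1 (fun x => - rint k x) (- k x) by exact: is_deriveN (H x01).
rewrite [- k x * _]mulrC.
exact: (@is_derive1_comp _ expR (fun x => - rint k x) x _ _ (is_derive_expR _) d1).
Qed.

(** Integral form: the function [(A + int k u) e^(- int k)] has a nonpositive
    derivative a.e. *)
Lemma gronwall k u (A : R) : inte k -> (forall t, 0 <= t <= 1 -> 0 <= k t) ->
  inte (fun x => k x * u x) -> 0 <= A ->
  (forall x, 0 <= x <= 1 -> u x <= A + rint (fun t => k t * u t) x) ->
  forall x, 0 <= x <= 1 -> u x <= A * expR (rint k 1).
Proof.
move=> ik k0 iku A0 uA x x01; have /andP[x0 x1] := x01.
apply: le_trans (uA x x01) _.
set V := fun x => A + rint (fun t => k t * u t) x.
have pV : prim V (fun x => k x * u x).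
  by apply: eq_prim (primD (prim_cst A) (prim_rint iku)) => // t _; rewrite add0r.
have [iVE VE] := primM pV (prim_expN ik k0).
have VEx : V x * expR (- rint k x) <= A.
  have V0 : V 0 * expR (- rint k 0) = A.
    by rewrite /V !rint0 oppr0 expR0 addr0 mulr1.
  rewrite VE// V0 gerDl -oppr_ge0.
  rewrite -[X in 0 <= X]mulN1r -RintegralZl//; last first.
    by apply: inteS iVE => //; exact: sub_itv0.
  apply: rint_ge0 => // t t01.
  have -> : k t * u t * expR (- rint k t) + V t * (- k t * expR (- rint k t)) =
    k t * expR (- rint k t) * (u t - V t) by ring.
  rewrite mulN1r oppr_ge0 mulr_ge0_le0//; first by rewrite mulr_ge0 ?k0 ?expR_ge0.
  by rewrite subr_le0 uA.
rewrite -/(V x).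
have -> : V x = V x * expR (- rint k x) * expR (rint k x).
  by rewrite -mulrA -expRD addNr expR0 mulr1.
move: VEx; move: (V x * expR _) => w wA.
have rk : rint k x <= rint k 1 by exact: rint_mono.
apply: (@le_trans _ _ (A * expR (rint k x))).
  by apply: ler_wpM2r => //; exact: expR_ge0.
by apply: ler_wpM2l; [exact: A0|rewrite ler_expR].
Qed.

End Gronwall.

(** * Modulus and exponential of complex numbers *)

Section ComplexScalars.
Context {R : realType}.
Local Notation C := R[i].
Implicit Types (z w : C).

Lemma cabsE z : cabs z = Num.sqrt (complex.Re z ^+ 2 + complex.Im z ^+ 2).
Proof. by rewrite /cabs normc_def. Qed.

Lemma normc_cabs z : `|z| = real_complex R (cabs z).
Proof. by rewrite cabsE normc_def. Qed.

Lemma cabs_ge0 z : 0 <= cabs z.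
Proof. by rewrite cabsE sqrtr_ge0. Qed.

Lemma cabsM z w : cabs (z * w) = cabs z * cabs w.
Proof. by apply: complexI; rewrite rmorphM/= -!normc_cabs normrM. Qed.

Lemma cabsD z w : cabs (z + w) <= cabs z + cabs w.
Proof. by rewrite -lecR rmorphD/= -!normc_cabs ler_normD. Qed.

Lemma cabsN z : cabs (- z) = cabs z.
Proof. by apply: complexI; rewrite -!normc_cabs normrN. Qed.

Lemma cabs0 : cabs (0 : C) = 0.
Proof. by apply: complexI; rewrite -normc_cabs normr0. Qed.

Lemma cabs1 : cabs (1 : C) = 1.
Proof. by apply: complexI; rewrite -normc_cabs normr1. Qed.

Lemma cabsV z : cabs z^-1 = (cabs z)^-1.
Proof. by apply: complexI; rewrite fmorphV/= -!normc_cabs normfV. Qed.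

Lemma cabs_Re z : `|complex.Re z| <= cabs z.
Proof. by rewrite cabsE -sqrtr_sqr ler_wsqrtr// lerDl sqr_ge0. Qed.

Lemma cabs_Im z : `|complex.Im z| <= cabs z.
Proof. by rewrite cabsE -sqrtr_sqr ler_wsqrtr// lerDr sqr_ge0. Qed.

Lemma cabs_le_ReIm z : cabs z <= `|complex.Re z| + `|complex.Im z|.
Proof.
rewrite cabsE -[leRHS]ger0_norm ?addr_ge0// -sqrtr_sqr ler_wsqrtr//.
rewrite sqrrD !real_normK ?num_real//.
have : 0 <= `|complex.Re z| * `|complex.Im z| by rewrite mulr_ge0.
lra.
Qed.

Lemma ReCD z w : complex.Re (z + w) = complex.Re z + complex.Re w.
Proof. by case: z; case: w. Qed.
Lemma ImCD z w : complex.Im (z + w) = complex.Im z + complex.Im w.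
Proof. by case: z; case: w. Qed.
Lemma ReCN z : complex.Re (- z) = - complex.Re z.
Proof. by case: z. Qed.
Lemma ImCN z : complex.Im (- z) = - complex.Im z.
Proof. by case: z. Qed.
Lemma ReCM z w : complex.Re (z * w) =
  complex.Re z * complex.Re w - complex.Im z * complex.Im w.
Proof. by case: z; case: w. Qed.
Lemma ImCM z w : complex.Im (z * w) =
  complex.Re z * complex.Im w + complex.Im z * complex.Re w.
Proof. by case: z => a b; case: w => c d /=; rewrite [b * c]mulrC. Qed.

Lemma complex_ext z w : complex.Re z = complex.Re w ->
  complex.Im z = complex.Im w -> z = w.
Proof. by case: z => a b; case: w => c d /= -> ->. Qed.

Lemma cexpD z w : cexp (z + w) = cexp z * cexp w.
Proof.
apply: complex_ext; rewrite ?ReCM ?ImCM /= ReCD ImCD expRD.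
  by rewrite cosD; ring.
by rewrite sinD; ring.
Qed.

Lemma cexp0 : cexp (0 : C) = 1.
Proof. by rewrite /cexp/= expR0 cos0 sin0 mulr1 mulr0. Qed.

Lemma cabs_cexp z : cabs (cexp z) = expR (complex.Re z).
Proof.
rewrite cabsE /= !exprMn -mulrDr cos2Dsin2 mulr1 sqrtr_sqr ger0_norm//.
Qed.

End ComplexScalars.

(** * Primitives of complex-valued functions *)

Section ComplexPrimitives.
Context {R : realType}.
Local Notation C := R[i].
Local Notation leb := (@lebesgue_measure R).
Local Notation inte h := (leb.-integrable `[0, 1] (EFin \o h)).
Local Notation rint h x := (\int[leb]_(t in `[0, x]) h t).
Implicit Types (f g h k : R -> C).

(** Integrability on [0, 1] of a complex function. *)
Definition cinte h : Prop :=
  inte (fun x => complex.Re (h x)) /\ inte (fun x => complex.Im (h x)).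

(** Bounded measurable complex functions on [0, 1]. *)
Definition cbmeas f : Prop :=
  bmeas (fun x => complex.Re (f x)) /\ bmeas (fun x => complex.Im (f x)).

(** [f] is, on [0, 1], an indefinite integral of the complex function [h]. *)
Definition cprim f h : Prop :=
  prim (fun x => complex.Re (f x)) (fun x => complex.Re (h x)) /\
  prim (fun x => complex.Im (f x)) (fun x => complex.Im (h x)).

Lemma inteN (h : R -> R) : inte h -> inte (fun x => - h x).
Proof. by move=> ih; have := primN (prim_rint ih) => -[]. Qed.

Lemma eq_cinte h k : (forall x, 0 <= x <= 1 -> h x = k x) -> cinte h -> cinte k.
Proof.
by move=> hk [h1 h2]; split; [apply: eq_inte h1|apply: eq_inte h2] => x /hk ->.
Qed.

Lemma cinteD h k : cinte h -> cinte k -> cinte (fun x => h x + k x).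
Proof.
move=> [h1 h2] [k1 k2]; split.
  by apply: eq_inte (inteD h1 k1) => x _; rewrite ReCD.
by apply: eq_inte (inteD h2 k2) => x _; rewrite ImCD.
Qed.

Lemma cinteN h : cinte h -> cinte (fun x => - h x).
Proof.
move=> [h1 h2]; split.
  by apply: eq_inte (inteN h1) => x _; rewrite ReCN.
by apply: eq_inte (inteN h2) => x _; rewrite ImCN.
Qed.

Lemma cbmeas_cinteM f h : cbmeas f -> cinte h -> cinte (fun x => f x * h x).
Proof.
move=> [f1 f2] [h1 h2]; split.
  apply: eq_inte (inteD (bmeas_inteM f1 h1) (inteN (bmeas_inteM f2 h2))) => x _.
  by rewrite ReCM.
by apply: eq_inte (inteD (bmeas_inteM f1 h2) (bmeas_inteM f2 h1)) => x _; rewrite ImCM.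
Qed.

Lemma cprim_cinte f h : cprim f h -> cinte h.
Proof. by move=> [[? _] [? _]]. Qed.

Lemma cprim_cbmeas f h : cprim f h -> cbmeas f.
Proof. by move=> [/prim_ac/ac_bmeas ? /prim_ac/ac_bmeas ?]. Qed.

Lemma eq_cprim f g h k : (forall x, 0 <= x <= 1 -> f x = g x) ->
  (forall x, 0 <= x <= 1 -> h x = k x) -> cprim f h -> cprim g k.
Proof.
move=> fg hk [f1 f2]; split; [apply: eq_prim f1|apply: eq_prim f2] => x x01;
  by rewrite ?fg ?hk.
Qed.

Lemma cprimD f g h k : cprim f h -> cprim g k ->
  cprim (fun x => f x + g x) (fun x => h x + k x).
Proof.
move=> [f1 f2] [g1 g2]; split.
  by apply: eq_prim (primD f1 g1) => x _; rewrite ReCD.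
by apply: eq_prim (primD f2 g2) => x _; rewrite ImCD.
Qed.

Lemma cprimN f h : cprim f h -> cprim (fun x => - f x) (fun x => - h x).
Proof.
move=> [f1 f2]; split.
  by apply: eq_prim (primN f1) => x _; rewrite ReCN.
by apply: eq_prim (primN f2) => x _; rewrite ImCN.
Qed.

Lemma cprim_cst (c : C) : cprim (fun=> c) (fun=> 0).
Proof. by split; exact: prim_cst. Qed.

Lemma cprimM f g h k : cprim f h -> cprim g k ->
  cprim (fun x => f x * g x) (fun x => h x * g x + f x * k x).
Proof.
move=> [f1 f2] [g1 g2]; split.
  apply: eq_prim (primD (primM f1 g1) (primN (primM f2 g2))) => x _.
    by rewrite ReCM.
  by rewrite ReCD !ReCM; ring.
apply: eq_prim (primD (primM f1 g2) (primM f2 g1)) => x _.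
  by rewrite ImCM.
by rewrite ImCD !ImCM; ring.
Qed.

Lemma cprim_cint h : cinte h -> cprim (fun x => cint `[0, x] h) h.
Proof. by move=> [h1 h2]; split => /=; exact: prim_rint. Qed.

Lemma cprimE f h x : cprim f h -> 0 <= x <= 1 -> f x = f 0 + cint `[0, x] h.
Proof.
move=> [[_ f1] [_ f2]] x01; apply: complex_ext.
  by rewrite ReCD/= -f1.
by rewrite ImCD/= -f2.
Qed.

Lemma eq_cint (D : set R) h k : (forall x, D x -> h x = k x) ->
  cint D h = cint D k.
Proof.
by move=> hk; congr Complex; apply: eq_Rintegral => x; rewrite inE => /hk ->.
Qed.

Lemma cint0 h : cint `[0, 0] h = 0.
Proof. by rewrite /cint !rint0. Qed.

Lemma measurable_cabs (D : set R) h : measurable_fun D (fun x => complex.Re (h x)) ->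
  measurable_fun D (fun x => complex.Im (h x)) ->
  measurable_fun D (fun x => cabs (h x)).
Proof.
move=> h1 h2.
have -> : (fun x => cabs (h x)) = (fun x => Num.sqrt x) \o
    (fun x => complex.Re (h x) ^+ 2 + complex.Im (h x) ^+ 2).
  by apply/funext => x /=; rewrite cabsE.
apply: measurableT_comp.
  by apply: continuous_measurable_fun; exact: sqrt_continuous.
by apply: measurable_funD; exact: measurable_funX.
Qed.

Lemma inte_le (f g : R -> R) : measurable_fun (`[0, 1] : set R) f ->
  (forall x, 0 <= x <= 1 -> `|f x| <= g x) -> inte g -> inte f.
Proof.
move=> mf fg ig; apply: le_integrable ig => //.
  exact/measurable_EFinP.
move=> x/=; rewrite in_itv/= => x01; rewrite lee_fin (le_trans (fg x x01))//.
exact: ler_norm.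
Qed.

Lemma inte_measurable (h : R -> R) : inte h -> measurable_fun (`[0, 1] : set R) h.
Proof. by case/integrableP => /measurable_EFinP. Qed.

Lemma inte_norm (h : R -> R) : inte h -> inte (fun x => `|h x|).
Proof. exact: integrable_norm. Qed.

Lemma cinte_cabs h : cinte h -> inte (fun x => cabs (h x)).
Proof.
move=> [h1 h2].
apply: (inte_le (g := fun x => `|complex.Re (h x)| + `|complex.Im (h x)|)).
- by apply: measurable_cabs; exact: inte_measurable.
- by move=> x _; rewrite ger0_norm ?cabs_ge0// cabs_le_ReIm.
- by apply: inteD; exact: inte_norm.
Qed.

Lemma cinte_le h (g : R -> R) : measurable_fun (`[0, 1] : set R) (fun x => complex.Re (h x)) ->
  measurable_fun (`[0, 1] : set R) (fun x => complex.Im (h x)) ->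
  (forall x, 0 <= x <= 1 -> cabs (h x) <= g x) -> inte g -> cinte h.
Proof.
move=> m1 m2 hg ig; split; apply: inte_le ig => // x x01.
  exact: le_trans (cabs_Re _) (hg x x01).
exact: le_trans (cabs_Im _) (hg x x01).
Qed.

Lemma cabs_cint h x : cinte h -> x <= 1 ->
  cabs (cint `[0, x] h) <= 2 * rint (fun t => cabs (h t)) x.
Proof.
move=> ih x1; have ic := cinte_cabs ih; have [h1 h2] := ih.
rewrite (le_trans (cabs_le_ReIm _))//= mulr_natl mulr2n lerD//.
  rewrite (le_trans (le_normr_Rintegral _ _))//.
    by apply: inteS h1 => //; exact: sub_itv0.
  by apply: le_rint => // [|t _]; [exact: inte_norm|exact: cabs_Re].
rewrite (le_trans (le_normr_Rintegral _ _))//.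
  by apply: inteS h2 => //; exact: sub_itv0.
by apply: le_rint => // [|t _]; [exact: inte_norm|exact: cabs_Im].
Qed.

Lemma cbmeas_cabs f : cbmeas f -> bmeas (fun x => cabs (f x)).
Proof.
move=> [[m1 [M M0 hM]] [m2 [N N0 hN]]]; split; first exact: measurable_cabs.
exists (M + N); first exact: addr_ge0.
move=> x x01; rewrite ger0_norm ?cabs_ge0// (le_trans (cabs_le_ReIm _))//.
by rewrite lerD ?hM ?hN.
Qed.

Lemma is_derive_scaled (f : R -> R) (a x d : R) : is_derive (x * a) 1 f d ->
  is_derive x 1 (fun t => f (t * a)) (a * d).
Proof.
move=> df.
have dl : is_derive x 1 (fun t : R => t * a) a.
  have := @is_deriveM _ _ (@idfun R) (cst a) x 1 _ _ (is_derive_id _ _) (is_derive_cst _ _ _).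
  by rewrite /= scaler0 add0r /GRing.scale/= mulr1.
rewrite mulrC; exact: (@is_derive1_comp _ f (fun t => t * a) x _ _ df dl).
Qed.

Lemma prim_scaled (f h : R -> R) (a : R) : (forall x : R, is_derive x 1 f (h x)) ->
  continuous h -> prim (fun x => f (x * a)) (fun x => a * h (x * a)).
Proof.
move=> df ch; apply: prim_C1 => x; first exact: is_derive_scaled.
apply: continuousM; first exact: cst_continuous.
have cl : {for x, continuous (fun y : R => y * a)}.
  by apply: continuousM; [exact: cvg_id|exact: cst_continuous].
exact: (continuous_comp cl (ch _)).
Qed.

Lemma cprim_cexp (z : C) :
  cprim (fun x => cexp (real_complex R x * z)) (fun x => z * cexp (real_complex R x * z)).
Proof.
have pe (a : R) := prim_scaled a (@is_derive_expR R) (@continuous_expR R).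
have pc (a : R) := prim_scaled a (@is_derive_cos R) (fun x => continuousN (@continuous_sin R x)).
have ps (a : R) := prim_scaled a (@is_derive_sin R) (@continuous_cos R).
have Re_x (x : R) : complex.Re (real_complex R x * z) = x * complex.Re z.
  by rewrite ReCM/= mul0r subr0.
have Im_x (x : R) : complex.Im (real_complex R x * z) = x * complex.Im z.
  by rewrite ImCM/= mul0r addr0.
split.
  apply: eq_prim (primM (pe (complex.Re z)) (pc (complex.Im z))) => x _.
    by rewrite /= Re_x Im_x.
  by rewrite ReCM/= Re_x Im_x; ring.
apply: eq_prim (primM (pe (complex.Re z)) (ps (complex.Im z))) => x _.
  by rewrite /= Re_x Im_x.
by rewrite ImCM/= Re_x Im_x; ring.
Qed.

End ComplexPrimitives.

(** * Two by two matrices *)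

Section TwoByTwo.
Context {R : realType}.
Local Notation C := R[i].
Local Notation M2 := 'M[C]_2.
Implicit Types (A B K : M2).

Lemma ord2P (i : 'I_2) : i = 0 \/ i = 1.
Proof. by case: i => [[|[|//]] ?]; [left|right]; exact/val_inj. Qed.

Lemma mx2_eta A : A = mx2 (A 0 0) (A 0 1) (A 1 0) (A 1 1).
Proof.
by apply/matrixP => i j; rewrite !mxE; case: (ord2P i) => ->; case: (ord2P j) => ->.
Qed.

Lemma mulmx2E A B k j : (A *m B) k j = A k 0 * B 0 j + A k 1 * B 1 j.
Proof.
rewrite mxE big_ord_recl big_ord1.
by congr (_ + A k _ * B _ j); exact/val_inj.
Qed.

Lemma mx2M (a b c d a' b' c' d' : C) : mx2 a b c d *m mx2 a' b' c' d' =
  mx2 (a * a' + b * c') (a * b' + b * d') (c * a' + d * c') (c * b' + d * d').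
Proof.
apply/matrixP => i j; rewrite !mxE !big_ord_recl big_ord0 !mxE addr0.
by case: (ord2P i) => ->; case: (ord2P j) => ->.
Qed.

Lemma mx2D (a b c d a' b' c' d' : C) : mx2 a b c d + mx2 a' b' c' d' =
  mx2 (a + a') (b + b') (c + c') (d + d').
Proof.
by apply/matrixP => i j; rewrite !mxE; case: (ord2P i) => ->; case: (ord2P j) => ->.
Qed.

Lemma mx2N (a b c d : C) : - mx2 a b c d = mx2 (- a) (- b) (- c) (- d).
Proof.
by apply/matrixP => i j; rewrite !mxE; case: (ord2P i) => ->; case: (ord2P j) => ->.
Qed.

Lemma mx2Z (e a b c d : C) : e *: mx2 a b c d = mx2 (e * a) (e * b) (e * c) (e * d).
Proof.
by apply/matrixP => i j; rewrite !mxE; case: (ord2P i) => ->; case: (ord2P j) => ->.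
Qed.

Lemma mx2_1 : 1%:M = mx2 1 0 0 1 :> M2.
Proof.
by apply/matrixP => i j; rewrite !mxE; case: (ord2P i) => ->; case: (ord2P j) => ->.
Qed.

Lemma mx2E (a b c d : C) : [/\ mx2 a b c d 0 0 = a, mx2 a b c d 0 1 = b,
  mx2 a b c d 1 0 = c & mx2 a b c d 1 1 = d].
Proof. by rewrite !mxE. Qed.

(** The adjugate of a 2 x 2 matrix, in a form which is visibly additive. *)
Definition adj2 A : M2 := mx2 (A 1 1) (- A 0 1) (- A 1 0) (A 0 0).

Lemma adj2_mx2 (a b c d : C) : adj2 (mx2 a b c d) = mx2 d (- b) (- c) a.
Proof. by rewrite /adj2; have [-> -> -> ->] := mx2E a b c d. Qed.

Lemma adj2M A B : adj2 (A *m B) = adj2 B *m adj2 A.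
Proof.
rewrite [A]mx2_eta [B]mx2_eta mx2M !adj2_mx2 mx2M; congr mx2; ring.
Qed.

Lemma adj2N A : adj2 (- A) = - adj2 A.
Proof. by rewrite [A]mx2_eta mx2N !adj2_mx2 mx2N. Qed.

Lemma adj2D A B : adj2 (A + B) = adj2 A + adj2 B.
Proof.
by rewrite [A]mx2_eta [B]mx2_eta mx2D !adj2_mx2 mx2D !opprD.
Qed.

Lemma adj2_1 : adj2 1%:M = 1%:M.
Proof. by rewrite mx2_1 adj2_mx2 oppr0. Qed.

Lemma normMC_mx2 (a b c d : C) : normMC (mx2 a b c d) = cabs a + cabs b + cabs c + cabs d.
Proof.
rewrite /normMC !big_ord_recl !big_ord0 !addr0 !mxE/=; ring.
Qed.

Lemma normMC_ge0 A : 0 <= normMC A.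
Proof. by rewrite sumr_ge0// => k _; rewrite sumr_ge0// => j _; exact: cabs_ge0. Qed.

Lemma normMC_N A : normMC (- A) = normMC A.
Proof. by rewrite [A]mx2_eta mx2N !normMC_mx2 !cabsN. Qed.

Lemma normMC_adj2 A : normMC (adj2 A) = normMC A.
Proof. rewrite [A]mx2_eta adj2_mx2 !normMC_mx2 !cabsN; ring. Qed.

Lemma normMC_D A B : normMC (A + B) <= normMC A + normMC B.
Proof.
rewrite /normMC -big_split/=; apply: ler_sum => k _; rewrite -big_split/=.
by apply: ler_sum => j _; rewrite mxE cabsD.
Qed.

Lemma normMC_B A B : normMC (A - B) <= normMC A + normMC B.
Proof. by rewrite -(normMC_N B) normMC_D. Qed.

Lemma normMC_Z (c : C) A : normMC (c *: A) = cabs c * normMC A.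
Proof. by rewrite [A]mx2_eta mx2Z !normMC_mx2 !cabsM !mulrDr. Qed.

Lemma normMC_M A B : normMC (A *m B) <= normMC A * normMC B.
Proof.
rewrite [A]mx2_eta [B]mx2_eta mx2M !normMC_mx2.
move: (A 0 0) (A 0 1) (A 1 0) (A 1 1) (B 0 0) (B 0 1) (B 1 0) (B 1 1).
move=> a b c d a' b' c' d'.
have H (x y z w : C) : cabs (x * y + z * w) <= cabs x * cabs y + cabs z * cabs w.
  by rewrite -!cabsM cabsD.
have := (H a a' b c', H a b' b d', H c a' d c', H c b' d d').
move=> [[[]]].
have P (x y : C) : 0 <= cabs x * cabs y by rewrite mulr_ge0 ?cabs_ge0.
have := (P a c', P a d', P b a', P b b', P c c', P c d', P d a', P d b').
move=> [[[[[[[]]]]]]].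
move: (cabs (a * a' + _)) (cabs (a * b' + _)) (cabs (c * a' + _)) (cabs (c * b' + _)).
move: (cabs a) (cabs b) (cabs c) (cabs d) (cabs a') (cabs b') (cabs c') (cabs d').
move=> *; lra.
Qed.

Lemma normMC_M3 A B K : normMC (A *m B *m K) <= normMC A * normMC B * normMC K.
Proof.
rewrite (le_trans (normMC_M _ _))// ler_wpM2r ?normMC_ge0//; exact: normMC_M.
Qed.

Lemma normMC_1 : normMC (1%:M : M2) = 2.
Proof. rewrite mx2_1 normMC_mx2 cabs0 cabs1; ring. Qed.

End TwoByTwo.

(** * Primitives of matrix-valued functions *)

Section MatrixPrimitives.
Context {R : realType}.
Local Notation C := R[i].
Local Notation M2 := 'M[C]_2.
Local Notation leb := (@lebesgue_measure R).
Local Notation inte h := (leb.-integrable `[0, 1] (EFin \o h)).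
Local Notation rint h x := (\int[leb]_(t in `[0, x]) h t).
Implicit Types (F G H K : R -> M2).

(** Entrywise integrability on [0, 1]. *)
Definition minte H : Prop := forall k j, cinte (fun x => H x k j).
(** Entrywise boundedness and measurability on [0, 1]. *)
Definition mbmeas F : Prop := forall k j, cbmeas (fun x => F x k j).
(** [F] is, on [0, 1], an indefinite integral of the matrix function [H]. *)
Definition mprim F H : Prop := forall k j, cprim (fun x => F x k j) (fun x => H x k j).

Lemma eq_minte H K : (forall x, 0 <= x <= 1 -> H x = K x) -> minte H -> minte K.
Proof. by move=> HK mH k j; apply: eq_cinte (mH k j) => x /HK ->. Qed.

Lemma eq_mprim F G H K : (forall x, 0 <= x <= 1 -> F x = G x) ->
  (forall x, 0 <= x <= 1 -> H x = K x) -> mprim F H -> mprim G K.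
Proof.
by move=> FG HK FH k j; apply: eq_cprim (FH k j) => x x01; rewrite ?FG ?HK.
Qed.

Lemma minteD H K : minte H -> minte K -> minte (fun x => H x + K x).
Proof.
by move=> mH mK k j; apply: eq_cinte (cinteD (mH k j) (mK k j)) => x _; rewrite mxE.
Qed.

Lemma minteN H : minte H -> minte (fun x => - H x).
Proof. by move=> mH k j; apply: eq_cinte (cinteN (mH k j)) => x _; rewrite mxE. Qed.

Lemma mbmeas_minteM F H : mbmeas F -> minte H -> minte (fun x => F x *m H x).
Proof.
move=> bF mH k j.
apply: eq_cinte (cinteD (cbmeas_cinteM (bF k 0) (mH 0 j))
  (cbmeas_cinteM (bF k 1) (mH 1 j))) => x _.
by rewrite mulmx2E.
Qed.

Lemma minte_mbmeasM H F : minte H -> mbmeas F -> minte (fun x => H x *m F x).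
Proof.
move=> mH bF k j.
apply: eq_cinte (cinteD (cbmeas_cinteM (bF 0 j) (mH k 0))
  (cbmeas_cinteM (bF 1 j) (mH k 1))) => x _.
by rewrite mulmx2E [F x 0 j * _]mulrC [F x 1 j * _]mulrC.
Qed.

Lemma mprim_minte F H : mprim F H -> minte H.
Proof. by move=> FH k j; exact: cprim_cinte (FH k j). Qed.

Lemma mprim_mbmeas F H : mprim F H -> mbmeas F.
Proof. by move=> FH k j; exact: cprim_cbmeas (FH k j). Qed.

Lemma mprimD F G H K : mprim F H -> mprim G K ->
  mprim (fun x => F x + G x) (fun x => H x + K x).
Proof.
by move=> FH GK k j; apply: eq_cprim (cprimD (FH k j) (GK k j)) => x _; rewrite mxE.
Qed.

Lemma mprimN F H : mprim F H -> mprim (fun x => - F x) (fun x => - H x).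
Proof. by move=> FH k j; apply: eq_cprim (cprimN (FH k j)) => x _; rewrite mxE. Qed.

Lemma mprim_cst (A : M2) : mprim (fun=> A) (fun=> 0).
Proof. by move=> k j; apply: eq_cprim (cprim_cst (A k j)) => x _; rewrite ?mxE. Qed.

Lemma mprimM F G H K : mprim F H -> mprim G K ->
  mprim (fun x => F x *m G x) (fun x => H x *m G x + F x *m K x).
Proof.
move=> FH GK k j.
apply: eq_cprim (cprimD (cprimM (FH k 0) (GK 0 j)) (cprimM (FH k 1) (GK 1 j))) => x _.
  by rewrite mulmx2E.
by rewrite mxE !mulmx2E addrACA.
Qed.

Lemma mprim_adj2 F H : mprim F H -> mprim (fun x => adj2 (F x)) (fun x => adj2 (H x)).
Proof.
move=> FH k j; case: (ord2P k) => ->; case: (ord2P j) => ->.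
- by apply: eq_cprim (FH 1 1) => x _; rewrite mxE.
- by apply: eq_cprim (cprimN (FH 0 1)) => x _; rewrite mxE.
- by apply: eq_cprim (cprimN (FH 1 0)) => x _; rewrite mxE.
- by apply: eq_cprim (FH 0 0) => x _; rewrite mxE.
Qed.

Lemma mprim_mint H : minte H -> mprim (fun x => mint `[0, x] H) H.
Proof.
by move=> mH k j; apply: eq_cprim (cprim_cint (mH k j)) => x _; rewrite ?mxE.
Qed.

Lemma mprimE F H x : mprim F H -> 0 <= x <= 1 -> F x = F 0 + mint `[0, x] H.
Proof.
by move=> FH x01; apply/matrixP => k j; rewrite !mxE (cprimE (FH k j)).
Qed.

Lemma mint0 H : mint `[0, 0] H = 0.
Proof. by apply/matrixP => k j; rewrite !mxE cint0. Qed.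

Lemma eq_mint (D : set R) H K : (forall x, D x -> H x = K x) -> mint D H = mint D K.
Proof. by move=> HK; apply/matrixP => k j; rewrite !mxE; apply: eq_cint => x /HK ->. Qed.

Lemma mintD H K x : minte H -> minte K -> 0 <= x <= 1 ->
  mint `[0, x] (fun t => H t + K t) = mint `[0, x] H + mint `[0, x] K.
Proof.
move=> mH mK x01; have := mprimE (mprimD (mprim_mint mH) (mprim_mint mK)) x01.
by rewrite !mint0 !add0r.
Qed.

Lemma mintN H x : minte H -> 0 <= x <= 1 ->
  mint `[0, x] (fun t => - H t) = - mint `[0, x] H.
Proof.
by move=> mH x01; have := mprimE (mprimN (mprim_mint mH)) x01; rewrite mint0 oppr0 add0r.
Qed.

Lemma mintMl (A : M2) H x : minte H -> 0 <= x <= 1 ->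
  mint `[0, x] (fun t => A *m H t) = A *m mint `[0, x] H.
Proof.
move=> mH x01; have := mprimE (mprimM (mprim_cst A) (mprim_mint mH)) x01.
rewrite mint0 mulmx0 add0r => ->.
by apply: eq_mint => t _; rewrite mul0mx add0r.
Qed.

Lemma minte_normMC H : minte H -> inte (fun x => normMC (H x)).
Proof.
move=> mH.
apply: eq_inte (inteD (inteD (cinte_cabs (mH 0 0)) (cinte_cabs (mH 0 1)))
  (inteD (cinte_cabs (mH 1 0)) (cinte_cabs (mH 1 1)))) => x _.
by rewrite [H x]mx2_eta normMC_mx2; have [-> -> -> ->] := mx2E (H x 0 0) (H x 0 1) (H x 1 0) (H x 1 1); rewrite !addrA.
Qed.

Lemma bmeasD (f g : R -> R) : bmeas f -> bmeas g -> bmeas (fun x => f x + g x).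
Proof.
move=> [mf [M M0 fM]] [mg [N N0 gN]]; split; first exact: measurable_funD.
exists (M + N); first exact: addr_ge0.
by move=> x x01; rewrite (le_trans (ler_normD _ _))// lerD ?fM ?gN.
Qed.

Lemma bmeasM (f g : R -> R) : bmeas f -> bmeas g -> bmeas (fun x => f x * g x).
Proof.
move=> [mf [M M0 fM]] [mg [N N0 gN]]; split; first exact: measurable_funM.
exists (M * N); first exact: mulr_ge0.
by move=> x x01; rewrite normrM ler_pM ?fM ?gN.
Qed.

Lemma mbmeas_normMC F : mbmeas F -> bmeas (fun x => normMC (F x)).
Proof.
move=> bF.
have H := bmeasD (bmeasD (cbmeas_cabs (bF 0 0)) (cbmeas_cabs (bF 0 1)))
  (bmeasD (cbmeas_cabs (bF 1 0)) (cbmeas_cabs (bF 1 1))).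
rewrite (_ : (fun x => _) = (fun x => cabs (F x 0 0) + cabs (F x 0 1) +
  (cabs (F x 1 0) + cabs (F x 1 1))))//; apply/funext => x.
by rewrite [F x]mx2_eta normMC_mx2; have [-> -> -> ->] := mx2E (F x 0 0) (F x 0 1) (F x 1 0) (F x 1 1); rewrite !addrA.
Qed.

Lemma bmeas_normM_inte F H : mbmeas F -> minte H ->
  inte (fun x => normMC (H x) * normMC (F x)).
Proof.
move=> bF mH; apply: eq_inte (bmeas_inteM (mbmeas_normMC bF) (minte_normMC mH)) => x _.
by rewrite mulrC.
Qed.

Lemma normMC_mint H x : minte H -> 0 <= x <= 1 ->
  normMC (mint `[0, x] H) <= 2 * rint (fun t => normMC (H t)) x.
Proof.
move=> mH /andP[x0 x1].
have iH k j : leb.-integrable `[0, x] (EFin \o (fun t => cabs (H t k j))).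
  by apply: inteS (cinte_cabs (mH k j)) => //; exact: sub_itv0.
have iD (f g : R -> R) : leb.-integrable `[0, x] (EFin \o f) ->
    leb.-integrable `[0, x] (EFin \o g) ->
    leb.-integrable `[0, x] (EFin \o (fun t => f t + g t)).
  move=> h1 h2; have : leb.-integrable `[0, x] ((EFin \o f) \+ (EFin \o g))%E by exact: integrableD.
  exact: eq_integrable.
have -> : rint (fun t => normMC (H t)) x =
    rint (fun t => cabs (H t 0 0)) x + rint (fun t => cabs (H t 0 1)) x +
    rint (fun t => cabs (H t 1 0)) x + rint (fun t => cabs (H t 1 1)) x.
  rewrite -!RintegralD//; do ?[exact: iD|exact: iH]; last first.
    by apply: (iD (fun t => cabs (H t 0 0) + cabs (H t 0 1))) => //; exact: iD.
  apply: eq_Rintegral => t _.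
  by rewrite [H t]mx2_eta normMC_mx2; have [-> -> -> ->] := mx2E (H t 0 0) (H t 0 1) (H t 1 0) (H t 1 1).
rewrite [mint _ _]mx2_eta normMC_mx2 !mulrDr !lerD// mxE cabs_cint//; exact: mH.
Qed.

(** Gronwall's inequality for a Volterra equation with matrix kernel. *)
Lemma normMC_gronwall K F G (A : R) : minte K -> mbmeas F -> 0 <= A ->
  (forall x, 0 <= x <= 1 -> F x = G x + mint `[0, x] (fun t => K t *m F t)) ->
  (forall x, 0 <= x <= 1 -> normMC (G x) <= A) ->
  forall x, 0 <= x <= 1 ->
    normMC (F x) <= A * expR (2 * rint (fun t => normMC (K t)) 1).
Proof.
move=> mK bF A0 FG GA x x01.
have iK := minte_normMC mK.
have iK2 : inte (fun t => 2 * normMC (K t)).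
  by apply: bmeas_inteM iK; apply: ac_bmeas; exact: ac_cst.
rewrite -RintegralZl//.
apply: (gronwall (u := fun x => normMC (F x))) x01 => //.
- by move=> t _; rewrite mulr_ge0 ?normMC_ge0.
- apply: eq_inte (bmeas_inteM (mbmeas_normMC bF) iK2) => t _.
  by rewrite mulrC.
- move=> {}x x01; rewrite FG// (le_trans (normMC_D _ _))// lerD ?GA//.
  have mKF := minte_mbmeasM mK bF.
  rewrite (le_trans (normMC_mint mKF x01))//.
  under [leRHS]eq_Rintegral do rewrite -mulrA.
  have x1 : x <= 1 by case/andP : x01.
  rewrite RintegralZl//; last first.
    by apply: inteS (bmeas_normM_inte bF mK) => //; exact: sub_itv0.
  rewrite ler_wpM2l//; apply: le_rint => //.
  + exact: minte_normMC.
  + exact: bmeas_normM_inte.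
  + by move=> t _; exact: normMC_M.
Qed.

End MatrixPrimitives.

(** * Integrals attached to the L_1 and L_2 norms *)

Section LpFacts.
Context {R : realType}.
Local Notation C := R[i].
Local Notation leb := (@lebesgue_measure R).
Local Notation inte h := (leb.-integrable `[0, 1] (EFin \o h)).
Local Notation rint h x := (\int[leb]_(t in `[0, x]) h t).

Lemma integral_eLnorm (s : R -> C) (n : nat) : (0 < n)%N ->
  (\int[leb]_(x in `[0%R, 1%R]) (cabs (s x) ^+ n)%:E = eLnorm n%:R s `^ n%:R)%E.
Proof.
move=> n0; have n0R : n%:R != 0 :> R by rewrite pnatr_eq0 -lt0n.
rewrite /eLnorm powR_Lnorm// [LHS]integral_mkcond; apply: eq_integral => x _.
rewrite !patchE; case: ifPn => _ /=.
  by rewrite powR_mulrn ?normr_ge0// ger0_norm// cabs_ge0.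
by rewrite normr0 powR0.
Qed.

Lemma in_Lp_integral (s : R -> C) (n : nat) : (0 < n)%N -> in_Lp n%:R s ->
  inte (fun x => cabs (s x) ^+ n) /\
  rint (fun x => cabs (s x) ^+ n) 1 = Lp_norm n%:R s ^+ n.
Proof.
move=> n0 [m1 m2 soo]; have N0 : (0 <= eLnorm n%:R s)%E by exact: Lnorm_ge0.
have iE := integral_eLnorm s n0.
have fN : eLnorm n%:R s \is a fin_num by rewrite ge0_fin_numE.
have Lp0 : 0 <= Lp_norm n%:R s by exact: fine_ge0.
have iE' : (\int[leb]_(x in `[0%R, 1%R]) (cabs (s x) ^+ n)%:E = (Lp_norm n%:R s ^+ n)%:E)%E.
  by rewrite iE -[eLnorm n%:R s]fineK// poweR_EFin powR_mulrn.
split; last by rewrite /Rintegral iE'.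
apply/integrableP; split.
  apply/measurable_EFinP; apply: measurable_funX; exact: measurable_cabs.
under eq_integral do rewrite /= ger0_norm ?exprn_ge0 ?cabs_ge0//.
by rewrite iE' ltry.
Qed.

Lemma in_L1_cinte (s : R -> C) : in_Lp 1 s ->
  cinte s /\ rint (fun x => cabs (s x)) 1 = Lp_norm 1 s.
Proof.
move=> s1; have [i1 e1] := @in_Lp_integral s 1%N isT s1.
rewrite expr1 in e1; split => //; have [m1 m2 _] := s1.
exact: cinte_le m1 m2 (fun x _ => lexx _) i1.
Qed.

Lemma le_1Dsqr (r : R) : r <= 1 + r ^+ 2.
Proof. have := sqr_ge0 (r - 2^-1); rewrite sqrrB; lra. Qed.

Lemma inte_cst (c : R) : inte (fun=> c).
Proof.
apply: continuous_compact_integrable; first exact: segment_compact.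
by apply: continuous_subspaceT => x; exact: cst_continuous.
Qed.

Lemma in_L2_cinte (s : R -> C) : in_Lp 2 s -> cinte s.
Proof.
move=> s2; have [i2 e2] := @in_Lp_integral s 2%N isT s2; have [m1 m2 _] := s2.
apply: (cinte_le m1 m2 (g := fun x => 1 + cabs (s x) ^+ 2)).
  by move=> x _; exact: le_1Dsqr.
by apply: inteD => //; exact: inte_cst.
Qed.

(** The L_1 norm is bounded through [r <= 1 + r ^+ 2]. *)
Lemma in_L2_norm1 (s : R -> C) : in_Lp 2 s ->
  rint (fun x => cabs (s x)) 1 <= 1 + Lp_norm 2 s ^+ 2.
Proof.
move=> s2; have [i2 e2] := @in_Lp_integral s 2%N isT s2.
have <- : rint (fun x => 1 + cabs (s x) ^+ 2) 1 = 1 + Lp_norm 2 s ^+ 2.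
  rewrite RintegralD//; last exact: inte_cst.
  rewrite -e2; congr (_ + _); rewrite Rintegral_cst// mul1r.
  have H : leb `[0, 1]%classic = 1%:E.
    by rewrite [LHS]lebesgue_measure_itv/= lte01 sube0.
  by rewrite [X in fine X]H.
apply: le_rint => //.
- exact: cinte_cabs (in_L2_cinte s2).
- by apply: inteD => //; exact: inte_cst.
- by move=> x _; exact: le_1Dsqr.
Qed.

End LpFacts.

(** * Translation invariance of Lebesgue measure *)

Section Translation.
Context {R : realType}.
Local Notation leb := (@lebesgue_measure R).
Local Open Scope ereal_scope.

Let shift (c : R) : R -> measurableTypeR R := fun x => (x + c)%R.

Let measurable_shift c : measurable_fun setT (shift c).
Proof. exact: (@measurable_funD _ _ _ setT (fun x => x) (fun=> c)). Qed.

Lemma lebesgue_measure_shift c (A : set R) : measurable A ->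
  pushforward leb (shift c) A = leb A.
Proof.
move=> mA; have mph := measurable_shift c.
apply/esym/lebesgue_measure_unique => //= _ [[a b]] _ <-.
rewrite /pushforward/=.
have -> : shift c @^-1` `]a, b] = `](a - c)%R, (b - c)%R]%classic.
  by apply/seteqP; split => x /=; rewrite !in_itv/= /shift ltrBlDr lerBrDr.
rewrite !lebesgue_measure_itv/= !lte_fin ltrD2r; case: ifPn => // _.
by rewrite -!EFinB opprB addrA subrK.
Qed.

Lemma ge0_integral_shift c (f : R -> \bar R) : measurable_fun setT f ->
  (forall x, 0 <= f x) -> \int[leb]_x f (x + c)%R = \int[leb]_x f x.
Proof.
move=> mf f0; have mph := measurable_shift c.
transitivity (\int[pushforward leb (shift c)]_y f y).
  by rewrite ge0_integral_pushforward.
by apply: eq_measure_integral => A mA _; exact: lebesgue_measure_shift.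
Qed.

Lemma integral_shift c (f : R -> \bar R) : measurable_fun setT f ->
  \int[leb]_x f (x + c)%R = \int[leb]_x f x.
Proof.
move=> mf; rewrite integralE [RHS]integralE.
rewrite -(ge0_integral_shift c (measurable_funepos mf))//.
rewrite -(ge0_integral_shift c (measurable_funeneg mf))//.
congr (_ - _); apply: eq_integral => x _.
  by rewrite (funepos_comp f (fun x => x + c)%R).
by rewrite (funeneg_comp f (fun x => x + c)%R).
Qed.

End Translation.

(** * Iterated integrals and shears of the plane *)

Section Shear.
Context {R : realType}.
Local Notation leb := (@lebesgue_measure R).
Local Notation RM := (measurableTypeR R).
Local Notation leb2 := (leb \x leb)%E.

Lemma Rintegral_iterated (G : RM * RM -> R) :
  leb2.-integrable setT (EFin \o G) ->
  \int[leb]_t \int[leb]_u G (t, u) = fine (\int[leb2]_z (G z)%:E)%E.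
Proof.
move=> iG; rewrite -integral12_prod_meas1//; congr fine.
have mF := measurable_fubini_F iG.
have mF' : measurable_fun setT
    (fun t : RM => \int[leb]_u G (t, u)).
  exact: (measurableT_comp (fine_measurable measurableT) mF).
apply: ae_eq_integral => //.
  exact/measurable_EFinP.
have := ae_integrable1 iG.
apply: (@filterS _ _ (ae_filter_ringOfSetsType leb)) => t /= it _.
by rewrite /fubini_F /Rintegral fineK//; exact: integrable_fin_num.
Qed.

Lemma integrable_Rintegral_section (G : RM * RM -> R) :
  leb2.-integrable setT (EFin \o G) ->
  leb.-integrable setT (EFin \o (fun t : RM => \int[leb]_u G (t, u))).
Proof.
move=> iG; have iF := integrable_fubini_F iG.
have mF' : measurable_fun setT (fun t : RM => \int[leb]_u G (t, u)).
  exact: (measurableT_comp (fine_measurable measurableT) (measurable_fubini_F iG)).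
apply: le_integrable iF => //; first exact/measurable_EFinP.
move=> t _; rewrite /= /Rintegral /fubini_F /comp.
by case: (integral _ _ _) => [r| |] //=; rewrite ?normr0 leey.
Qed.

Lemma measurable_shear (G : RM * RM -> R) : measurable_fun setT G ->
  measurable_fun setT (fun z : RM * RM => G (z.1 + z.2, z.2)).
Proof.
move=> mG; apply: (measurableT_comp mG).
apply: measurable_fun_pair; last exact: measurable_snd.
by apply: measurable_funD; [exact: measurable_fst|exact: measurable_snd].
Qed.

(** A shear preserves Lebesgue measure of the plane. *)
Lemma integrable_shear (G : RM * RM -> R) : leb2.-integrable setT (EFin \o G) ->
  leb2.-integrable setT (EFin \o (fun z : RM * RM => G (z.1 + z.2, z.2))).
Proof.
move=> iG; have mG : measurable_fun setT G.
  by apply/measurable_EFinP; exact: measurable_int iG.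
apply/integrable21ltyP.
  by apply/measurable_EFinP; exact: measurable_shear.
move/(integrable21ltyP _ _ (measurable_int _ iG)) : iG; apply: le_lt_trans.
rewrite le_eqVlt; apply/orP; left; apply/eqP; apply: eq_integral => u _ /=.
apply: (@ge0_integral_shift R u (fun s => `|G (s, u)|%:E)) => //.
apply/measurable_EFinP; apply: measurableT_comp => //.
exact: measurable_fun_pair1.
Qed.

Lemma integral_shear (G : RM * RM -> R) : leb2.-integrable setT (EFin \o G) ->
  (\int[leb2]_z (G (z.1 + z.2, z.2))%:E = \int[leb2]_z (G z)%:E)%E.
Proof.
move=> iG; have mG : measurable_fun setT G.
  by apply/measurable_EFinP; exact: measurable_int iG.
have iG' := integrable_shear iG.
have := integral21_prod_meas1 iG'; rewrite /comp => <-.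
have := integral21_prod_meas1 iG; rewrite /comp => <-.
apply: eq_integral => u _; rewrite /fubini_G/=.
apply: (@integral_shift R u (fun s => (G (s, u))%:E)).
by apply/measurable_EFinP; exact: measurable_fun_pair1.
Qed.

Lemma Rintegral_iterated_shear (G : RM * RM -> R) :
  leb2.-integrable setT (EFin \o G) ->
  \int[leb]_t \int[leb]_u G (t + u, u) = \int[leb]_s \int[leb]_u G (s, u).
Proof.
move=> iG; rewrite (Rintegral_iterated (integrable_shear iG)) Rintegral_iterated//.
by congr fine; exact: integral_shear.
Qed.

Lemma integrable_dominated_prod (G : RM * RM -> R) (p q : RM -> R) :
  measurable_fun setT G -> leb.-integrable setT (EFin \o p) ->
  leb.-integrable setT (EFin \o q) ->
  (forall s u, `|G (s, u)| <= p s * q u) ->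
  leb2.-integrable setT (EFin \o G).
Proof.
move=> mG ip iq Gpq.
have mp : measurable_fun setT p by apply/measurable_EFinP; exact: measurable_int ip.
have mq : measurable_fun setT q by apply/measurable_EFinP; exact: measurable_int iq.
(* by Tonelli, the dominating product function is integrable *)
pose H (z : RM * RM) := p z.1 * q z.2.
have mH : measurable_fun setT H.
  apply: measurable_funM.
    exact: (measurableT_comp mp (@measurable_fst _ _ _ _)).
  exact: (measurableT_comp mq (@measurable_snd _ _ _ _)).
suff iH : leb2.-integrable setT (EFin \o H).
  apply: le_integrable iH => //; first exact/measurable_EFinP.
  move=> [s u] _ /=; rewrite lee_fin (le_trans (Gpq s u))//.
  exact: ler_norm.
apply/integrable12ltyP; first exact/measurable_EFinP.
move/integrableP : ip => [_ ip]; move/integrableP : iq => [_ iq].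
rewrite (eq_integral (fun s => `|(p s)%:E| * \int[leb]_u `|(q u)%:E|)%E); last first.
  move=> s _; rewrite -ge0_integralZl//.
  - by apply: eq_integral => u _; rewrite /H/= normrM EFinM.
  - by apply/measurable_EFinP; exact: measurableT_comp.
rewrite ge0_integralZr//.
- by apply: lte_mul_pinfty => //; [exact: integral_ge0|rewrite ge0_fin_numE//; exact: integral_ge0].
- by apply/measurable_EFinP; exact: measurableT_comp.
- exact: integral_ge0.
Qed.

End Shear.

(** * Iterated complex integrals over a triangle *)

Section ComplexShear.
Context {R : realType}.
Local Notation C := R[i].
Local Notation leb := (@lebesgue_measure R).
Local Notation RM := (measurableTypeR R).

(** Measurable complex functions on the plane. *)
Definition cmeas2 (G : RM * RM -> C) : Prop :=
  measurable_fun setT (fun z => complex.Re (G z)) /\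
  measurable_fun setT (fun z => complex.Im (G z)).

(** Integrability on the whole line of a complex function. *)
Definition cinteT (f : R -> C) : Prop :=
  leb.-integrable setT (EFin \o (fun x => complex.Re (f x))) /\
  leb.-integrable setT (EFin \o (fun x => complex.Im (f x))).

Lemma Rintegral_itv_if (f : R -> R) (x y : R) :
  \int[leb]_(t in `[x, y]) f t = \int[leb]_t (if x <= t <= y then f t else 0).
Proof.
rewrite Rintegral_mkcond; apply: eq_Rintegral => t _.
rewrite patchE; case: ifPn; rewrite ?notin_setE ?inE/= in_itv/=.
  by move=> ->.
by move/negP/negbTE => ->.
Qed.

Lemma integrable_itv_if (f : R -> R) (x y : R) :
  leb.-integrable `[x, y] (EFin \o f) ->
  leb.-integrable setT (EFin \o (fun t => if x <= t <= y then f t else 0)).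
Proof.
move/integrable_mkcond => /(_ (measurable_itv _)); apply: eq_integrable => // t _ /=.
rewrite patchE; case: ifPn; rewrite ?notin_setE ?inE/= in_itv/=.
  by move=> ->.
by move/negP/negbTE => ->.
Qed.

Lemma cint_itv_if (f : R -> C) (x y : R) :
  cint `[x, y] f = cint setT (fun t => if x <= t <= y then f t else 0).
Proof.
congr Complex; rewrite Rintegral_itv_if; apply: eq_Rintegral => t _; by case: ifP.
Qed.

Lemma integrableT_itv (f : R -> R) (x y : R) : leb.-integrable setT (EFin \o f) ->
  leb.-integrable `[x, y] (EFin \o f).
Proof. exact: integrableS. Qed.

Lemma cinteT_itv (f : R -> C) (x y : R) : cinteT f ->
  cinteT (fun t => if x <= t <= y then f t else 0).
Proof.
move=> [f1 f2]; split.
  apply: eq_integrable (integrable_itv_if (integrableT_itv x y f1)) => // t _ /=.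
  by case: ifP.
apply: eq_integrable (integrable_itv_if (integrableT_itv x y f2)) => // t _ /=.
by case: ifP.
Qed.

Lemma cint_0 : cint setT (fun _ : R => 0 : C) = 0.
Proof.
have H : \int[leb]_(_ in setT) (0 : R) = 0.
  by rewrite Rintegral_cst ?mul0r.
by apply: complex_ext; exact: H.
Qed.

Lemma integrableT_scale (a : R) (g : R -> R) : leb.-integrable setT (EFin \o g) ->
  leb.-integrable setT (EFin \o (fun t => a * g t)).
Proof. exact: integrableZl. Qed.

Lemma cinte_itv (f : R -> C) (y : R) : cinte f -> y <= 1 ->
  cinteT (fun t => if 0 <= t <= y then f t else 0).
Proof.
move=> [f1 f2] y1; have h := sub_itv0 y1; split.
  have := integrable_itv_if (inteS (measurable_itv _) h f1).
  by apply: eq_integrable => // t _ /=; case: ifP.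
have := integrable_itv_if (inteS (measurable_itv _) h f2).
by apply: eq_integrable => // t _ /=; case: ifP.
Qed.

Lemma cinteT_cinte (f : R -> C) : cinteT f -> cinte f.
Proof. by move=> [f1 f2]; split; exact: integrableT_itv. Qed.

Lemma cintTZ (c : C) (f : R -> C) : cinteT f ->
  cint setT (fun t => c * f t) = c * cint setT f.
Proof.
move=> [f1 f2].
apply: complex_ext.
  rewrite ReCM /cint [LHS]/= [X in _ * X - _]/= [X in _ - _ * X]/=.
  rewrite -!RintegralZl// -RintegralB//; [|exact: integrableT_scale..].
  by apply: eq_Rintegral => t _; rewrite ReCM.
rewrite ImCM /cint [LHS]/= [X in _ * X + _]/= [X in _ + _ * X]/=.
rewrite -!RintegralZl// -RintegralD//; [|exact: integrableT_scale..].
by apply: eq_Rintegral => t _; rewrite ImCM.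
Qed.

Lemma cint_iterated_shear (G : RM * RM -> C) (p q : RM -> R) : cmeas2 G ->
  leb.-integrable setT (EFin \o p) -> leb.-integrable setT (EFin \o q) ->
  (forall s u, cabs (G (s, u)) <= p s * q u) ->
  cint setT (fun t => cint setT (fun u => G (t + u, u))) =
  cint setT (fun s => cint setT (fun u => G (s, u))).
Proof.
move=> [m1 m2] ip iq Gpq; apply: complex_ext; rewrite /cint; cbn [complex.Re complex.Im].
  apply: (@Rintegral_iterated_shear R (fun z => complex.Re (G z))).
  apply: integrable_dominated_prod ip iq _ => // s u.
  exact: le_trans (cabs_Re _) (Gpq s u).
apply: (@Rintegral_iterated_shear R (fun z => complex.Im (G z))).
apply: integrable_dominated_prod ip iq _ => // s u.
exact: le_trans (cabs_Im _) (Gpq s u).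
Qed.

Lemma cinteT_iterated_shear (G : RM * RM -> C) (p q : RM -> R) : cmeas2 G ->
  leb.-integrable setT (EFin \o p) -> leb.-integrable setT (EFin \o q) ->
  (forall s u, cabs (G (s, u)) <= p s * q u) ->
  cinteT (fun t => cint setT (fun u => G (t + u, u))).
Proof.
move=> [m1 m2] ip iq Gpq; split; rewrite /cint; cbn [complex.Re complex.Im].
  have iG : (leb \x leb)%E.-integrable setT (EFin \o (fun z => complex.Re (G z))).
    apply: integrable_dominated_prod ip iq _ => // s u.
    exact: le_trans (cabs_Re _) (Gpq s u).
  exact: integrable_Rintegral_section (integrable_shear iG).
have iG : (leb \x leb)%E.-integrable setT (EFin \o (fun z => complex.Im (G z))).
  apply: integrable_dominated_prod ip iq _ => // s u.
  exact: le_trans (cabs_Im _) (Gpq s u).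
exact: integrable_Rintegral_section (integrable_shear iG).
Qed.

Lemma cmeas2M (G H : RM * RM -> C) : cmeas2 G -> cmeas2 H ->
  cmeas2 (fun z => G z * H z).
Proof.
move=> [g1 g2] [h1 h2]; split.
  under eq_fun do rewrite ReCM.
  by apply: measurable_funB; exact: measurable_funM.
under eq_fun do rewrite ImCM.
by apply: measurable_funD; exact: measurable_funM.
Qed.

Lemma cmeas2_cexp (z : C) :
  cmeas2 (fun w : RM * RM => cexp (real_complex R (w.1 - w.2) * z)).
Proof.
have mf (f : R -> R) (a : R) : continuous f ->
    measurable_fun setT (fun w : RM * RM => f ((w.1 - w.2) * a)).
  move=> cf; apply: (measurableT_comp (continuous_measurable_fun cf)).
  apply: measurable_funM; last exact: measurable_cst.
  by apply: measurable_funB; [exact: measurable_fst|exact: measurable_snd].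
have rz (a : R) : complex.Re (real_complex R a * z) = a * complex.Re z.
  by rewrite ReCM/= mul0r subr0.
have iz (a : R) : complex.Im (real_complex R a * z) = a * complex.Im z.
  by rewrite ImCM/= mul0r addr0.
split; rewrite /cexp/=; under eq_fun do rewrite rz iz.
  by apply: measurable_funM; apply: mf; [exact: continuous_expR|exact: continuous_cos].
by apply: measurable_funM; apply: mf; [exact: continuous_expR|exact: continuous_sin].
Qed.

Lemma cmeas2_triangle (x : R) (G : RM * RM -> C) : cmeas2 G ->
  cmeas2 (fun z => if [&& 0 <= z.2, z.2 <= z.1 & z.1 <= x] then G z else 0).
Proof.
have m1 : measurable_fun setT (@fst RM RM) by exact: measurable_fst.
have m2 : measurable_fun setT (@snd RM RM) by exact: measurable_snd.
have mb : measurable_fun setT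
    (fun z : RM * RM => [&& 0 <= z.2, z.2 <= z.1 & z.1 <= x]).
  by apply: measurable_and; [|apply: measurable_and]; apply: measurable_fun_ler.
move=> [g1 g2]; split.
  rewrite (_ : (fun _ => _) = (fun z : RM * RM =>
    if [&& 0 <= z.2, z.2 <= z.1 & z.1 <= x] then complex.Re (G z) else 0)).
    exact: measurable_fun_ifT.
  by apply/funext => z; case: ifP.
rewrite (_ : (fun _ => _) = (fun z : RM * RM =>
  if [&& 0 <= z.2, z.2 <= z.1 & z.1 <= x] then complex.Im (G z) else 0)).
  exact: measurable_fun_ifT.
by apply/funext => z; case: ifP.
Qed.

(** Change of the order of integration over the triangle
    [0 <= u <= s <= x], with [s = t + u].  The constant [c] stands inside the
    left-hand integral because the integrability needed to take it out is a
    by-product of the proof. *)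
Lemma cint_triangle (h : R -> R -> C) (p q : R -> R) (c z : C) (x : R) : x <= 1 ->
  cmeas2 (fun w => h w.1 w.2) ->
  leb.-integrable setT (EFin \o p) -> leb.-integrable setT (EFin \o q) ->
  (forall s u, cabs (h s u) <= p s * q u) ->
  (forall t, cinteT (fun u => h (t + u) u)) ->
  cint `[0, x] (fun t => c * (cexp (real_complex R t * z) *
    cint `[0, x - t] (fun u => h (t + u) u))) =
  c * cint `[0, x] (fun s => cexp (real_complex R s * z) *
    cint `[0, s] (fun u => cexp (- (real_complex R u * z)) * h s u)).
Proof.
move=> x1 mh ip iq hpq ih.
pose G (w : RM * RM) := if [&& 0 <= w.2, w.2 <= w.1 & w.1 <= x] then
  cexp (real_complex R (w.1 - w.2) * z) * h w.1 w.2 else 0.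
have mG : cmeas2 G.
  by apply: cmeas2_triangle; apply: cmeas2M => //; exact: cmeas2_cexp.
pose M := expR `|complex.Re z|.
have GM s u : cabs (G (s, u)) <= M * p s * q u.
  have pq0 : 0 <= p s * q u by exact: le_trans (cabs_ge0 _) (hpq s u).
  rewrite /G/=; case: ifP => [/and3P[u0 us sx]|_]; last first.
    by rewrite cabs0 -mulrA mulr_ge0// expR_ge0.
  rewrite cabsM -mulrA ler_pM ?cabs_ge0// cabs_cexp ReCM/= mul0r subr0 ler_expR.
  rewrite (le_trans (ler_norm _))// normrM ler_piMl// ger0_norm ?subr_ge0//; lra.
have iMp : leb.-integrable setT (EFin \o (fun s => M * p s)).
  exact: integrableT_scale.
have := cint_iterated_shear mG iMp iq GM.
have row s : cinteT (fun u => h s u).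
  have [m1 m2] := mh; split.
  - apply: le_integrable (integrableT_scale (p s) iq) => //.
      by apply/measurable_EFinP; exact: (@measurable_fun_pair2 _ _ _ RM RM _ (fun w => complex.Re (h w.1 w.2)) s).
    move=> u _ /=; rewrite lee_fin (le_trans (cabs_Re _))// (le_trans (hpq s u))//.
    exact: ler_norm.
  - apply: le_integrable (integrableT_scale (p s) iq) => //.
      by apply/measurable_EFinP; exact: (@measurable_fun_pair2 _ _ _ RM RM _ (fun w => complex.Im (h w.1 w.2)) s).
    move=> u _ /=; rewrite lee_fin (le_trans (cabs_Im _))// (le_trans (hpq s u))//.
    exact: ler_norm.
move=> E; transitivity (cint setT (fun t => c * cint setT (fun u => G (t + u, u)))).
  rewrite cint_itv_if; apply: eq_cint => t _; case: ifPn => [/andP[t0 tx]|tx].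
    apply: (congr1 (GRing.mul _)).
    rewrite cint_itv_if -cintTZ; last exact: cinteT_itv.
    apply: eq_cint => u _; rewrite /G [(t + u, u).1]/= [(t + u, u).2]/= lerDr t0/=.
    have -> : (u <= x - t) = (t + u <= x) by rewrite lerBrDl.
    by case: ifP => _; [rewrite addrK|rewrite mulr0].
  rewrite (_ : (fun u => G _) = (fun u => 0)).
    by rewrite cint_0 mulr0.
  apply/funext => u; rewrite /G [(t + u, u).1]/= [(t + u, u).2]/= lerDr.
  case: ifP => [/and3P[u0 t0 tux]|_]; last by [].
  have t0x : 0 <= t <= x by rewrite t0 (le_trans _ tux) ?lerDl.
  by rewrite t0x in tx.
rewrite cintTZ; last exact: cinteT_iterated_shear mG iMp iq GM.
apply: (congr1 (GRing.mul _)).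
rewrite E cint_itv_if; apply: eq_cint => s _; case: ifPn => [/andP[s0 sx]|sx].
  rewrite cint_itv_if -cintTZ; last first.
    apply: cinte_itv; last exact: le_trans sx x1.
    apply: cbmeas_cinteM (cinteT_cinte (row s)).
    apply: (cprim_cbmeas (h := fun u => - z * cexp (real_complex R u * - z))).
    apply: eq_cprim (cprim_cexp (- z)) => u _; first by rewrite mulrN.
    reflexivity.
  apply: eq_cint => u _; rewrite /G [(s, u).1]/= [(s, u).2]/= sx andbT.
  case: ifP => _; last by rewrite mulr0.
  rewrite mulrA -cexpD; congr (cexp _ * _).
  by rewrite rmorphB mulrBl.
rewrite (_ : (fun u => G _) = (fun u => 0)).
  by rewrite cint_0.
apply/funext => u; rewrite /G [(s, u).1]/= [(s, u).2]/=.
case: ifP => [/and3P[u0 us sx']|_]; last by [].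
have s0x : 0 <= s <= x by rewrite sx' (le_trans u0 us).
by rewrite s0x in sx.
Qed.

End ComplexShear.

(** * Convolutions of square integrable functions *)

Section Convolutions.
Context {R : realType}.
Local Notation C := R[i].
Local Notation leb := (@lebesgue_measure R).
Local Notation RM := (measurableTypeR R).
Local Notation inte h := (leb.-integrable `[0, 1] (EFin \o h)).

(** Extension by zero outside [0, 1], which makes translates of a function on
    [0, 1] meaningful on the whole line. *)
Definition ext0 (s : R -> C) (x : R) : C := if 0 <= x <= 1 then s x else 0.

(** Measurable functions on the line that are integrable and square integrable. *)
Definition sqT (e : R -> C) : Prop :=
  [/\ measurable_fun (setT : set RM) (fun x : RM => complex.Re (e x)),
      measurable_fun (setT : set RM) (fun x : RM => complex.Im (e x)),
      leb.-integrable setT (EFin \o (fun x => cabs (e x) ^+ 2)) &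
      leb.-integrable setT (EFin \o (fun x => cabs (e x)))].

Lemma measurable_ext0 (f : R -> R) : measurable_fun (`[0, 1] : set R) f ->
  measurable_fun (setT : set RM) (fun x : RM => if 0 <= x <= 1 then f x else 0).
Proof.
move=> mf; have := (measurable_restrictT f (measurable_itv `[0, 1])).1 mf.
congr measurable_fun; apply/funext => t.
rewrite patchE; case: ifPn; rewrite ?notin_setE ?inE/= in_itv/=.
  by move=> ->.
by move/negP/negbTE => ->.
Qed.

Lemma ext0_sqT (s : R -> C) : in_Lp 2 s -> sqT (ext0 s).
Proof.
move=> s2; have [m1 m2 _] := s2; have [i2 _] := @in_Lp_integral _ s 2%N isT s2.
have i1 := cinte_cabs (in_L2_cinte s2).
split.
- rewrite (_ : (fun _ => _) = (fun x : RM => if 0 <= x <= 1 then complex.Re (s x) else 0)).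
    exact: measurable_ext0.
  by apply/funext => x; rewrite /ext0; case: ifP.
- rewrite (_ : (fun _ => _) = (fun x : RM => if 0 <= x <= 1 then complex.Im (s x) else 0)).
    exact: measurable_ext0.
  by apply/funext => x; rewrite /ext0; case: ifP.
- have := integrable_itv_if i2; apply: eq_integrable => // x _ /=.
  by rewrite /ext0; case: ifP => // _; rewrite cabs0 expr0n.
- have := integrable_itv_if i1; apply: eq_integrable => // x _ /=.
  by rewrite /ext0; case: ifP => // _; rewrite cabs0.
Qed.

Lemma measurable_RMshift (f : RM -> R) (t : R) : measurable_fun setT f ->
  measurable_fun setT (fun x : RM => f (t + x)).
Proof.
move=> mf; apply: (measurableT_comp mf).
exact: (@measurable_funD _ _ _ setT (fun=> t) (fun x => x)).
Qed.

Lemma integrable_RMshift (f : RM -> R) (t : R) : leb.-integrable setT (EFin \o f) ->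
  leb.-integrable setT (EFin \o (fun x : RM => f (t + x))).
Proof.
move=> ifT; have mf : measurable_fun setT f.
  by apply/measurable_EFinP; exact: measurable_int ifT.
apply/integrableP; split.
  by apply/measurable_EFinP; exact: measurable_RMshift.
move/integrableP : ifT => [_]; apply: le_lt_trans.
rewrite -(@ge0_integral_shift R t (fun x => `|(f x)%:E|)%E) //.
  rewrite le_eqVlt; apply/orP; left; apply/eqP; apply: eq_integral => x _ /=.
  by rewrite addrC.
by apply/measurable_EFinP; exact: measurableT_comp.
Qed.

Lemma Rintegral_RMshift (f : RM -> R) (t : R) : measurable_fun setT f ->
  \int[leb]_x f (t + x) = \int[leb]_x f x.
Proof.
move=> mf; rewrite /Rintegral -(@integral_shift R t (fun x => (f x)%:E)).
  by congr fine; apply: eq_integral => x _; rewrite addrC.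
exact/measurable_EFinP.
Qed.

Lemma cinteT_le (f : R -> C) (g : R -> R) :
  measurable_fun (setT : set RM) (fun x : RM => complex.Re (f x)) ->
  measurable_fun (setT : set RM) (fun x : RM => complex.Im (f x)) ->
  (forall x, cabs (f x) <= g x) -> leb.-integrable setT (EFin \o g) -> cinteT f.
Proof.
move=> m1 m2 fg ig; split; apply: le_integrable ig => //.
- exact/measurable_EFinP.
- move=> x _ /=; rewrite lee_fin (le_trans (cabs_Re _))// (le_trans (fg x))//.
  exact: ler_norm.
- exact/measurable_EFinP.
- move=> x _ /=; rewrite lee_fin (le_trans (cabs_Im _))// (le_trans (fg x))//.
  exact: ler_norm.
Qed.

Lemma cabs_cintT (f : R -> C) (g : R -> R) : cinteT f ->
  (forall x, cabs (f x) <= g x) -> leb.-integrable setT (EFin \o g) ->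
  cabs (cint setT f) <= 2 * \int[leb]_x g x.
Proof.
move=> [i1 i2] fg ig.
rewrite (le_trans (cabs_le_ReIm _))//= mulr_natl mulr2n lerD//.
  rewrite (le_trans (le_normr_Rintegral _ _))//; apply: le_Rintegral => //.
    exact: integrable_norm.
  by move=> x _; exact: le_trans (cabs_Re _) (fg x).
rewrite (le_trans (le_normr_Rintegral _ _))//; apply: le_Rintegral => //.
  exact: integrable_norm.
by move=> x _; exact: le_trans (cabs_Im _) (fg x).
Qed.

Lemma ler_prod_sqr (x y : R) : 0 <= x -> 0 <= y -> x * y <= x ^+ 2 + y ^+ 2.
Proof. by move=> x0 y0; have := sqr_ge0 (x - y); have := mulr_ge0 x0 y0; rewrite sqrrB; lra. Qed.

(** Joint measurability suffices; no integrability is assumed. *)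
Lemma measurable_parametric (F : (RM * RM) * RM -> R) : measurable_fun setT F ->
  measurable_fun setT (fun w => \int[leb]_y F (w, y)).
Proof.
move=> mF; have mF' : measurable_fun setT (EFin \o F) by exact/measurable_EFinP.
have H : measurable_fun setT (fun w => \int[leb]_y (EFin \o F) (w, y))%E.
  (* Tonelli's theorem applies to the positive and to the negative part *)
  rewrite (_ : (fun _ => _) = (fun w => fubini_F leb (EFin \o F)^\+ w -
      fubini_F leb (EFin \o F)^\- w)%E).
    apply: emeasurable_funB.
      apply: measurable_fun_fubini_tonelli_F; last by [].
      exact: measurable_funepos.
    apply: measurable_fun_fubini_tonelli_F; last by [].
    exact: measurable_funeneg.
  apply/funext => w; rewrite integralE /fubini_F.
  congr (_ - _)%E; apply: eq_integral => y _.
    by rewrite (funepos_comp (EFin \o F) (fun y => (w, y))).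
  by rewrite (funeneg_comp (EFin \o F) (fun y => (w, y))).
exact: (measurableT_comp (fine_measurable measurableT) H).
Qed.

Context (e e' : R -> C).
Context (se : sqT e) (se' : sqT e').

Lemma cinteT_shift_prod (t : R) : cinteT (fun x => e (t + x) * e' x).
Proof.
have [m1 m2 ie _] := se; have [m1' m2' ie' _] := se'.
apply: (@cinteT_le _ (fun x => cabs (e (t + x)) ^+ 2 + cabs (e' x) ^+ 2)).
- under eq_fun do rewrite ReCM.
  apply: measurable_funB; apply: measurable_funM => //.
    exact: (measurable_RMshift (f := fun x => complex.Re (e x))).
  exact: (measurable_RMshift (f := fun x => complex.Im (e x))).
- under eq_fun do rewrite ImCM.
  apply: measurable_funD; apply: measurable_funM => //.
    exact: (measurable_RMshift (f := fun x => complex.Re (e x))).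
  exact: (measurable_RMshift (f := fun x => complex.Im (e x))).
- by move=> x; rewrite cabsM ler_prod_sqr// cabs_ge0.
- have := integrableD measurableT (integrable_RMshift (f := fun x => cabs (e x) ^+ 2) t ie) ie'.
  exact: eq_integrable.
Qed.

(** A uniform bound for the convolution of [e] and [e']. *)
Definition convB : R :=
  2 * (\int[leb]_x (cabs (e x) ^+ 2) + \int[leb]_x (cabs (e' x) ^+ 2)).

Lemma cabs_sigma_conv (s u : R) : cabs (sigma_conv e e' s u) <= convB.
Proof.
have [m1 m2 ie _] := se; have [m1' m2' ie' _] := se'.
have it := integrable_RMshift (f := fun x => cabs (e x) ^+ 2) u ie.
have i2 : leb.-integrable setT
    (EFin \o (fun x => cabs (e (u + x)) ^+ 2 + cabs (e' x) ^+ 2)).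
  by have := integrableD measurableT it ie'; exact: eq_integrable.
rewrite /convB -(@Rintegral_RMshift (fun x => cabs (e x) ^+ 2) u); last first.
  by apply/measurable_EFinP; exact: measurable_int ie.
rewrite -RintegralD// /sigma_conv cint_itv_if; apply: cabs_cintT => //.
  by apply: cinteT_itv; exact: cinteT_shift_prod.
move=> x; case: ifP => _.
  by rewrite cabsM ler_prod_sqr// cabs_ge0.
by rewrite cabs0 addr_ge0// exprn_ge0// cabs_ge0.
Qed.

Lemma cmeas2_sigma_conv : cmeas2 (fun w => sigma_conv e e' w.1 w.2).
Proof.
have [m1 m2 _ _] := se; have [m1' m2' _ _] := se'.
pose T3 := ((RM * RM) * RM)%type.
have p1 : measurable_fun setT (fun z : T3 => z.1.1).
  exact: (measurableT_comp (@measurable_fst _ _ RM RM) (@measurable_fst _ _ (RM * RM)%type RM)).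
have p2 : measurable_fun setT (fun z : T3 => z.1.2).
  exact: (measurableT_comp (@measurable_snd _ _ RM RM) (@measurable_fst _ _ (RM * RM)%type RM)).
have p3 : measurable_fun setT (fun z : T3 => z.2) by exact: measurable_snd.
have p23 : measurable_fun setT (fun z : T3 => z.1.2 + z.2) by exact: measurable_funD.
have mb : measurable_fun setT (fun z : T3 => 0 <= z.2 <= z.1.1 - z.1.2).
  by apply: measurable_and; apply: measurable_fun_ler => //; exact: measurable_funB.
have c1 := measurableT_comp m1 p23; have c2 := measurableT_comp m2 p23.
have c1' := measurableT_comp m1' p3; have c2' := measurableT_comp m2' p3.
pose FRe (z : T3) := if 0 <= z.2 <= z.1.1 - z.1.2 then
  complex.Re (e (z.1.2 + z.2)) * complex.Re (e' z.2) -
  complex.Im (e (z.1.2 + z.2)) * complex.Im (e' z.2) else 0.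
have mRe : measurable_fun setT FRe.
  apply: measurable_fun_ifT; [exact: mb| |exact: measurable_cst].
  by apply: measurable_funB; exact: measurable_funM.
pose FIm (z : T3) := if 0 <= z.2 <= z.1.1 - z.1.2 then
  complex.Re (e (z.1.2 + z.2)) * complex.Im (e' z.2) +
  complex.Im (e (z.1.2 + z.2)) * complex.Re (e' z.2) else 0.
have mIm : measurable_fun setT FIm.
  apply: measurable_fun_ifT; [exact: mb| |exact: measurable_cst].
  by apply: measurable_funD; exact: measurable_funM.
split.
  rewrite (_ : (fun _ => _) = (fun w : RM * RM => \int[leb]_y FRe (w, y))).
    exact: measurable_parametric mRe.
  apply/funext => w; rewrite /sigma_conv /cint; cbn [complex.Re].
  rewrite Rintegral_itv_if; apply: eq_Rintegral => y _; rewrite /FRe.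
  by rewrite ReCM.
rewrite (_ : (fun _ => _) = (fun w : RM * RM => \int[leb]_y FIm (w, y))).
  exact: measurable_parametric mIm.
apply/funext => w; rewrite /sigma_conv /cint; cbn [complex.Im].
rewrite Rintegral_itv_if; apply: eq_Rintegral => y _; rewrite /FIm.
by rewrite ImCM.
Qed.

End Convolutions.

(** * The convolution kernels as iterated integrals *)

Section IteratedKernels.
Context {R : realType}.
Local Notation C := R[i].
Local Notation leb := (@lebesgue_measure R).
Local Notation RM := (measurableTypeR R).
Local Notation inte h := (leb.-integrable `[0, 1] (EFin \o h)).

Lemma cintMl (c : C) (f : R -> C) (x : R) : cinte f -> 0 <= x <= 1 ->
  cint `[0, x] (fun t => c * f t) = c * cint `[0, x] f.
Proof.
move=> cf x01; have := cprimE (cprimM (cprim_cst c) (cprim_cint cf)) x01.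
rewrite cint0 mulr0 add0r => ->.
by apply: eq_cint => t _; rewrite mul0r add0r.
Qed.

Lemma cbmeas_cexp (z : C) : cbmeas (fun x => cexp (real_complex R x * z)).
Proof. exact: cprim_cbmeas (cprim_cexp z). Qed.

Lemma cbmeas_cexpN (z : C) : cbmeas (fun x => cexp (- (real_complex R x * z))).
Proof.
have := cbmeas_cexp (- z); congr cbmeas; apply/funext => x; by rewrite mulrN.
Qed.

Lemma cmeas2_fst (e : R -> C) : sqT e -> cmeas2 (fun w : RM * RM => e w.1).
Proof.
move=> [m1 m2 _ _]; split.
  exact: (measurableT_comp m1 (@measurable_fst _ _ RM RM)).
exact: (measurableT_comp m2 (@measurable_fst _ _ RM RM)).
Qed.

Lemma cmeas2_snd (e : R -> C) : sqT e -> cmeas2 (fun w : RM * RM => e w.2).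
Proof.
move=> [m1 m2 _ _]; split.
  exact: (measurableT_comp m1 (@measurable_snd _ _ RM RM)).
exact: (measurableT_comp m2 (@measurable_snd _ _ RM RM)).
Qed.

Lemma sqT_cinte (e : R -> C) : sqT e -> cinteT e.
Proof. by move=> [m1 m2 _ i1]; exact: cinteT_le m1 m2 (fun x => lexx _) i1. Qed.

(** The second iterated integral, for functions on the whole line. *)
Lemma cint_sigma_conv_total (e e' : R -> C) (c z : C) (x : R) : sqT e -> sqT e' ->
  x <= 1 ->
  cint `[0, x] (fun t => c * (cexp (real_complex R t * z) * sigma_conv e e' x t)) =
  c * cint `[0, x] (fun s => (cexp (real_complex R s * z) * e s) *
    cint `[0, s] (fun u => cexp (- (real_complex R u * z)) * e' u)).
Proof.
move=> se se' x1; have [_ _ _ i1] := se; have [_ _ _ i1'] := se'.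
rewrite (@cint_triangle R (fun s u => e s * e' u) _ _ c z x x1 _ i1 i1').
- apply: (congr1 (GRing.mul _)).
  apply: eq_cint => s /=; rewrite in_itv/= => /andP[s0 sx].
  rewrite -mulrA; congr (_ * _); rewrite -cintMl ?s0 ?(le_trans sx)//; last first.
    apply: cbmeas_cinteM; first exact: cbmeas_cexpN.
    exact: cinteT_cinte (sqT_cinte se').
  by apply: eq_cint => u _; rewrite mulrCA.
- by apply: cmeas2M; [exact: cmeas2_fst|exact: cmeas2_snd].
- by move=> s u; rewrite cabsM.
- by move=> t; exact: cinteT_shift_prod.
Qed.

(** The third iterated integral: the change of variables of [cint_triangle] is
    used once for the outer convolution and once for the inner one. *)
Lemma cint_Tconv_total (e e' : R -> C) (c z : C) (x : R) : sqT e -> sqT e' ->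
  x <= 1 ->
  cint `[0, x] (fun t => c * (cexp (real_complex R t * z) *
    Tconv e (sigma_conv e' e) x t)) =
  c * cint `[0, x] (fun s => (cexp (real_complex R s * z) * e s) *
    cint `[0, s] (fun u => (cexp (- (real_complex R u * z)) * e' u) *
      cint `[0, u] (fun v => cexp (real_complex R v * z) * e v))).
Proof.
move=> se se' x1; have [m1 m2 _ i1] := se.
(* only 0 <= u <= 1 matters; the cut-off makes the bound integrable in u *)
pose cv s u := if 0 <= u <= 1 then sigma_conv e' e s u else 0.
pose B := convB e' e.
have cvB s u : cabs (cv s u) <= B.
  rewrite /cv; case: ifP => _; first exact: cabs_sigma_conv.
  by rewrite cabs0; exact: le_trans (cabs_ge0 _) (cabs_sigma_conv se' se 0 0).
have B0 : 0 <= B by exact: le_trans (cabs_ge0 _) (cvB 0 0).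
pose q (u : R) : R := if 0 <= u <= 1 then B else 0.
have iq : leb.-integrable setT (EFin \o q).
  exact: integrable_itv_if (inte_cst B).
have [M1 M2] := cmeas2_sigma_conv se' se.
have mb : measurable_fun setT (fun w : RM * RM => 0 <= w.2 <= 1).
  by apply: measurable_and; apply: measurable_fun_ler => //; exact: measurable_snd.
have mcv : cmeas2 (fun w => cv w.1 w.2).
  split.
    rewrite (_ : (fun _ => _) = (fun w : RM * RM =>
      if 0 <= w.2 <= 1 then complex.Re (sigma_conv e' e w.1 w.2) else 0)).
      by apply: measurable_fun_ifT; [exact: mb|exact: M1|exact: measurable_cst].
    by apply/funext => w; rewrite /cv; case: ifP.
  rewrite (_ : (fun _ => _) = (fun w : RM * RM =>
    if 0 <= w.2 <= 1 then complex.Im (sigma_conv e' e w.1 w.2) else 0)).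
    by apply: measurable_fun_ifT; [exact: mb|exact: M2|exact: measurable_cst].
  by apply/funext => w; rewrite /cv; case: ifP.
pose h s u := e s * cv s u.
have mh : cmeas2 (fun w => h w.1 w.2).
  by apply: cmeas2M => //; exact: cmeas2_fst.
have hpq s u : cabs (h s u) <= cabs (e s) * q u.
  rewrite cabsM ler_wpM2l ?cabs_ge0// /q; case: ifPn => [_|/negbTE u01].
    exact: cvB.
  by rewrite /cv u01 cabs0.
have hT t : cinteT (fun u => h (t + u) u).
  have mt : measurable_fun setT (fun u : RM => (t + u, u) : RM * RM).
    apply: measurable_fun_pair; last exact: measurable_id.
    exact: (@measurable_funD _ _ _ setT (fun=> t) (fun x => x)).
  have [mh1 mh2] := mh.
  apply: (@cinteT_le _ _ (fun u => B * cabs (e (t + u)))).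
  - exact: (measurableT_comp mh1 mt).
  - exact: (measurableT_comp mh2 mt).
  - by move=> u; rewrite cabsM mulrC ler_wpM2r ?cabs_ge0.
  - apply: integrableT_scale.
    exact: (integrable_RMshift (f := fun u => cabs (e u))).
transitivity (cint `[0, x] (fun t => c * (cexp (real_complex R t * z) *
    cint `[0, x - t] (fun u => h (t + u) u)))).
  apply: eq_cint => t /=; rewrite in_itv/= => /andP[t0 tx].
  do 2 apply: (congr1 (GRing.mul _)); apply: eq_cint => u /=; rewrite in_itv/= => /andP[u0 ux].
  rewrite /h /cv; have -> : 0 <= u <= 1 by rewrite u0/=; lra.
  reflexivity.
apply: etrans (cint_triangle c z x1 mh i1 iq hpq hT) _.
apply: (congr1 (GRing.mul _)).
apply: eq_cint => s /=; rewrite in_itv/= => /andP[s0 sx].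
have s1 : s <= 1 by exact: le_trans sx x1.
rewrite -mulrA; congr (_ * _).
have cs : cinte (fun u => cexp (- (real_complex R u * z)) * cv s u).
  apply: cbmeas_cinteM; first exact: cbmeas_cexpN.
  have [mc1 mc2] := mcv; apply: (@cinte_le _ _ (fun=> B)).
  - apply: measurable_funTS.
    exact: (@measurable_fun_pair2 _ _ _ RM RM _ (fun w => complex.Re (cv w.1 w.2)) s).
  - apply: measurable_funTS.
    exact: (@measurable_fun_pair2 _ _ _ RM RM _ (fun w => complex.Im (cv w.1 w.2)) s).
  - by move=> u _; exact: cvB.
  - exact: inte_cst.
transitivity (e s * cint `[0, s] (fun u => cexp (- (real_complex R u * z)) * cv s u)).
  by rewrite -cintMl ?s0//; apply: eq_cint => u _; rewrite mulrCA.
congr (_ * _).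
transitivity (cint `[0, s] (fun u =>
    cexp (real_complex R u * - z) * sigma_conv e' e s u)).
  apply: eq_cint => u /=; rewrite in_itv/= => /andP[u0 us].
  by rewrite /cv u0 (le_trans us s1) mulrN.
have := cint_sigma_conv_total 1 (- z) se' se s1; rewrite mul1r => E.
under eq_cint do rewrite -[cexp _ * _]mul1r.
apply: etrans E _.
apply: eq_cint => u _; rewrite mulrN; congr (_ * _).
by apply: eq_cint => v _; rewrite mulrN opprK.
Qed.

(** A diagonal entry of the matrix N yields the second iterate of the kernel. *)
Lemma cint_sigma_conv (s s' : R -> C) (c z : C) (x : R) : in_Lp 2 s -> in_Lp 2 s' ->
  x <= 1 ->
  cint `[0, x] (fun t => c * (cexp (real_complex R t * z) * sigma_conv s s' x t)) =
  c * cint `[0, x] (fun r => (cexp (real_complex R r * z) * s r) *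
    cint `[0, r] (fun u => cexp (- (real_complex R u * z)) * s' u)).
Proof.
move=> s2 s2' x1; transitivity (cint `[0, x] (fun t => c * (cexp (real_complex R t * z) *
    sigma_conv (ext0 s) (ext0 s') x t))).
  apply: eq_cint => t /=; rewrite in_itv/= => /andP[t0 tx].
  do 2 apply: (congr1 (GRing.mul _)).
  apply: eq_cint => u /=; rewrite in_itv/= => /andP[u0 ux].
  have H1 : 0 <= t + u <= 1 by lra.
  have H2 : 0 <= u <= 1 by lra.
  by rewrite /ext0 H1 H2.
apply: etrans (cint_sigma_conv_total c z (ext0_sqT s2) (ext0_sqT s2') x1) _.
apply: (congr1 (GRing.mul _)).
apply: eq_cint => r /=; rewrite in_itv/= => /andP[r0 rx].
have r1 : 0 <= r <= 1 by rewrite r0 (le_trans rx x1).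
rewrite {1}/ext0 r1; apply: (congr1 (GRing.mul _)).
apply: eq_cint => u /=; rewrite in_itv/= => /andP[u0 ur].
have u1 : 0 <= u <= 1 by rewrite u0; lra.
by rewrite /ext0 u1.
Qed.

(** An off-diagonal entry of the matrix N yields the third iterate of the
    kernel. *)
Lemma cint_Tconv (s s' : R -> C) (c z : C) (x : R) : in_Lp 2 s -> in_Lp 2 s' ->
  x <= 1 ->
  cint `[0, x] (fun t => c * (cexp (real_complex R t * z) *
    Tconv s (sigma_conv s' s) x t)) =
  c * cint `[0, x] (fun r => (cexp (real_complex R r * z) * s r) *
    cint `[0, r] (fun u => (cexp (- (real_complex R u * z)) * s' u) *
      cint `[0, u] (fun v => cexp (real_complex R v * z) * s v))).
Proof.
move=> s2 s2' x1; transitivity (cint `[0, x] (fun t => c * (cexp (real_complex R t * z) *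
    Tconv (ext0 s) (sigma_conv (ext0 s') (ext0 s)) x t))).
  apply: eq_cint => t /=; rewrite in_itv/= => /andP[t0 tx].
  do 2 apply: (congr1 (GRing.mul _)).
  apply: eq_cint => u /=; rewrite in_itv/= => /andP[u0 ux].
  have H1 : 0 <= t + u <= 1 by lra.
  rewrite {1}/ext0 H1; apply: (congr1 (GRing.mul _)).
  apply: eq_cint => v /=; rewrite in_itv/= => /andP[v0 vt].
  have H2 : 0 <= u + v <= 1 by lra.
  have H3 : 0 <= v <= 1 by lra.
  by rewrite /ext0 H2 H3.
apply: etrans (cint_Tconv_total c z (ext0_sqT s2) (ext0_sqT s2') x1) _.
apply: (congr1 (GRing.mul _)).
apply: eq_cint => r /=; rewrite in_itv/= => /andP[r0 rx].
have r1 : 0 <= r <= 1 by rewrite r0 (le_trans rx x1).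
rewrite {1}/ext0 r1; apply: (congr1 (GRing.mul _)).
apply: eq_cint => u /=; rewrite in_itv/= => /andP[u0 ur].
have u1 : 0 <= u <= 1 by rewrite u0; lra.
rewrite {1}/ext0 u1; apply: (congr1 (GRing.mul _)).
apply: eq_cint => v /=; rewrite in_itv/= => /andP[v0 vu].
have v1 : 0 <= v <= 1 by rewrite v0; lra.
by rewrite /ext0 v1.
Qed.

End IteratedKernels.

(** * Volterra equations with matrix kernel *)

Lemma volterra_alg3 (V : zmodType) (a k b c e : V) :
  - a + 0 + k - b + c = - (a - k + b - c + e) + e.
Proof. by rewrite !opprD !opprK addr0 addrNK. Qed.

Lemma volterra_alg1 (V : zmodType) (a k b : V) :
  - a + 0 + k = - (a - k + b) + b.
Proof. by rewrite !opprD !opprK addr0 addrNK. Qed.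

Section Volterra.
Context {R : realType}.
Local Notation C := R[i].
Local Notation M2 := 'M[C]_2.
Local Notation leb := (@lebesgue_measure R).
Local Notation inte h := (leb.-integrable `[0, 1] (EFin \o h)).
Local Notation rint h x := (\int[leb]_(t in `[0, x]) h t).

Lemma normMC_mint_le (H : R -> M2) (g : R -> R) (x : R) : minte H -> inte g ->
  (forall t, 0 <= t <= 1 -> normMC (H t) <= g t) -> 0 <= x <= 1 ->
  normMC (mint `[0, x] H) <= 2 * rint g 1.
Proof.
move=> mH ig Hg x01; have /andP[x0 x1] := x01.
apply: le_trans (normMC_mint mH x01) _; rewrite ler_wpM2l//.
apply: (@le_trans _ _ (rint g x)).
  by apply: le_rint => //; exact: minte_normMC.
apply: rint_mono => // t t01; exact: le_trans (normMC_ge0 _) (Hg t t01).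
Qed.

Lemma rint_scale (c : R) (g : R -> R) (x : R) : inte g -> x <= 1 ->
  rint (fun t => c * g t) x = c * rint g x.
Proof. by move=> ig x1; rewrite RintegralZl//; apply: inteS ig => //; exact: sub_itv0. Qed.

Lemma rint_add (f g : R -> R) (x : R) : inte f -> inte g -> x <= 1 ->
  rint (fun t => f t + g t) x = rint f x + rint g x.
Proof.
by move=> f1 g1 x1; rewrite RintegralD//; [apply: inteS f1|apply: inteS g1] => //;
  exact: sub_itv0.
Qed.

Lemma inte_scale (c : R) (g : R -> R) : inte g -> inte (fun t => c * g t).
Proof. by move=> ig; apply: bmeas_inteM ig; apply: ac_bmeas; exact: ac_cst. Qed.

(** A weighted inequality of Cauchy and Schwarz; adding 1 to [int k] avoids the
    distinction of the case [int k = 0]. *)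
Lemma sqr_rint_le (k b : R -> R) : inte k -> bmeas b ->
  (forall t, 0 <= t <= 1 -> 0 <= k t) ->
  rint (fun t => k t * b t) 1 ^+ 2 <= (rint k 1 + 1) * rint (fun t => k t * b t ^+ 2) 1.
Proof.
move=> ik bb k0.
have ikb : inte (fun t => k t * b t).
  by apply: eq_inte (bmeas_inteM bb ik) => t _; rewrite mulrC.
have ikb2 : inte (fun t => k t * b t ^+ 2).
  by apply: eq_inte (bmeas_inteM (bmeasM bb bb) ik) => t _; rewrite mulrC expr2.
set q := rint (fun t => k t * b t) 1; set L := rint k 1.
set G := rint (fun t => k t * b t ^+ 2) 1.
have L0 : 0 <= L by apply: rint_ge0.
(* the integral of k (b - r)^2 is nonnegative for every r; this choice is
   nearly optimal *)
pose r := q / (L + 1).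
have : 0 <= rint (fun t => k t * (b t - r) ^+ 2) 1.
  by apply: rint_ge0 => // t t01; rewrite mulr_ge0 ?k0 ?sqr_ge0.
have -> : rint (fun t => k t * (b t - r) ^+ 2) 1 = G + (- 2 * r) * q + r ^+ 2 * L.
  have i1 := inte_scale (- 2 * r) ikb; have i2 := inte_scale (r ^+ 2) ik.
  have i12 := inteD ikb2 i1.
  rewrite /G /q /L -(rint_scale _ ikb)// -(rint_scale _ ik)//.
  rewrite -(rint_add ikb2 i1)// -(rint_add i12 i2)//.
  by apply: eq_Rintegral => t _; ring.
have -> : q = r * (L + 1) by rewrite /r divfK//; lra.
have := sqr_ge0 r => r2 H.
have : r ^+ 2 * (L + 1) <= G.
  have -> : r ^+ 2 * (L + 1) = - (- 2 * r * (r * (L + 1)) + r ^+ 2 * L) - r ^+ 2 by ring.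
  lra.
move=> HG; rewrite exprMn [(L + 1) ^+ 2]expr2 mulrA mulrC.
by apply: ler_wpM2l => //; lra.
Qed.

Context (K Y : R -> M2).
Context (mK : minte K) (pY : mprim Y (fun x => - (K x *m Y x))) (Y0 : Y 0 = 1%:M).

Let B x := mint `[0, x] K.
Let Y2 x := mint `[0, x] (fun t => K t *m B t).
Let T3 x := mint `[0, x] (fun t => K t *m Y2 t).
Let L := rint (fun t => normMC (K t)) 1.
Let q := rint (fun t => normMC (K t) * normMC (B t)) 1.
Let Gam := rint (fun t => normMC (K t) * normMC (B t) ^+ 2) 1.

Let pB : mprim B K. Proof. exact: mprim_mint. Qed.
Let bB := mprim_mbmeas pB.
Let mKB : minte (fun t => K t *m B t). Proof. exact: minte_mbmeasM. Qed.
Let pY2 : mprim Y2 (fun t => K t *m B t). Proof. exact: mprim_mint. Qed.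
Let bY2 := mprim_mbmeas pY2.
Let mKY2 : minte (fun t => K t *m Y2 t). Proof. exact: minte_mbmeasM. Qed.
Let pT3 : mprim T3 (fun t => K t *m Y2 t). Proof. exact: mprim_mint. Qed.
Let bT3 := mprim_mbmeas pT3.
Let iK := minte_normMC mK.
Let nB := mbmeas_normMC bB.

Let ikb : inte (fun t => normMC (K t) * normMC (B t)).
Proof. by apply: eq_inte (bmeas_inteM nB iK) => t _; rewrite mulrC. Qed.

Let ikb2 : inte (fun t => normMC (K t) * normMC (B t) ^+ 2).
Proof. by apply: eq_inte (bmeas_inteM (bmeasM nB nB) iK) => t _; rewrite mulrC expr2. Qed.

Let L0 : 0 <= L. Proof. by apply: rint_ge0 => // t _; exact: normMC_ge0. Qed.
Let q0 : 0 <= q.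
Proof. by apply: rint_ge0 => // t _; rewrite mulr_ge0 ?normMC_ge0. Qed.
Let Gam0 : 0 <= Gam.
Proof. by apply: rint_ge0 => // t _; rewrite mulr_ge0 ?exprn_ge0 ?normMC_ge0. Qed.

Lemma volterra_sqr_le : q ^+ 2 <= (L + 1) * Gam.
Proof. by apply: sqr_rint_le => // t _; exact: normMC_ge0. Qed.

Lemma volterra_second_le x : 0 <= x <= 1 -> normMC (Y2 x) <= 2 * q.
Proof. by move=> x01; apply: normMC_mint_le => // t _; exact: normMC_M. Qed.

Lemma volterra_third_le x : 0 <= x <= 1 ->
  normMC (T3 x) <= 2 * q * normMC (B x) + 2 * Gam.
Proof.
move=> x01.
have mBKB : minte (fun t => B t *m (K t *m B t)) by exact: mbmeas_minteM.
have -> : T3 x = B x *m Y2 x - mint `[0, x] (fun t => B t *m (K t *m B t)).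
  have := mprimE (mprimM pB pY2) x01; rewrite mintD// => ->.
  by rewrite /B mint0 mul0mx add0r addrK.
rewrite (le_trans (normMC_B _ _))// lerD//.
  rewrite (le_trans (normMC_M _ _))// mulrC ler_wpM2r ?normMC_ge0//.
  exact: volterra_second_le.
apply: normMC_mint_le => // t _; rewrite mulmxA (le_trans (normMC_M3 _ _ _))//.
by rewrite expr2 mulrA [normMC (B t) * _]mulrC.
Qed.

(** The fourth iterate is quadratic in [B] because the third one is
    [B Y2 - int B K B] ([volterra_third_le]). *)
Lemma volterra_fourth_le x : 0 <= x <= 1 ->
  normMC (mint `[0, x] (fun t => K t *m T3 t)) <= 8 * (L + 1) * Gam.
Proof.
move=> x01.
have mKT : minte (fun t => K t *m T3 t) by exact: minte_mbmeasM.
have i1 := inte_scale (2 * q) ikb; have i2 := inte_scale (2 * Gam) iK.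
apply: (@le_trans _ _ (2 * (2 * q * q + 2 * Gam * L))); last first.
  have := volterra_sqr_le; rewrite expr2 => H.
  have : 0 <= L * Gam by rewrite mulr_ge0.
  have := Gam0; lra.
have -> : 2 * q * q + 2 * Gam * L = rint (fun t => 2 * q * (normMC (K t) * normMC (B t)) +
   2 * Gam * normMC (K t)) 1.
  by rewrite rint_add// !rint_scale.
apply: normMC_mint_le => //; first exact: inteD.
move=> t t01; rewrite (le_trans (normMC_M _ _))//.
have := ler_wpM2l (normMC_ge0 (K t)) (volterra_third_le t01).
move/le_trans; apply; rewrite le_eqVlt; apply/orP; left; apply/eqP; ring.
Qed.

Let mNK : minte (fun t => - K t). Proof. exact: minteN. Qed.
Let bY := mprim_mbmeas pY.

Let normNK : rint (fun t => normMC (- K t)) 1 = L.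
Proof. by apply: eq_Rintegral => t _; rewrite normMC_N. Qed.

(** The Neumann series of [Y] without its first four terms. *)
Lemma volterra_tail_le x : 0 <= x <= 1 ->
  normMC (Y x - 1%:M + B x - Y2 x + T3 x) <= 8 * (L + 1) * Gam * expR (2 * L).
Proof.
pose Z t := Y t - 1%:M + B t - Y2 t + T3 t.
have pZ : mprim Z (fun t => - K t *m Z t + K t *m T3 t).
  apply: eq_mprim (mprimD (mprimD (mprimD (mprimD pY (mprim_cst (- 1%:M))) pB)
    (mprimN pY2)) pT3) => t _; first reflexivity.
  rewrite /Z mulNmx !mulmxDr !mulmxN mulmx1.
  exact: volterra_alg3.
have bZ := mprim_mbmeas pZ.
rewrite -[in expR _]normNK; apply: (normMC_gronwall (G := fun x =>
  mint `[0, x] (fun t => K t *m T3 t)) mNK bZ).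
- exact: mulr_ge0 (mulr_ge0 (ler0n _ 8) (addr_ge0 L0 ler01)) Gam0.
- move=> y y01; apply: etrans (mprimE pZ y01) _.
  have mKT : minte (fun t => K t *m T3 t) := minte_mbmeasM mK bT3.
  have mKZ : minte (fun t => - K t *m Z t) := minte_mbmeasM mNK bZ.
  have Z0 : Z 0 = 0.
    by rewrite /Z Y0 subrr /B /Y2 /T3 !mint0 subr0 !addr0.
  rewrite Z0 add0r; apply: etrans (mintD mKZ mKT y01) _; exact: addrC.
- exact: volterra_fourth_le.
Qed.

Lemma volterra_first_le x : 0 <= x <= 1 ->
  normMC (Y x - 1%:M + B x) <= 2 * q * expR (2 * L).
Proof.
pose Z t := Y t - 1%:M + B t.
have pZ : mprim Z (fun t => - K t *m Z t + K t *m B t).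
  apply: eq_mprim (mprimD (mprimD pY (mprim_cst (- 1%:M))) pB) => t _; first reflexivity.
  rewrite /Z mulNmx !mulmxDr !mulmxN mulmx1.
  exact: volterra_alg1.
have bZ := mprim_mbmeas pZ.
rewrite -[in expR _]normNK; apply: (normMC_gronwall (G := Y2) mNK bZ).
- by rewrite mulr_ge0.
- move=> y y01; apply: etrans (mprimE pZ y01) _.
  have mKZ : minte (fun t => - K t *m Z t) := minte_mbmeasM mNK bZ.
  have Z0 : Z 0 = 0 by rewrite /Z Y0 subrr /B !mint0 addr0.
  rewrite Z0 add0r; apply: etrans (mintD mKZ mKB y01) _; exact: addrC.
- exact: volterra_second_le.
Qed.

Lemma volterra_le x : 0 <= x <= 1 -> normMC (Y x) <= 2 * expR (2 * L).
Proof.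
rewrite -[in expR _]normNK; apply: (normMC_gronwall (G := fun=> 1%:M) mNK bY) => //.
- move=> y y01; rewrite {1}(mprimE pY y01) Y0; congr (_ + _).
  by apply: eq_mint => t _; rewrite mulNmx.
- by move=> y _; rewrite normMC_1.
Qed.

Lemma volterra_sub1_le x : 0 <= x <= 1 ->
  normMC (Y x - 1%:M) <= normMC (B x) + 2 * q * expR (2 * L).
Proof.
move=> x01; have -> : Y x - 1%:M = (Y x - 1%:M + B x) - B x by rewrite addrK.
by rewrite (le_trans (normMC_B _ _))// addrC lerD// volterra_first_le.
Qed.

End Volterra.

(** * From the differential system to integral equations *)

Section DiracSystem.
Context {R : realType}.
Local Notation C := R[i].
Local Notation M2 := 'M[C]_2.
Local Notation leb := (@lebesgue_measure R).
Local Notation inte h := (leb.-integrable `[0, 1] (EFin \o h)).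
Local Notation rint h x := (\int[leb]_(t in `[0, x]) h t).
Implicit Types (x t d : R) (mu : C).

Lemma abs_continuous_ac (f : R -> C) : abs_continuous f ->
  ac (fun x => complex.Re (f x)) /\ ac (fun x => complex.Im (f x)).
Proof.
move=> acf; split=> e e0; have [del del0 hd] := acf e e0; exists del => // n a b ab tI sd;
  apply: le_lt_trans (hd n a b ab tI sd); apply: ler_sum => i _.
  by rewrite -ReCN -ReCD; exact: cabs_Re.
by rewrite -ImCN -ImCD; exact: cabs_Im.
Qed.

Lemma mx_ac_mbmeas (F : R -> M2) : mx_abs_continuous F -> mbmeas F.
Proof.
by move=> acF k j; have [h1 h2] := abs_continuous_ac (acF k j); split; exact: ac_bmeas.
Qed.

Lemma mx_ac_mprim (F H : R -> M2) : mx_abs_continuous F ->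
  {ae leb, forall x, x \in `[0, 1] -> mx_has_derivative F x (H x)} ->
  minte H -> mprim F H.
Proof.
move=> acF dF mH k j; have [h1 h2] := abs_continuous_ac (acF k j).
have [i1 i2] := mH k j; split; apply: ac_prim => //.
  move: dF; apply: (@filterS _ _ (ae_filter_ringOfSetsType leb)) => x /= dF x01.
  by have [|] := dF _ k j => //; move: x01; rewrite !in_itv/= => /andP[? ?]; rewrite !ltW.
move: dF; apply: (@filterS _ _ (ae_filter_ringOfSetsType leb)) => x /= dF x01.
by have [|] := dF _ k j => //; move: x01; rewrite !in_itv/= => /andP[? ?]; rewrite !ltW.
Qed.

Lemma cinte0 : cinte (fun _ : R => 0 : C).
Proof. exact: cprim_cinte (cprim_cst 0). Qed.

Lemma minte_mx2 (a b c d : R -> C) : cinte a -> cinte b -> cinte c -> cinte d ->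
  minte (fun x => mx2 (a x) (b x) (c x) (d x)).
Proof.
move=> ia ib ic id k j; case: (ord2P k) => ->; case: (ord2P j) => ->.
- by apply: eq_cinte ia => x _; rewrite mxE.
- by apply: eq_cinte ib => x _; rewrite mxE.
- by apply: eq_cinte ic => x _; rewrite mxE.
- by apply: eq_cinte id => x _; rewrite mxE.
Qed.

Lemma mprim_mx2 (a b c d a' b' c' d' : R -> C) : cprim a a' -> cprim b b' ->
  cprim c c' -> cprim d d' ->
  mprim (fun x => mx2 (a x) (b x) (c x) (d x)) (fun x => mx2 (a' x) (b' x) (c' x) (d' x)).
Proof.
move=> ia ib ic id k j; case: (ord2P k) => ->; case: (ord2P j) => ->.
- by apply: eq_cprim ia => x _; rewrite mxE.
- by apply: eq_cprim ib => x _; rewrite mxE.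
- by apply: eq_cprim ic => x _; rewrite mxE.
- by apply: eq_cprim id => x _; rewrite mxE.
Qed.

Lemma mint_mx2 (D : set R) (a b c d : R -> C) :
  mint D (fun x => mx2 (a x) (b x) (c x) (d x)) =
  mx2 (cint D a) (cint D b) (cint D c) (cint D d).
Proof.
apply/matrixP => k j; rewrite mxE.
case: (ord2P k) => ->; case: (ord2P j) => ->; rewrite mxE; apply: eq_cint => x _;
  by rewrite mxE.
Qed.

Lemma minte_J (s1 s2 : R -> C) : cinte s1 -> cinte s2 -> minte (Jmx s1 s2).
Proof. by move=> i1 i2; exact: minte_mx2 cinte0 i1 i2 cinte0. Qed.

Lemma in_ML_minte (P : R -> M2) : in_ML 1 P -> minte P.
Proof. by move=> iP k j; have [] := in_L1_cinte (iP k j). Qed.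

Lemma in_ML_norm (P : R -> M2) : in_ML 1 P -> rint (fun x => normMC (P x)) 1 = normML 1 P.
Proof.
move=> iP; have i k j := cinte_cabs (in_L1_cinte (iP k j)).1.
have e k j := (in_L1_cinte (iP k j)).2.
rewrite /normML !big_ord_recl !big_ord0 !addr0.
rewrite -!e -!rint_add//; try exact: inteD.
by apply: eq_Rintegral => x _; rewrite /normMC !big_ord_recl !big_ord0 !addr0.
Qed.

Lemma rint_sigma0_le (s1 s2 : R -> C) : in_Lp 2 s1 -> in_Lp 2 s2 ->
  rint (sigma0 s1 s2) 1 <= 2 + Lp_norm 2 s1 ^+ 2 + Lp_norm 2 s2 ^+ 2.
Proof.
move=> h1 h2; rewrite rint_add//; try exact: (cinte_cabs (in_L2_cinte _)).
have := in_L2_norm1 h1; have := in_L2_norm1 h2; lra.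
Qed.

Lemma inte_sigma0 (s1 s2 : R -> C) : in_Lp 2 s1 -> in_Lp 2 s2 -> inte (sigma0 s1 s2).
Proof.
by move=> h1 h2; apply: inteD; apply: cinte_cabs; exact: in_L2_cinte.
Qed.

Lemma expAD x t mu : expA (x + t) mu = expA x mu *m expA t mu.
Proof.
rewrite /expA mx2M !mulr0 !mul0r !addr0 !add0r -!cexpD rmorphD/= mulrDl opprD.
reflexivity.
Qed.

Lemma expA0 mu : expA 0 mu = 1%:M.
Proof. by rewrite /expA mul0r oppr0 cexp0 mx2_1. Qed.

Lemma expAK t mu : expA t mu *m expA (- t) mu = 1%:M.
Proof. by rewrite -expAD addrN expA0. Qed.

Lemma Re_itmu t mu : complex.Re (real_complex R t * ('i%C * mu)) = - (t * complex.Im mu).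
Proof. by rewrite ReCM [complex.Re ('i%C * mu)]ReCM/= !mul0r subr0 mul1r sub0r mulrN. Qed.

Lemma normMC_expA t mu d : strip d mu -> `|t| <= 1 -> 0 < d ->
  normMC (expA t mu) <= 2 * expR d.
Proof.
rewrite /strip/= => mud t1 d0.
rewrite normMC_mx2 cabs0 !addr0 !cabs_cexp ReCN Re_itmu opprK.
have H : `|t * complex.Im mu| <= d.
  by rewrite normrM (le_trans _ mud)// ler_piMl.
move: H; rewrite ler_norml => /andP[H1 H2].
have : expR (- (t * complex.Im mu)) <= expR d by rewrite ler_expR; lra.
have : expR (t * complex.Im mu) <= expR d by rewrite ler_expR.
lra.
Qed.

Lemma mprim_expA mu : mprim (fun x => expA x mu) (fun x => Amx mu *m expA x mu).
Proof.
have c2 := cprim_cexp (- ('i%C * mu)).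
apply: eq_mprim (mprim_mx2 (cprim_cexp ('i%C * mu)) (cprim_cst 0) (cprim_cst 0) c2) => x _.
  by rewrite mulrN.
rewrite /Amx /expA /J0 mx2Z mx2M !mulr0 !mul0r !addr0 !add0r mulr1.
by rewrite !mulrN mulr1.
Qed.

Lemma mprim_expAN mu : mprim (fun x => expA (- x) mu) (fun x => - (expA (- x) mu *m Amx mu)).
Proof.
have c2 := cprim_cexp (- ('i%C * mu)).
apply: eq_mprim (mprim_mx2 c2 (cprim_cst 0) (cprim_cst 0) (cprim_cexp ('i%C * mu))) => x _.
  by rewrite /expA rmorphN/= !mulNr !mulrN opprK.
rewrite /Amx /expA /J0 mx2Z mx2M !mulr0 !mul0r !addr0 !add0r mulr1 mx2N.
rewrite rmorphN/= !oppr0 !mulNr !mulrN mulr1 ?mulrN ?mulNr !opprK.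
by congr mx2; rewrite mulrC.
Qed.

End DiracSystem.

(** * The oscillatory kernel and the matrices D_0 and D^(0) *)

Lemma mx2_diagM (R : realType) (a b p q r s : R[i]) :
  mx2 a 0 0 b *m mx2 p q r s = mx2 (a * p) (a * q) (b * r) (b * s).
Proof. by rewrite mx2M !mul0r !addr0 !add0r. Qed.

Section Kernel.
Context {R : realType}.
Local Notation C := R[i].
Local Notation M2 := 'M[C]_2.
Local Notation leb := (@lebesgue_measure R).
Local Notation inte h := (leb.-integrable `[0, 1] (EFin \o h)).
Local Notation rint h x := (\int[leb]_(t in `[0, x]) h t).
Context (s1 s2 : R -> C) (mu : C) (d : R).
Context (h1 : in_Lp 2 s1) (h2 : in_Lp 2 s2) (mud : strip d mu) (d0 : 0 < d).

(** The exponent of the oscillation [exp (freq * t)] of the kernel. *)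
Definition freq : C := - (2 * 'i%C * mu).

(** The kernel [expA (- t) mu *m Jmx s1 s2 t *m expA t mu] of the Volterra
    equation, written out entrywise. *)
Definition Kmx (t : R) : M2 :=
  mx2 0 (cexp (real_complex R t * freq) * s1 t)
      (cexp (- (real_complex R t * freq)) * s2 t) 0.

Lemma expA_shift (x t : R) : expA (x - 2 * t) mu =
  mx2 (cexp (real_complex R x * ('i%C * mu)) * cexp (real_complex R t * freq)) 0 0
      (cexp (- (real_complex R x * ('i%C * mu))) * cexp (- (real_complex R t * freq))).
Proof.
have E : real_complex R (x - 2 * t) * ('i%C * mu) =
    real_complex R x * ('i%C * mu) + real_complex R t * freq.
  rewrite rmorphB rmorphM /= (_ : real_complex R 2 = 2) ?rmorph_nat//.
  by rewrite /freq; ring.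
by rewrite /expA E opprD !cexpD.
Qed.

Lemma expA_J (x t : R) : expA (x - 2 * t) mu *m Jmx s1 s2 t = expA x mu *m Kmx t.
Proof.
rewrite expA_shift /Jmx /Kmx /expA !mx2M !mulr0 !mul0r !addr0 !add0r.
by congr mx2; exact/esym/mulrA.
Qed.

Lemma expA_Kmx_expA (t : R) : expA t mu *m Kmx t *m expA t mu = Kmx t.
Proof.
have E w : cexp w * cexp (- w) = 1 :> C by rewrite -cexpD addrN cexp0.
rewrite /expA /Kmx; set w := real_complex R t * _.
rewrite !mx2M !mulr0 !mul0r !addr0 !add0r.
congr mx2; first by rewrite mul0r.
- by rewrite mulrAC E mul1r.
- by rewrite mulrAC [X in X * _]mulrC E mul1r.
- by rewrite mul0r.
Qed.

Lemma Kmx_expAN (t : R) : expA (- t) mu *m Jmx s1 s2 t = Kmx t *m expA (- t) mu.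
Proof.
have -> : - t = t - 2 * t by ring.
rewrite expA_J -[X in _ = X *m _]expA_Kmx_expA -mulmxA.
have -> : expA t mu *m expA (t - 2 * t) mu = 1%:M.
  rewrite -expAD; have -> : t + (t - 2 * t) = 0 by ring.
  exact: expA0.
by rewrite mulmx1.
Qed.

Lemma cinte_k1 : cinte (fun t => cexp (real_complex R t * freq) * s1 t).
Proof. by apply: cbmeas_cinteM (in_L2_cinte h1); exact: cbmeas_cexp. Qed.

Lemma cinte_k2 : cinte (fun t => cexp (- (real_complex R t * freq)) * s2 t).
Proof. by apply: cbmeas_cinteM (in_L2_cinte h2); exact: cbmeas_cexpN. Qed.

Lemma minte_Kmx : minte Kmx.
Proof. exact: minte_mx2 cinte0 cinte_k1 cinte_k2 cinte0. Qed.

Lemma cint_0D (x : R) : cint `[0, x] (fun _ : R => 0 : C) = 0.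
Proof.
have H : \int[leb]_(_ in `[0, x]) (0 : R) = 0 by rewrite Rintegral_cst ?mul0r.
by apply: complex_ext; exact: H.
Qed.

Lemma mint_Kmx (x : R) : mint `[0, x] Kmx =
  mx2 0 (osc_minus s1 mu x) (osc_plus s2 mu x) 0.
Proof.
apply: etrans (mint_mx2 _ _ _ _ _) _; rewrite cint_0D.
have E (t : R) : real_complex R t * freq = - (2 * 'i%C * mu * real_complex R t).
  by rewrite /freq; ring.
rewrite (eq_cint (k := fun t => cexp (- (2 * 'i%C * mu * real_complex R t)) * s1 t)); last first.
  by move=> t _; rewrite E.
rewrite [X in mx2 _ _ X _](eq_cint (k := fun t => cexp (2 * 'i%C * mu * real_complex R t) * s2 t)); last first.
  by move=> t _; rewrite E opprK.
reflexivity.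
Qed.

Lemma D_0E (x : R) : 0 <= x <= 1 -> D_0 s1 s2 x mu = - (expA x mu *m mint `[0, x] Kmx).
Proof.
move=> x01; apply: (congr1 (@GRing.opp _)).
apply: etrans _ (mintMl (expA x mu) minte_Kmx x01).
by apply: eq_mint => t _; exact: expA_J.
Qed.

Let b1 (t : R) := cint `[0, t] (fun r => cexp (real_complex R r * freq) * s1 r).
Let b2 (t : R) := cint `[0, t] (fun r => cexp (- (real_complex R r * freq)) * s2 r).

(** The correction by the matrix N consists of the second and the third
    iterate of the kernel, multiplied by the exponential. *)
Lemma D_sup0E (x : R) : 0 <= x <= 1 ->
  D_sup0 s1 s2 x mu = expA x mu *m
   (- mint `[0, x] Kmx + mint `[0, x] (fun t => Kmx t *m mint `[0, t] Kmx)
    - mint `[0, x] (fun t => Kmx t *m mint `[0, t] (fun r => Kmx r *m mint `[0, r] Kmx))).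
Proof.
move=> /andP[x0 x1]; rewrite /D_sup0 D_0E ?x0// -addrA mulmxDr mulmxN; congr (_ + _).
have BE t : mint `[0, t] Kmx = mx2 0 (b1 t) (b2 t) 0.
  by apply: etrans (mint_mx2 _ _ _ _ _) _; rewrite cint_0D.
have KB t : Kmx t *m mint `[0, t] Kmx =
    mx2 ((cexp (real_complex R t * freq) * s1 t) * b2 t) 0 0
        ((cexp (- (real_complex R t * freq)) * s2 t) * b1 t).
  by rewrite BE /Kmx mx2M !mulr0 !mul0r !addr0 !add0r.
pose I11 t := cint `[0, t] (fun r => (cexp (real_complex R r * freq) * s1 r) * b2 r).
pose I22 t := cint `[0, t] (fun r => (cexp (- (real_complex R r * freq)) * s2 r) * b1 r).
have Y2E t : mint `[0, t] (fun r => Kmx r *m mint `[0, r] Kmx) =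
    mx2 (I11 t) 0 0 (I22 t).
  rewrite (eq_mint (K := fun r => mx2 ((cexp (real_complex R r * freq) * s1 r) * b2 r) 0 0
        ((cexp (- (real_complex R r * freq)) * s2 r) * b1 r))); last by move=> r _; exact: KB.
  by apply: etrans (mint_mx2 _ _ _ _ _) _; rewrite cint_0D.
have I11E t : I11 t = cint `[0, t] (fun r => (cexp (real_complex R r * freq) * s1 r) * b2 r).
  reflexivity.
have I22E t : I22 t = cint `[0, t] (fun r => (cexp (- (real_complex R r * freq)) * s2 r) * b1 r).
  reflexivity.
clearbody I11 I22.
pose I12 t := cint `[0, t] (fun r => (cexp (real_complex R r * freq) * s1 r) * I22 r).
pose I21 t := cint `[0, t] (fun r => (cexp (- (real_complex R r * freq)) * s2 r) * I11 r).
have T3E t : mint `[0, t] (fun t => Kmx t *m mint `[0, t] (fun r => Kmx r *m mint `[0, r] Kmx)) =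
    mx2 0 (I12 t) (I21 t) 0.
  rewrite (eq_mint (K := fun r => mx2 0 ((cexp (real_complex R r * freq) * s1 r) * I22 r)
        ((cexp (- (real_complex R r * freq)) * s2 r) * I11 r) 0)); last first.
    move=> r _; rewrite (Y2E r) /Kmx mx2M !mulr0 !mul0r !addr0 !add0r.
    reflexivity.
  by apply: etrans (mint_mx2 _ _ _ _ _) _; rewrite cint_0D.
have I12E t : I12 t = cint `[0, t] (fun r => (cexp (real_complex R r * freq) * s1 r) * I22 r).
  reflexivity.
have I21E t : I21 t = cint `[0, t] (fun r => (cexp (- (real_complex R r * freq)) * s2 r) * I11 r).
  reflexivity.
clearbody I12 I21.
rewrite (Y2E x) (T3E x) mx2N mx2D oppr0 !addr0 !add0r.
set c := cexp (real_complex R x * ('i%C * mu)).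
set c' := cexp (- (real_complex R x * ('i%C * mu))).
have -> : expA x mu = mx2 c 0 0 c' by [].
rewrite mx2M !mul0r !addr0 !add0r.
have NE t : expA (x - 2 * t) mu *m Nmx s1 s2 x t = mx2
    (c * (cexp (real_complex R t * freq) * sigma_conv s1 s2 x t))
    (- c * (cexp (real_complex R t * freq) * Tconv s1 (sigma_conv s2 s1) x t))
    (- c' * (cexp (real_complex R t * - freq) * Tconv s2 (sigma_conv s1 s2) x t))
    (c' * (cexp (real_complex R t * - freq) * sigma_conv s2 s1 x t)).
  rewrite expA_shift /Nmx mx2_diagM -/c -/c'.
  congr mx2; by rewrite ?mulrN ?mulNr ?mulrA.
clearbody c c'.
rewrite (eq_mint (K := fun t => mx2
    (c * (cexp (real_complex R t * freq) * sigma_conv s1 s2 x t))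
    (- c * (cexp (real_complex R t * freq) * Tconv s1 (sigma_conv s2 s1) x t))
    (- c' * (cexp (real_complex R t * - freq) * Tconv s2 (sigma_conv s1 s2) x t))
    (c' * (cexp (real_complex R t * - freq) * sigma_conv s2 s1 x t)))); last first.
  by move=> t _; exact: NE.
apply: etrans (mint_mx2 _ _ _ _ _) _; congr mx2.
- by rewrite I11E; exact: cint_sigma_conv.
- rewrite I12E; apply: etrans (cint_Tconv _ _ h1 h2 x1) _; rewrite mulNr mulrN.
  apply: (congr1 (@GRing.opp _)); apply: (congr1 (GRing.mul _)).
  apply: eq_cint => r _; rewrite I22E; reflexivity.
- rewrite I21E; apply: etrans (cint_Tconv _ _ h2 h1 x1) _; rewrite mulNr mulrN.
  apply: (congr1 (@GRing.opp _)).
  apply: (congr1 (GRing.mul _)); apply: eq_cint => r _; rewrite mulrN.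
  rewrite I11E.
  apply: (congr1 (GRing.mul _)); apply: eq_cint => u _; rewrite mulrN opprK.
  apply: (congr1 (GRing.mul _)); apply: eq_cint => v _; rewrite mulrN.
  reflexivity.
- rewrite I22E; apply: etrans (cint_sigma_conv _ _ h2 h1 x1) _.
  apply: (congr1 (GRing.mul _)); apply: eq_cint => r _; rewrite mulrN.
  apply: (congr1 (GRing.mul _)); apply: eq_cint => u _; rewrite mulrN opprK.
  reflexivity.
Qed.

End Kernel.

(** * Bounds on the kernel *)

Section KernelBounds.
Context {R : realType}.
Local Notation C := R[i].
Local Notation M2 := 'M[C]_2.
Local Notation leb := (@lebesgue_measure R).
Local Notation inte h := (leb.-integrable `[0, 1] (EFin \o h)).
Local Notation rint h x := (\int[leb]_(t in `[0, x]) h t).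
Context (s1 s2 : R -> C) (mu : C) (d : R).
Context (h1 : in_Lp 2 s1) (h2 : in_Lp 2 s2) (mud : strip d mu) (d0 : 0 < d).
Local Notation K := (Kmx s1 s2 mu).
Local Notation B := (fun x => mint `[0, x] K).

Lemma Re_freq (t : R) : complex.Re (real_complex R t * freq mu) = t * (2 * complex.Im mu).
Proof.
have -> : real_complex R t * freq mu = - (real_complex R (2 * t) * ('i%C * mu)).
  by rewrite rmorphM /= (_ : real_complex R 2 = 2) ?rmorph_nat// /freq; ring.
by rewrite ReCN Re_itmu opprK; ring.
Qed.

Lemma normMC_Kmx (t : R) : 0 <= t <= 1 ->
  normMC (K t) <= expR (2 * d) * sigma0 s1 s2 t.
Proof.
move=> /andP[t0 t1]; rewrite /Kmx normMC_mx2 cabs0 addr0 add0r !cabsM !cabs_cexp ReCN Re_freq.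
rewrite /sigma0 mulrDr.
move: mud; rewrite /strip/= => mud'.
have H : `|t * (2 * complex.Im mu)| <= 2 * d.
  rewrite normrM ger0_norm// normrM ger0_norm//.
  rewrite (le_trans (ler_piMl _ t1))//.
  by rewrite ler_wpM2l.
move: H; rewrite ler_norml => /andP[H1 H2].
by apply: lerD; apply: ler_wpM2r; rewrite ?cabs_ge0// ler_expR; lra.
Qed.

Lemma gamma0E (x : R) : gamma0 s1 s2 x mu =
  cabs (osc_minus s1 mu x) + cabs (osc_plus s1 mu x) +
  (cabs (osc_minus s2 mu x) + cabs (osc_plus s2 mu x)).
Proof. by rewrite /gamma0 !big_cons big_nil addr0. Qed.

Lemma gamma0_ge0 (x : R) : 0 <= gamma0 s1 s2 x mu.
Proof. by rewrite gamma0E !addr_ge0 ?cabs_ge0. Qed.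

Lemma normMC_mint_Kmx (x : R) : normMC (mint `[0, x] K) <= gamma0 s1 s2 x mu.
Proof.
rewrite mint_Kmx normMC_mx2 cabs0 addr0 add0r gamma0E.
have a0 := cabs_ge0 (osc_plus s1 mu x); have b0 := cabs_ge0 (osc_minus s2 mu x).
by rewrite lerD// ?lerDl// lerDr.
Qed.

Lemma bmeas_osc (s : R -> C) : in_Lp 2 s ->
  bmeas (fun x => cabs (osc_minus s mu x)) /\ bmeas (fun x => cabs (osc_plus s mu x)).
Proof.
move=> hs; have cs := in_L2_cinte hs; split; apply: cbmeas_cabs.
  apply: cprim_cbmeas (cprim_cint _); apply: cbmeas_cinteM cs.
  have := cbmeas_cexp (- (2 * 'i%C * mu)); congr cbmeas; apply/funext => x.
  by rewrite mulrN mulrC.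
apply: cprim_cbmeas (cprim_cint _); apply: cbmeas_cinteM cs.
have := cbmeas_cexp (2 * 'i%C * mu); congr cbmeas; apply/funext => x.
by rewrite mulrC.
Qed.

Lemma bmeas_gamma0 : bmeas (fun x => gamma0 s1 s2 x mu).
Proof.
have [a b] := bmeas_osc h1; have [a' b'] := bmeas_osc h2.
have := bmeasD (bmeasD a b) (bmeasD a' b'); congr bmeas; apply/funext => x.
exact/esym/gamma0E.
Qed.

Let iK : inte (fun t => normMC (K t)).
Proof. exact: minte_normMC (minte_Kmx mu h1 h2). Qed.

Let bB : bmeas (fun t => normMC (B t)).
Proof. exact: mbmeas_normMC (mprim_mbmeas (mprim_mint (minte_Kmx mu h1 h2))). Qed.

Lemma rint_Kmx_le : rint (fun t => normMC (K t)) 1 <=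
  expR (2 * d) * (2 + Lp_norm 2 s1 ^+ 2 + Lp_norm 2 s2 ^+ 2).
Proof.
have i0 := inte_sigma0 h1 h2.
apply: (@le_trans _ _ (rint (fun t => expR (2 * d) * sigma0 s1 s2 t) 1)).
  by apply: le_rint => //; [exact: inte_scale|exact: normMC_Kmx].
rewrite rint_scale//; apply: ler_wpM2l; first exact: expR_ge0.
exact: rint_sigma0_le.
Qed.

Lemma rint_Kmx_sqr_le : rint (fun t => normMC (K t) * normMC (B t) ^+ 2) 1 <=
  expR (2 * d) * gamma1 s1 s2 mu.
Proof.
have i0 := inte_sigma0 h1 h2; have bg := bmeas_gamma0.
have ig : inte (fun t => sigma0 s1 s2 t * gamma0 s1 s2 t mu ^+ 2).
  by apply: eq_inte (bmeas_inteM (bmeasM bg bg) i0) => t _; rewrite mulrC expr2.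
have iB : inte (fun t => normMC (K t) * normMC (B t) ^+ 2).
  by apply: eq_inte (bmeas_inteM (bmeasM bB bB) iK) => t _; rewrite mulrC expr2.
apply: (@le_trans _ _ (rint (fun t => expR (2 * d) * (sigma0 s1 s2 t * gamma0 s1 s2 t mu ^+ 2)) 1)).
  apply: le_rint => //; first exact: inte_scale.
  move=> t t01; rewrite mulrA; apply: ler_pM.
  - exact: normMC_ge0.
  - by rewrite exprn_ge0// normMC_ge0.
  - exact: normMC_Kmx.
  - by rewrite lerXn2r ?nnegrE ?normMC_ge0 ?gamma0_ge0// normMC_mint_Kmx.
by rewrite rint_scale.
Qed.

Lemma gamma1_ge0 : 0 <= gamma1 s1 s2 mu.
Proof.
apply: Rintegral_ge0 => t _; rewrite mulr_ge0 ?exprn_ge0 ?gamma0_ge0//.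
by rewrite addr_ge0 ?cabs_ge0.
Qed.

End KernelBounds.

(** * The conjugated solutions *)

Lemma invmx_eq (F : fieldType) (n : nat) (A B : 'M[F]_n) : A *m B = 1%:M -> invmx A = B.
Proof.
by move=> AB; have [uA _] := mulmx1_unit AB; rewrite -[RHS]mul1mx -(mulVmx uA) -mulmxA AB mulmx1.
Qed.

Lemma scale_mulmx_assoc (F : fieldType) (n : nat) (c : F) (A P D W : 'M[F]_n) :
  (c *: (A *m P *m D)) *m W = A *m (c *: P) *m (D *m W).
Proof. by rewrite -scalemxAl -scalemxAr -scalemxAl !mulmxA. Qed.

(** The derivative of [X E D] when [X' = X K], [E' = - E A] and
    [D' = A D + P D - J D]. *)
Lemma variation_of_constants (F : fieldType) (n : nat) (X K E A J P D : 'M[F]_n) :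
  E *m J = K *m E ->
  (X *m K *m E + X *m (- (E *m A))) *m D + X *m E *m (A *m D + P *m D - J *m D) =
  X *m E *m P *m D.
Proof.
move=> EJ; rewrite -(mulmxA X K) -EJ mulmxDl mulmxN mulNmx !mulmxDr mulmxN !mulmxA.
move: (X *m E *m J *m D) (X *m E *m A *m D) (X *m E *m P *m D) => a b c.
by rewrite !addrA addrNK [a + c]addrC addrK.
Qed.

Section Solutions.
Context {R : realType}.
Local Notation C := R[i].
Local Notation M2 := 'M[C]_2.
Local Notation leb := (@lebesgue_measure R).
Local Notation inte h := (leb.-integrable `[0, 1] (EFin \o h)).
Local Notation rint h x := (\int[leb]_(t in `[0, x]) h t).
Context (s1 s2 : R -> C) (P : R -> M2) (mu : C) (D Dt : R -> M2).
Context (h1 : in_Lp 2 s1) (h2 : in_Lp 2 s2) (hP : in_ML 1 P).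
Context (hD : unperturbed_sol s1 s2 mu D) (hDt : perturbed_sol s1 s2 P mu Dt).
Local Notation K := (Kmx s1 s2 mu).
Local Notation J := (Jmx s1 s2).

Lemma minte_cst (A : M2) : minte (fun _ : R => A).
Proof. by move=> k j; split; exact: inte_cst. Qed.

Let mJ : minte J.
Proof. by apply: minte_J; exact: in_L2_cinte. Qed.

Let mP : minte P. Proof. exact: in_ML_minte. Qed.

Lemma mprim_unperturbed : mprim D (fun x => Amx mu *m D x - J x *m D x).
Proof.
have [acD aeD _] := hD; have bD := mx_ac_mbmeas acD.
apply: mx_ac_mprim => //.
  move: aeD; apply: (@filterS _ _ (ae_filter_ringOfSetsType leb)) => x /= H x01.
  by have [V dV <-] := H x01; rewrite addrK.
apply: minteD; first exact: minte_mbmeasM (minte_cst _) bD.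
by apply: minteN; exact: minte_mbmeasM.
Qed.

Lemma mprim_perturbed :
  mprim Dt (fun x => Amx mu *m Dt x + (mu^-1 *: P x) *m Dt x - J x *m Dt x).
Proof.
have [acD aeD _] := hDt; have bD := mx_ac_mbmeas acD.
apply: mx_ac_mprim => //.
  move: aeD; apply: (@filterS _ _ (ae_filter_ringOfSetsType leb)) => x /= H x01.
  by have [V dV <-] := H x01; rewrite addrK.
apply: minteD; last by apply: minteN; exact: minte_mbmeasM.
apply: minteD; first exact: minte_mbmeasM (minte_cst _) bD.
apply: minte_mbmeasM bD.
move=> k j; apply: eq_cinte (cbmeas_cinteM (cprim_cbmeas (cprim_cst mu^-1)) (mP k j)) => x _.
by rewrite mxE.
Qed.

(** The solution conjugated by the exponential. *)
Definition Ymx (x : R) : M2 := expA (- x) mu *m D x.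
(** The adjugate of [Ymx], which is its inverse. *)
Definition Xmx (x : R) : M2 := adj2 (Ymx x).

Lemma mprim_Ymx : mprim Ymx (fun x => - (K x *m Ymx x)).
Proof.
apply: eq_mprim (mprimM (mprim_expAN mu) mprim_unperturbed) => x _; first reflexivity.
rewrite /Ymx mulmxA -Kmx_expAN mulmxBr mulNmx !mulmxA.
by rewrite addrA addNr add0r.
Qed.

Lemma Ymx0 : Ymx 0 = 1%:M.
Proof. by have [_ _ D0] := hD; rewrite /Ymx D0 oppr0 expA0 mulmx1. Qed.

Lemma adj2_Kmx x : adj2 (K x) = - K x.
Proof. by rewrite /Kmx adj2_mx2 mx2N !oppr0. Qed.

Lemma mprim_Xmx : mprim Xmx (fun x => Xmx x *m K x).
Proof.
apply: eq_mprim (mprim_adj2 mprim_Ymx) => x _; first reflexivity.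
by rewrite adj2N adj2M adj2_Kmx mulmxN opprK.
Qed.

(** Liouville: the kernel is traceless, so the determinant of [Ymx] is
    constant. *)
Lemma Xmx_Ymx x : 0 <= x <= 1 -> Xmx x *m Ymx x = 1%:M.
Proof.
move=> x01; have pXY : mprim (fun x => Xmx x *m Ymx x) (fun=> 0).
  apply: eq_mprim (mprimM mprim_Xmx mprim_Ymx) => t _; first reflexivity.
  by rewrite mulmxN -(mulmxA (Xmx t)) subrr.
have p0 : mprim (fun _ : R => 1%:M : M2) (fun=> 0) by exact: mprim_cst.
have E1 := mprimE pXY x01; have E2 := mprimE p0 x01.
have X0 : Xmx 0 *m Ymx 0 = 1%:M by rewrite /Xmx Ymx0 adj2_1 mulmx1.
by apply: etrans E1 _; rewrite X0; exact: esym E2.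
Qed.

Lemma Ymx_Xmx x : 0 <= x <= 1 -> Ymx x *m Xmx x = 1%:M.
Proof. by move=> x01; apply: mulmx1C; exact: Xmx_Ymx. Qed.

Lemma D_Ymx x : D x = expA x mu *m Ymx x.
Proof. by rewrite /Ymx mulmxA expAK mul1mx. Qed.

Lemma D_Xmx x : 0 <= x <= 1 -> D x *m (Xmx x *m expA (- x) mu) = 1%:M.
Proof.
by move=> x01; rewrite D_Ymx mulmxA -(mulmxA (expA x mu)) Ymx_Xmx// mulmx1 expAK.
Qed.

Lemma invmx_D x : 0 <= x <= 1 -> invmx (D x) = Xmx x *m expA (- x) mu.
Proof. by move=> x01; exact: invmx_eq (D_Xmx x01). Qed.

Lemma conjPDE x : 0 <= x <= 1 ->
  conjPD P D x = Xmx x *m conjP P x mu *m Ymx x.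
Proof.
move=> x01; rewrite /conjPD invmx_D// {1}D_Ymx /conjP !mulmxA.
reflexivity.
Qed.

Lemma minte_conjP : minte (fun t => conjP P t mu).
Proof.
apply: minte_mbmeasM; last exact: mprim_mbmeas (mprim_expA mu).
apply: mbmeas_minteM mP; exact: mprim_mbmeas (mprim_expAN mu).
Qed.

Lemma minte_conjPD : minte (conjPD P D).
Proof.
apply: (@eq_minte _ (fun x => Xmx x *m conjP P x mu *m Ymx x)).
  by move=> x x01; exact/esym/conjPDE.
apply: minte_mbmeasM; last exact: mprim_mbmeas mprim_Ymx.
by apply: mbmeas_minteM minte_conjP; exact: mprim_mbmeas mprim_Xmx.
Qed.

(** The perturbed solution relative to the unperturbed one, [D^-1 Dt]. *)
Definition Wmx (x : R) : M2 := Xmx x *m expA (- x) mu *m Dt x.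

Lemma D_Wmx x : 0 <= x <= 1 -> Dt x = D x *m Wmx x.
Proof. by move=> x01; rewrite /Wmx mulmxA (D_Xmx x01) mul1mx. Qed.

Lemma conjPD_Wmx x : 0 <= x <= 1 ->
  (mu^-1 *: conjPD P D x) *m Wmx x = Xmx x *m expA (- x) mu *m (mu^-1 *: P x) *m Dt x.
Proof.
move=> x01; rewrite [in RHS](D_Wmx x01) /conjPD (invmx_D x01).
exact: scale_mulmx_assoc.
Qed.

Lemma mprim_Wmx : mprim Wmx (fun x => (mu^-1 *: conjPD P D x) *m Wmx x).
Proof.
apply: eq_mprim (mprimM (mprimM mprim_Xmx (mprim_expAN mu)) mprim_perturbed) => x x01.
  reflexivity.
rewrite (conjPD_Wmx x01); exact: variation_of_constants (Kmx_expAN _ _ _ _).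
Qed.

Lemma Wmx0 : Wmx 0 = 1%:M.
Proof.
have [_ _ Dt0] := hDt.
by rewrite /Wmx Dt0 /Xmx Ymx0 adj2_1 oppr0 expA0 !mulmx1.
Qed.

End Solutions.

(** * Estimates of the remainder *)

Lemma mul_sub_assoc (F : fieldType) (n : nat) (E Y B Y2 T : 'M[F]_n) :
  E *m Y - E - E *m (- B + Y2 - T) = E *m (Y - 1%:M + B - Y2 + T).
Proof. by rewrite !mulmxDr !mulmxN mulmx1 !opprD !opprK !addrA. Qed.

Lemma mul_sub_assoc1 (F : fieldType) (n : nat) (E Y B : 'M[F]_n) :
  E *m Y - E - - (E *m B) = E *m (Y - 1%:M + B).
Proof. by rewrite !mulmxDr !mulmxN mulmx1 opprK. Qed.

Lemma conj_sub (F : fieldType) (n : nat) (X C Y : 'M[F]_n) :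
  X *m C *m Y - C = (X - 1%:M) *m C *m Y + C *m (Y - 1%:M).
Proof. by rewrite mulmxBl mul1mx mulmxBl mulmxBr mulmx1 addrA addrNK. Qed.

Lemma first_order_sub (F : fieldType) (n : nat) (c : F) (D I Q : 'M[F]_n) :
  D *m (1%:M + (I + c *: Q)) - D - c *: (D *m Q) = D *m I.
Proof.
by rewrite !mulmxDr mulmx1 -scalemxAr [D + _]addrC addrK addrK.
Qed.

(** The algebra of the decomposition; [Cc] and [Q] are the integrals of
    [E^-1 P E] and [D^-1 P D]. *)
Lemma decomposition_alg (F : fieldType) (n : nat) (c : F) (E D D0 S V Cc Q : 'M[F]_n) :
  V = E + S + c *: (E *m Cc) + c *: (D0 *m Cc) +
    (D - E - S + c *: ((D - E - D0) *m Cc + D *m (Q - Cc)) + (V - D - c *: (D *m Q))).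
Proof.
rewrite !mulmxBl mulmxBr !scalerDr !scalerN.
move: (c *: (E *m Cc)) (c *: (D0 *m Cc)) (c *: (D *m Cc)) (c *: (D *m Q)) => a b v f.
have -> : v - a - b + (f - v) = f - (a + b).
  rewrite -(addrA v) -opprD; move: (a + b) => w.
  by rewrite [LHS]addrC [LHS]addrA addrNK.
rewrite -(addrA D) -opprD -(addrA (E + S)) -(addrA V) -opprD.
move: (E + S) (a + b) => u w.
rewrite [D - u + _]addrACA -opprD; move: (D + f) (u + w) => z y.
by rewrite addrA [y + (z - y)]addrC addrNK [z + _]addrC addrNK.
Qed.

Lemma remainder_arith (R : realType) (g s k n C1 C2 Ck Cq Cd : R) :
  0 <= g -> 0 <= s -> 0 <= k -> 0 <= n -> 0 <= C1 -> 0 <= C2 -> 0 <= Ck ->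
  0 <= Cq -> 0 <= Cd ->
  C1 * g + (C2 * g + Cq * n) + Ck * k + Cd * n <=
  (C1 + (C2 + Cq) + Ck + Cd) * (s + g + k + n).
Proof.
move=> g0 s0 k0 n0 C10 C20 Ck0 Cq0 Cd0.
have -> : (C1 + (C2 + Cq) + Ck + Cd) * (s + g + k + n) =
  C1 * g + (C2 * g + Cq * n) + Ck * k + Cd * n +
  ((C1 + (C2 + Cq) + Ck + Cd) * s + C1 * (k + n) + C2 * (k + n) + Cq * (g + k) +
   Ck * (g + n) + Cd * (g + k)) by ring.
by rewrite lerDl !addr_ge0// mulr_ge0 ?addr_ge0.
Qed.

Section Estimates.
Context {R : realType}.
Local Notation C := R[i].
Local Notation M2 := 'M[C]_2.
Local Notation leb := (@lebesgue_measure R).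
Local Notation inte h := (leb.-integrable `[0, 1] (EFin \o h)).
Local Notation rint h x := (\int[leb]_(t in `[0, x]) h t).

Lemma mintZ (c : C) (H : R -> M2) (x : R) : minte H -> 0 <= x <= 1 ->
  mint `[0, x] (fun t => c *: H t) = c *: mint `[0, x] H.
Proof.
move=> mH x01; rewrite -mul_scalar_mx; apply: etrans _ (mintMl c%:M mH x01).
by apply: eq_mint => t _; rewrite mul_scalar_mx.
Qed.

Lemma minteZ (c : C) (H : R -> M2) : minte H -> minte (fun t => c *: H t).
Proof.
move=> mH k j; apply: eq_cinte (cbmeas_cinteM (cprim_cbmeas (cprim_cst c)) (mH k j)) => x _.
by rewrite mxE.
Qed.

Lemma mintB (H K : R -> M2) (x : R) : minte H -> minte K -> 0 <= x <= 1 ->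
  mint `[0, x] (fun t => H t - K t) = mint `[0, x] H - mint `[0, x] K.
Proof.
move=> mH mK x01; apply: etrans (mintD mH (minteN mK) x01) _.
by rewrite (mintN mK x01).
Qed.

Lemma normMC_mul_le (A B : M2) (a b : R) : normMC A <= a -> normMC B <= b ->
  normMC (A *m B) <= a * b.
Proof.
move=> Aa Bb; apply: le_trans (normMC_M A B) _.
by apply: ler_pM => //; exact: normMC_ge0.
Qed.

Context (s1 s2 : R -> C) (P : R -> M2) (mu : C) (d : R) (D Dt : R -> M2).
Context (h1 : in_Lp 2 s1) (h2 : in_Lp 2 s2) (hP : in_ML 1 P) (d0 : 0 < d).
Context (mud : strip d mu).
Context (hD : unperturbed_sol s1 s2 mu D) (hDt : perturbed_sol s1 s2 P mu Dt).
Local Notation K := (Kmx s1 s2 mu).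
Local Notation Y := (Ymx mu D).
Local Notation X := (Xmx mu D).

Let e := expR d.
Let Lam := expR (2 * d) * (2 + Lp_norm 2 s1 ^+ 2 + Lp_norm 2 s2 ^+ 2).
Let G := expR (2 * Lam).
Let p := normML 1 P.
Let q := rint (fun t => normMC (K t) * normMC (mint `[0, t] K)) 1.
Let g1 := e ^+ 2 * gamma1 s1 s2 mu.

Let e2E : expR (2 * d) = e ^+ 2.
Proof. by rewrite mulr_natl mulr2n expRD expr2. Qed.
Let e0 : 0 <= e. Proof. exact: expR_ge0. Qed.
Let G0 : 0 <= G. Proof. exact: expR_ge0. Qed.
Let mK : minte K. Proof. exact: minte_Kmx. Qed.
Let mP : minte P. Proof. exact: in_ML_minte. Qed.
Let iP : inte (fun t => normMC (P t)). Proof. exact: minte_normMC. Qed.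
Let pY := mprim_Ymx h1 h2 hD.
Let Y0 := Ymx0 hD.
Let L_le : rint (fun t => normMC (K t)) 1 <= Lam.
Proof. exact: rint_Kmx_le. Qed.
Let Lam0 : 0 <= Lam.
Proof. by rewrite mulr_ge0 ?expR_ge0// !addr_ge0 ?sqr_ge0. Qed.
Let p0 : 0 <= p.
Proof. by rewrite /p -in_ML_norm// rint_ge0// => t _; exact: normMC_ge0. Qed.
Let q0 : 0 <= q.
Proof. by apply: rint_ge0 => // t _; rewrite mulr_ge0 ?normMC_ge0. Qed.
Let g10 : 0 <= g1.
Proof. by rewrite mulr_ge0 ?sqr_ge0 ?gamma1_ge0. Qed.
Let expL : expR (2 * rint (fun t => normMC (K t)) 1) <= G.
Proof. by rewrite ler_expR ler_wpM2l. Qed.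

Let Gam_le : rint (fun t => normMC (K t) * normMC (mint `[0, t] K) ^+ 2) 1 <= g1.
Proof. by rewrite /g1 -e2E; exact: rint_Kmx_sqr_le. Qed.

Let Gam0 : 0 <= rint (fun t => normMC (K t) * normMC (mint `[0, t] K) ^+ 2) 1.
Proof. by apply: rint_ge0 => // t _; rewrite mulr_ge0 ?exprn_ge0 ?normMC_ge0. Qed.

Let L0 : 0 <= rint (fun t => normMC (K t)) 1.
Proof. by apply: rint_ge0 => // t _; exact: normMC_ge0. Qed.

Let q_sqr_le : q ^+ 2 <= (Lam + 1) * g1.
Proof.
apply: le_trans (volterra_sqr_le mK) _.
by apply: ler_pM; rewrite ?lerD2r// addr_ge0.
Qed.

Let E_le (t : R) : `|t| <= 1 -> normMC (expA t mu) <= 2 * e.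
Proof. by move=> t1; exact: normMC_expA. Qed.

Let norm01 (t : R) : 0 <= t <= 1 -> `|t| <= 1.
Proof. by move=> /andP[t0 t1]; rewrite ger0_norm. Qed.

Let Y_le x : 0 <= x <= 1 -> normMC (Y x) <= 2 * G.
Proof.
move=> x01; apply: le_trans (volterra_le mK pY Y0 x01) _.
by rewrite ler_wpM2l.
Qed.

Let X_le x : 0 <= x <= 1 -> normMC (X x) <= 2 * G.
Proof. by move=> x01; rewrite /Xmx normMC_adj2; exact: Y_le. Qed.

Let D_le x : 0 <= x <= 1 -> normMC (D x) <= 4 * e * G.
Proof.
move=> x01; rewrite (D_Ymx mu D x).
have -> : 4 * e * G = (2 * e) * (2 * G) by ring.
by apply: normMC_mul_le; [apply: E_le; exact: norm01|exact: Y_le].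
Qed.

Let Y1_le x : 0 <= x <= 1 -> normMC (Y x - 1%:M) <= gamma0 s1 s2 x mu + 2 * q * G.
Proof.
move=> x01; apply: le_trans (volterra_sub1_le mK pY Y0 x01) _; apply: lerD.
  exact: normMC_mint_Kmx.
by apply: ler_wpM2l => //; exact: mulr_ge0.
Qed.

Let X1_le x : 0 <= x <= 1 -> normMC (X x - 1%:M) <= gamma0 s1 s2 x mu + 2 * q * G.
Proof.
move=> x01; have -> : X x - 1%:M = adj2 (Y x - 1%:M).
  by rewrite adj2D adj2N adj2_1.
by rewrite normMC_adj2; exact: Y1_le.
Qed.

Let C_le t : 0 <= t <= 1 -> normMC (conjP P t mu) <= 4 * e ^+ 2 * normMC (P t).
Proof.
move=> t01; rewrite /conjP.
have -> : 4 * e ^+ 2 * normMC (P t) = (2 * e) * normMC (P t) * (2 * e) by ring.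
apply: normMC_mul_le; last by apply: E_le; exact: norm01.
by apply: normMC_mul_le => //; apply: E_le; rewrite normrN; exact: norm01.
Qed.

Lemma D_sup1_le x : 0 <= x <= 1 ->
  normMC (D_sup1 s1 s2 D x mu) <= 16 * e * G * (Lam + 1) * g1.
Proof.
move=> x01.
have -> : D_sup1 s1 s2 D x mu = expA x mu *m (Y x - 1%:M + mint `[0, x] K
   - mint `[0, x] (fun t => K t *m mint `[0, t] K)
   + mint `[0, x] (fun t => K t *m mint `[0, t] (fun r => K r *m mint `[0, r] K))).
  rewrite /D_sup1 (D_sup0E mu h1 h2 x01) {1}(D_Ymx mu D x).
  exact: mul_sub_assoc.
have -> : 16 * e * G * (Lam + 1) * g1 = (2 * e) * (8 * (Lam + 1) * g1 * G) by ring.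
apply: normMC_mul_le; first by apply: E_le; exact: norm01.
apply: le_trans (volterra_tail_le mK pY Y0 x01) _.
apply: ler_pM; [|exact: expR_ge0| |exact: expL].
  by rewrite !mulr_ge0 ?addr_ge0.
apply: ler_pM; [|exact: Gam0| |exact: Gam_le].
  by rewrite mulr_ge0 ?addr_ge0.
by rewrite ler_wpM2l// lerD2r.
Qed.

Lemma R_0_le x : 0 <= x <= 1 -> normMC (R_0 s1 s2 D x mu) <= 4 * e * G * q.
Proof.
move=> x01.
have -> : R_0 s1 s2 D x mu = expA x mu *m (Y x - 1%:M + mint `[0, x] K).
  rewrite /R_0 (D_0E mu h1 h2 x01) {1}(D_Ymx mu D x).
  exact: mul_sub_assoc1.
have -> : 4 * e * G * q = (2 * e) * (2 * q * G) by ring.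
apply: normMC_mul_le; first by apply: E_le; exact: norm01.
apply: le_trans (volterra_first_le mK pY Y0 x01) _.
by apply: ler_wpM2l => //; exact: mulr_ge0.
Qed.

Let mC := minte_conjP mu hP.
Let mQ := minte_conjPD h1 h2 hP hD.
Let igP : inte (fun t => normMC (P t) * gamma0 s1 s2 t mu).
Proof.
by apply: eq_inte (bmeas_inteM (bmeas_gamma0 mu h1 h2) iP) => t _; rewrite mulrC.
Qed.

Lemma mint_conjP_le x : 0 <= x <= 1 ->
  normMC (mint `[0, x] (fun t => conjP P t mu)) <= 8 * e ^+ 2 * p.
Proof.
move=> x01; have -> : 8 * e ^+ 2 * p = 2 * rint (fun t => 4 * e ^+ 2 * normMC (P t)) 1.
  by rewrite rint_scale// in_ML_norm// -/p; ring.
exact: normMC_mint_le mC (inte_scale _ iP) C_le x01.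
Qed.

(** [Y^-1 C Y - C = (Y^-1 - I) C Y + C (Y - I)] with [C = E^-1 P E]. *)
Lemma mint_R_1_le x : 0 <= x <= 1 ->
  normMC (mint `[0, x] (fun t => R_1 P D t mu)) <=
  8 * e ^+ 2 * (2 * G + 1) * (kP s1 s2 P mu + 2 * q * G * p).
Proof.
move=> x01; pose c := 4 * e ^+ 2 * (2 * G + 1).
have c0 : 0 <= c by rewrite mulr_ge0 ?addr_ge0 ?mulr_ge0 ?sqr_ge0.
have i2 := inte_scale (2 * q * G) iP.
have i3 := inteD igP i2.
have -> : 8 * e ^+ 2 * (2 * G + 1) * (kP s1 s2 P mu + 2 * q * G * p) =
    2 * rint (fun t => c * (normMC (P t) * gamma0 s1 s2 t mu + 2 * q * G * normMC (P t))) 1.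
  by rewrite (rint_scale _ i3)// (rint_add igP i2)// (rint_scale _ iP)// in_ML_norm// -/p /c /kP; ring.
apply: normMC_mint_le (minteD mQ (minteN mC)) (inte_scale c i3) _ x01.
move=> t t01; rewrite /R_1 (conjPDE P h1 h2 hD t01).
have -> : X t *m conjP P t mu *m Y t - conjP P t mu =
    (X t - 1%:M) *m conjP P t mu *m Y t + conjP P t mu *m (Y t - 1%:M).
  exact: conj_sub.
have g0 := gamma0_ge0 s1 s2 mu t.
have n0 := normMC_ge0 (P t).
pose w := gamma0 s1 s2 t mu + 2 * q * G.
apply: le_trans (normMC_D _ _) _.
have -> : c * (normMC (P t) * gamma0 s1 s2 t mu + 2 * q * G * normMC (P t)) =
    w * (4 * e ^+ 2 * normMC (P t)) * (2 * G) + (4 * e ^+ 2 * normMC (P t)) * w.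
  by rewrite /c /w; ring.
apply: lerD; last by apply: normMC_mul_le; [exact: C_le|exact: Y1_le].
apply: normMC_mul_le; last exact: Y_le.
by apply: normMC_mul_le; [exact: X1_le|exact: C_le].
Qed.

Lemma R_2_le x : 0 <= x <= 1 -> normMC (R_2 s1 s2 P D x mu) <=
  32 * e ^+ 3 * G * p * q +
  32 * e ^+ 3 * G * (2 * G + 1) * (kP s1 s2 P mu + 2 * q * G * p).
Proof.
move=> x01; rewrite /R_2; apply: le_trans (normMC_D _ _) _; apply: lerD.
  have -> : 32 * e ^+ 3 * G * p * q = (4 * e * G * q) * (8 * e ^+ 2 * p) by ring.
  by apply: normMC_mul_le; [exact: R_0_le|exact: mint_conjP_le].
set k := kP _ _ _ _ + _.
have -> : 32 * e ^+ 3 * G * (2 * G + 1) * k =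
  (4 * e * G) * (8 * e ^+ 2 * (2 * G + 1) * k) by ring.
by apply: normMC_mul_le; [exact: D_le|exact: mint_R_1_le].
Qed.

Let nu := (cabs mu)^-1.
Context (hmu : nu * p <= 2^-1).
Let W := Wmx mu D Dt.
Let pW : mprim W (fun x => (mu^-1 *: conjPD P D x) *m W x).
Proof. exact: (mprim_Wmx h1 h2 hP hD hDt). Qed.
Let a := 16 * e ^+ 2 * G ^+ 2.
Let a0 : 0 <= a. Proof. by rewrite !mulr_ge0 ?sqr_ge0. Qed.
Let nu0 : 0 <= nu. Proof. by rewrite invr_ge0 cabs_ge0. Qed.
Let mnQ : minte (fun t => mu^-1 *: conjPD P D t). Proof. exact: minteZ. Qed.

Let nQ_le t : 0 <= t <= 1 -> normMC (mu^-1 *: conjPD P D t) <= nu * a * normMC (P t).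
Proof.
move=> t01; rewrite normMC_Z cabsV -/nu -mulrA; apply: ler_wpM2l => //.
rewrite (conjPDE P h1 h2 hD t01).
have -> : a * normMC (P t) = (2 * G) * (4 * e ^+ 2 * normMC (P t)) * (2 * G).
  by rewrite /a; ring.
apply: normMC_mul_le; last exact: Y_le.
by apply: normMC_mul_le; [exact: X_le|exact: C_le].
Qed.

Let W_le x : 0 <= x <= 1 -> normMC (W x) <= 2 * expR a.
Proof.
move=> x01.
apply: (@le_trans _ _ (2 * expR (2 * rint (fun t => normMC (mu^-1 *: conjPD P D t)) 1))).
  apply: (normMC_gronwall (G := fun=> 1%:M) mnQ (mprim_mbmeas pW)) x01 => //.
    by move=> y y01; apply: etrans (mprimE pW y01) _; rewrite /W (Wmx0 hD hDt).
  by move=> y _; rewrite normMC_1.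
rewrite ler_wpM2l// ler_expR.
apply: (@le_trans _ _ (2 * rint (fun t => nu * a * normMC (P t)) 1)).
  rewrite ler_wpM2l//; apply: le_rint => //; [exact: minte_normMC|exact: inte_scale].
rewrite rint_scale// in_ML_norm// -/p.
have -> : 2 * (nu * a * p) = (2 * a) * (nu * p) by ring.
apply: le_trans (ler_wpM2l _ hmu) _; first by rewrite mulr_ge0.
by rewrite mulrAC divff ?mul1r.
Qed.

Let W1_le x : 0 <= x <= 1 -> normMC (W x - 1%:M) <= 4 * (nu * a * p) * expR a.
Proof.
move=> x01; have -> : W x - 1%:M = mint `[0, x] (fun t => (mu^-1 *: conjPD P D t) *m W t).
  by rewrite (mprimE pW x01) /W (Wmx0 hD hDt) addrC addKr.
have -> : 4 * (nu * a * p) * expR a =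
    2 * rint (fun t => 2 * expR a * (nu * a) * normMC (P t)) 1.
  by rewrite rint_scale// in_ML_norm// -/p; ring.
apply: normMC_mint_le (mprim_minte pW) (inte_scale _ iP) _ x01.
move=> t t01.
have -> : 2 * expR a * (nu * a) * normMC (P t) = (nu * a * normMC (P t)) * (2 * expR a).
  by ring.
by apply: normMC_mul_le; [exact: nQ_le|exact: W_le].
Qed.

Lemma Dt_1_le x : 0 <= x <= 1 ->
  normMC (Dt_1 P D Dt x mu) <= 32 * e * G * (a * p) ^+ 2 * expR a * nu ^+ 2.
Proof.
move=> x01.
have mW1 : mbmeas (fun t => W t - 1%:M).
  exact: mprim_mbmeas (mprimD pW (mprim_cst (- 1%:M))).
have mQW : minte (fun t => (mu^-1 *: conjPD P D t) *m (W t - 1%:M)).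
  exact: minte_mbmeasM.
have -> : Dt_1 P D Dt x mu =
    D x *m mint `[0, x] (fun t => (mu^-1 *: conjPD P D t) *m (W t - 1%:M)).
  have E := mprimE pW x01; rewrite /W (Wmx0 hD hDt) -/W in E.
  have E2 : mint `[0, x] (fun t => (mu^-1 *: conjPD P D t) *m W t) =
      mint `[0, x] (fun t => (mu^-1 *: conjPD P D t) *m (W t - 1%:M)) +
      mu^-1 *: mint `[0, x] (conjPD P D).
    rewrite -(mintZ _ mQ x01) -(mintD mQW mnQ x01); apply: eq_mint => t _.
    by rewrite mulmxBr mulmx1 addrNK.
  rewrite /Dt_1 {1}(D_Wmx Dt h1 h2 hD x01) -/W E E2.
  exact: first_order_sub.
have -> : 32 * e * G * (a * p) ^+ 2 * expR a * nu ^+ 2 =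
   (4 * e * G) * (2 * (nu * a * (4 * (nu * a * p) * expR a) * p)) by ring.
apply: normMC_mul_le; first exact: D_le.
have -> : nu * a * (4 * (nu * a * p) * expR a) * p =
   rint (fun t => nu * a * (4 * (nu * a * p) * expR a) * normMC (P t)) 1.
  by rewrite rint_scale// in_ML_norm.
apply: normMC_mint_le mQW (inte_scale _ iP) _ x01.
move=> t t01; rewrite mulrAC.
by apply: normMC_mul_le; [exact: nQ_le|exact: W1_le].
Qed.

Lemma decomposition x : 0 <= x <= 1 ->
  Dt x = main_part s1 s2 P x mu + remainder s1 s2 P D Dt x mu.
Proof.
move=> x01; rewrite /main_part /remainder /D_sup1 /R_2 /Dt_1 /R_0.
have -> : mint `[0, x] (fun t => R_1 P D t mu) =
    mint `[0, x] (conjPD P D) - mint `[0, x] (fun t => conjP P t mu).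
  exact: mintB.
exact: decomposition_alg.
Qed.

Lemma kP_ge0 : 0 <= kP s1 s2 P mu.
Proof. by apply: Rintegral_ge0 => t _; rewrite mulr_ge0 ?normMC_ge0 ?gamma0_ge0. Qed.

Lemma remainder_le x : 0 <= x <= 1 ->
  normMC (remainder s1 s2 P D Dt x mu) <=
  (16 * e * G * (Lam + 1) * e ^+ 2
    + (32 * e ^+ 3 * G * p + 32 * e ^+ 3 * G * (2 * G + 1) * (2 * G * p)) *
      ((Lam + 1) * e ^+ 2 + 1)
    + 32 * e ^+ 3 * G * (2 * G + 1)
    + 32 * e * G * (a * p) ^+ 2 * expR a) *
  (gamma s1 s2 mu ^+ 2 + gamma1 s1 s2 mu + nu * kP s1 s2 P mu + nu ^+ 2).
Proof.
move=> x01.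
have H1 := D_sup1_le x01; have H2 := R_2_le x01; have H3 := Dt_1_le x01.
have HR : normMC (remainder s1 s2 P D Dt x mu) <=
   normMC (D_sup1 s1 s2 D x mu) + nu * normMC (R_2 s1 s2 P D x mu) +
   normMC (Dt_1 P D Dt x mu).
  rewrite /remainder; apply: le_trans (normMC_D _ _) _; rewrite lerD2r.
  by apply: le_trans (normMC_D _ _) _; rewrite normMC_Z cabsV.
apply: le_trans HR _.
have H2' := ler_wpM2l nu0 H2.
apply: le_trans (lerD (lerD H1 H2') H3) _.
have nuq : nu * q <= (Lam + 1) * g1 + nu ^+ 2.
  by apply: le_trans (ler_prod_sqr nu0 q0) _; rewrite addrC lerD2r.
have k0 := kP_ge0; have gg0 := gamma1_ge0 s1 s2 mu; have gs0 := sqr_ge0 (gamma s1 s2 mu).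
set Ck := 32 * e ^+ 3 * G * (2 * G + 1).
set Cq := 32 * e ^+ 3 * G * p + Ck * (2 * G * p).
set Cd := 32 * e * G * (a * p) ^+ 2 * expR a.
set C1 := 16 * e * G * (Lam + 1).
have Ck0 : 0 <= Ck by rewrite !mulr_ge0 ?exprn_ge0 ?addr_ge0 ?mulr_ge0.
have Cq0 : 0 <= Cq.
  apply: addr_ge0; first by rewrite !mulr_ge0 ?exprn_ge0.
  by apply: mulr_ge0; [exact: Ck0|rewrite !mulr_ge0].
have Cd0 : 0 <= Cd by rewrite !mulr_ge0 ?exprn_ge0 ?expR_ge0 ?mulr_ge0.
have C10 : 0 <= C1 by rewrite !mulr_ge0 ?addr_ge0.
have -> : C1 * g1 + nu * (32 * e ^+ 3 * G * p * q + Ck * (kP s1 s2 P mu + 2 * q * G * p)) +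
   Cd * nu ^+ 2 = C1 * g1 + Cq * (nu * q) + Ck * (nu * kP s1 s2 P mu) + Cd * nu ^+ 2.
  by rewrite /Cq; ring.
have Hq := ler_wpM2l Cq0 nuq.
apply: (@le_trans _ _ (C1 * g1 + Cq * ((Lam + 1) * g1 + nu ^+ 2) +
   Ck * (nu * kP s1 s2 P mu) + Cd * nu ^+ 2)).
  by rewrite !lerD2r lerD2l.
rewrite /g1.
have b1 : 0 <= e ^+ 2 by exact: sqr_ge0.
have b2 : 0 <= (Lam + 1) * e ^+ 2 by rewrite mulr_ge0// addr_ge0.
have b3 : 0 <= nu * kP s1 s2 P mu by exact: mulr_ge0.
have b4 : 0 <= nu ^+ 2 by exact: sqr_ge0.
have RA := remainder_arith gg0 gs0 b3 b4 (mulr_ge0 C10 b1) (mulr_ge0 Cq0 b2) Ck0 Cq0 Cd0.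
clearbody Ck Cq Cd C1.
move: RA; apply: etrans; congr (_ <= _); ring.
Qed.

End Estimates.

(** * The constant of the theorem *)

Section Constants.
Context {R : realType}.

(** The constant of the theorem, from [d], the two L_2 norms [n1], [n2] and the
    L_1 norm [p] of the perturbation.  Here [e] bounds the growth of the
    exponentials up to a factor 2, [Lam] bounds the L_1 norm of the kernel,
    [2 * G] bounds [Ymx], and [a] is such that
    [normMC (conjPD P D t) <= a * normMC (P t)]. *)
Definition remainder_const (d n1 n2 p : R) : R :=
  let e := expR d in
  let Lam := expR (2 * d) * (2 + n1 ^+ 2 + n2 ^+ 2) in
  let G := expR (2 * Lam) in
  let a := 16 * e ^+ 2 * G ^+ 2 in
  16 * e * G * (Lam + 1) * e ^+ 2
  + (32 * e ^+ 3 * G * p + 32 * e ^+ 3 * G * (2 * G + 1) * (2 * G * p)) *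
    ((Lam + 1) * e ^+ 2 + 1)
  + 32 * e ^+ 3 * G * (2 * G + 1)
  + 32 * e * G * (a * p) ^+ 2 * expR a.

Lemma Lp_norm_ge0 (r : R) (s : R -> R[i]) : 0 <= Lp_norm r s.
Proof. by apply: fine_ge0; exact: Lnorm_ge0. Qed.

Lemma normML_ge0 (r : R) (P : R -> 'M[R[i]]_2) : 0 <= normML r P.
Proof. by rewrite sumr_ge0// => k _; rewrite sumr_ge0// => j _; exact: Lp_norm_ge0. Qed.

Lemma const_a_ge1 (s1 s2 : R -> R[i]) : 1 <= const_a s1 s2.
Proof.
have l0 : 0 <= const_l0 s1 s2 by rewrite /const_l0 le_max Lp_norm_ge0.
have l1 : 0 <= const_l1 s1 s2 by rewrite addr_ge0 ?Lp_norm_ge0.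
have lt : 0 <= const_lt s1 s2 by rewrite mulr_ge0 ?Lp_norm_ge0.
rewrite /const_a -addrA lerDl addr_ge0//.
apply: mulr_ge0; last exact: expR_ge0.
by apply: mulr_ge0; [exact: mulr_ge0|exact: addr_ge0].
Qed.

(** The lower bound on [|mu|] is used only through this inequality. *)
Lemma const_b_normML (s1 s2 : R -> R[i]) (P : R -> 'M[R[i]]_2) (d : R) (mu : R[i]) :
  0 < d -> 2 * const_b s1 s2 P * expR (2 * d) < cabs mu ->
  (cabs mu)^-1 * normML 1 P <= 2^-1.
Proof.
move=> d0 hmu; have p0 := normML_ge0 1 P; have a1 := const_a_ge1 s1 s2.
have e1 : 1 <= expR (2 * d).
  by rewrite -[leLHS](@expR0 R) ler_expR mulr_ge0// ltW.
have pb : normML 1 P <= const_b s1 s2 P.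
  by rewrite /const_b ler_peMl// exprn_ege1.
have b0 := le_trans p0 pb.
have be : const_b s1 s2 P <= const_b s1 s2 P * expR (2 * d) by rewrite ler_peMr.
have pm : 2 * normML 1 P < cabs mu.
  by apply: le_lt_trans hmu; rewrite -mulrA ler_wpM2l// (le_trans pb).
have m0 : 0 < cabs mu by apply: le_lt_trans pm; rewrite mulr_ge0.
rewrite ler_pdivrMl// -ler_pdivrMr ?invr_gt0// invrK mulrC; exact: ltW.
Qed.

End Constants.

Theorem theorem3p2 (R : realType) :
  exists a6 : R -> R -> R -> R -> R,
  forall (sigma1 sigma2 : R -> R[i]) (P : R -> 'M[R[i]]_2) (d : R),
    in_Lp 2 sigma1 -> in_Lp 2 sigma2 -> in_ML 1 P -> 0 < d ->
  forall (mu : R[i]) (D Dt : R -> 'M[R[i]]_2),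
    mu != 0 ->
    unperturbed_sol sigma1 sigma2 mu D ->
    perturbed_sol sigma1 sigma2 P mu Dt ->
    strip d mu ->
    2 * const_b sigma1 sigma2 P * expR (2 * d) < cabs mu ->
  forall x : R, 0 <= x <= 1 ->
    Dt x = main_part sigma1 sigma2 P x mu
             + remainder sigma1 sigma2 P D Dt x mu
    /\ normMC (remainder sigma1 sigma2 P D Dt x mu)
       <= a6 d (Lp_norm 2 sigma1) (Lp_norm 2 sigma2) (normML 1 P)
          * (gamma sigma1 sigma2 mu ^+ 2 + gamma1 sigma1 sigma2 mu
             + (cabs mu)^-1 * kP sigma1 sigma2 P mu + (cabs mu) ^- 2).
Proof.
exists remainder_const => s1 s2 P d h1 h2 hP d0 mu D Dt _ hD hDt mud hmu x x01.
split; first exact: (decomposition Dt h1 h2 hP hD x01).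
rewrite -exprVn.
exact: (remainder_le h1 h2 hP d0 mud hD hDt (const_b_normML d0 hmu) x01).
Qed.
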